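(* Let $\mathfrak g=\mathbb R e_7\ltimes_A\mathfrak h$ be a seven-dimensional almost-abelian Lie algebra endowed with a coclosed $G_2$-structure $\varphi_0$, where $e_7$ is a unit vector $g_{\varphi_0}$-orthogonal to the codimension-one abelian ideal $\mathfrak h$ and $A=\mathrm{ad}_{e_7}|_{\mathfrak h}$. The 4-form $\phi_0=\star_{\varphi_0}\varphi_0$ is a soliton for the Laplacian coflow if and only if there is a constant $c\in\mathbb R$ such that $A$ satisfies $$\left[-\Sigma-\tfrac12[A,A^\dagger],\,A\right]=\delta A\quad\text{on }\mathfrak h,\qquad \delta=l^2+s^2-c,$$ where $A^\dagger$ is the transpose of $A$ with respect to the metric on $\mathfrak h$, and $\Sigma$, $l$, $s^2$ are defined in the context. If $\phi_0$ is a soliton (with constant $c$), then the solution $\phi_t$ of the Laplacian coflow starting at $\phi_0$ is given by $$\phi_t=c(t)\,e^{f(t)D}\phi_0,\qquad c(t)=(1-2ct)^2,\qquad f(t)=-\frac{1}{2c}\ln(1-2ct),\qquad t<\frac1{2c},$$ where the derivation $D$ of $\mathfrak g$ is $D=X_0-c\,\mathrm{Id}$, with $X_0$ as in the context. (For $c=0$ read $c(t)=1$, $f(t)=t$, for all $t$; in general the condition on $t$ is $1-2ct>0$.)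
   Context: Almost-abelian: $\mathfrak g=\mathbb R e_7\ltimes_A\mathfrak h$ has a codimension-one abelian ideal $\mathfrak h$ and $[e_7,v]=Av$ for $v\in\mathfrak h$. A $G_2$-structure on a 7-dimensional Lie algebra $\mathfrak g$ is a 3-form $\varphi$ which in some coframe $(e^1,\dots,e^7)$ is $\varphi=e^{127}+e^{347}+e^{567}+e^{135}-e^{146}-e^{236}-e^{245}$; it determines the metric $g_\varphi$ and orientation for which this coframe is orthonormal and positive, and the dual 4-form is $\phi=\star_\varphi\varphi=e^{1234}+e^{3456}+e^{1256}-e^{2467}+e^{1367}+e^{1457}+e^{2357}$. It is coclosed if $d\phi=0$, $d$ being the Chevalley–Eilenberg differential. Laplacian coflow on $\mathfrak g$: $\dot\phi_t=-\Delta_t\phi_t$, $d\phi_t=0$, with initial value $\phi_0$, where $\phi_t$ is the dual 4-form of a $G_2$-structure on $\mathfrak g$ and $\Delta_t=dd^*+d^*d$ is the Hodge Laplacian of its metric and orientation (so $\Delta_t\phi_t=d\star_td\star_t\phi_t$). $\vartheta$ is the action of endomorphisms on forms: $\vartheta(X)\alpha=-\alpha\circ X$ on 1-forms, extended as a derivation; $e^{f D}\phi_0$ means $\exp(f\,\vartheta(D))\phi_0$. Induced $\mathrm{SU}(3)$-structure on $\mathfrak h$: $\omega_0$ and $\psi_0$ are the restrictions to $\mathfrak h$ of the contractions of $e_7$ with $\varphi_0$ and $-\phi_0$. An adapted frame of $\mathfrak h$ is a basis $(f_1,\dots,f_6)$ with $\omega_0=f^{12}+f^{34}+f^{56}$,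 $\psi_0=-f^{246}+f^{136}+f^{145}+f^{235}$; it is orthonormal, and $J_0f_{2k-1}=f_{2k}$, $J_0f_{2k}=-f_{2k-1}$. Coclosedness of $\varphi_0$ is equivalent to $A\in\mathfrak{sp}(\mathfrak h,\omega_0)$. Let $S$ and $L$ be the symmetric and skew-symmetric parts of $A$, extended by $0$ on $e_7$; $L|_{\mathfrak h}$ commutes with $J_0$. There exist $\theta\in[0,2\pi]$, $s_1,s_2,s_3\in\mathbb R$ and an adapted frame, written $(e_1,J_0e_1,e_2,J_0e_2,e_3,J_0e_3)$, with $Se_i=s_i(\cos\theta\,e_i+\sin\theta\,J_0e_i)$, $SJ_0e_i=-s_i(-\sin\theta\,e_i+\cos\theta\,J_0e_i)$. Put $a=\cos\theta$, $b=\sin\theta$, $s^2=s_1^2+s_2^2+s_3^2$, and let $l$ be the imaginary part of the complex trace of $L|_{\mathfrak h}$ (as a complex endomorphism of $(\mathfrak h,J_0)$). Let $\Sigma$ be the endomorphism of $\mathfrak g$ with $\Sigma e_7=-s^2e_7$ which preserves each plane $\langle e_i,J_0e_i\rangle$ and has there, in the basis $(e_i,J_0e_i)$, the matrix $$s_js_k\begin{pmatrix}-2+4a^2&-4ab\\-4ab&2-4a^2\end{pmatrix},\qquad \{i,j,k\}=\{1,2,3\}.$$ Let $\Lambda$ be the endomorphism of $\mathfrak g$ vanishing on $\mathfrak h$ with $\Lambda e_7=-l^2e_7$, and set $$X_0=-(\Sigma+\Lambda-[S,L]).$$ Then $X_0$ is symmetric and $-\Delta_0\phi_0=\vartheta(X_0)\phi_0$.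 Soliton: $\phi_0$ is a soliton if $X_0=c\,\mathrm{Id}+D$ for some $c\in\mathbb R$ and some derivation $D$ of $\mathfrak g$ (so that $-\Delta_0\phi_0=-4c\,\phi_0+\vartheta(D)\phi_0$). *)

(* Defs.v *)
From HB Require Import structures.
From mathcomp Require Import all_boot all_order all_algebra.
From mathcomp Require Import complex.
From mathcomp Require Import all_classical all_reals all_analysis.

Set Implicit Arguments.
Unset Strict Implicit.
Unset Printing Implicit Defensive.

Import Order.TTheory GRing.Theory Num.Theory.
Import numFieldNormedType.Exports.

Local Open Scope ring_scope.
Local Open Scope classical_set_scope.

Section LieAlgebra.
Context {R : realType} {g : vectType R}.

(* A bilinear bracket is a linear map [br] with [br x = ad x], [br x y = [x, y]]. *)
Definition is_lie_bracket (br : 'Hom(g, 'End(g))) : Prop :=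
  (forall x, br x x = 0) /\
  (forall x y z, br x (br y z) + br y (br z x) + br z (br x y) = 0).

Definition is_abelian_ideal (br : 'Hom(g, 'End(g))) (h : {vspace g}) : Prop :=
  (forall x v, v \in h -> br x v \in h) /\
  (forall v w, v \in h -> w \in h -> br v w = 0).

Definition is_derivation (br : 'Hom(g, 'End(g))) (D : 'End(g)) : Prop :=
  forall x y, D (br x y) = br (D x) y + br x (D y).

Definition commutator (X Y : 'End(g)) : 'End(g) := (X \o Y)%VF - (Y \o X)%VF.

End LieAlgebra.

(* A k-form is represented by its values on k-tuples of vectors.  The forms
   considered below are all obtained from determinants of coordinates, hence are
   multilinear and alternating, so this is not required separately. *)
Definition kform {R : realType} (g : vectType R) (k : nat) : Type :=
  k.-tuple g -> R.

Section Forms.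
Context {R : realType} {g : vectType R}.

(* e^{i_1 ... i_k} for the coframe dual to the basis [b]; the indices in [I]
   are numbered from 1, and e^{12}(u,v) = e^1(u) e^2(v) - e^1(v) e^2(u). *)
Definition coform {n : nat} (b : n.+1.-tuple g) {k : nat} (I : seq nat) :
    kform g k :=
  fun v => \det (\matrix_(i < k, j < k)
                   coord b (inord (nth 0%N I i).-1) (tnth v j)).

Definition interior_prod {k : nat} (x : g) (alpha : kform g k.+1) : kform g k :=
  fun v => alpha [tuple of x :: v].

(* (d alpha)(v_0, ..., v_{k+1})
     = \sum_(i < j) (-1)^(i+j) alpha([v_i, v_j], v_0, .., ^i, .., ^j, .., v_{k+1});
   for i < j one has [lift j i = i], and [lift j (lift i m)] enumerates the
   indices other than i and j in increasing order. *)
Definition ext_d (br : 'Hom(g, 'End(g))) {k : nat} (alpha : kform g k.+1) :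
    kform g k.+2 :=
  fun v => \sum_(j < k.+2) \sum_(i < k.+1 | (i < j)%N)
    (-1) ^+ (i + j) *
    alpha [tuple of br (tnth v (lift j i)) (tnth v j) ::
                    [tuple tnth v (lift j (lift i m)) | m < k]].

(* theta(X) alpha (v_1, .., v_k) = - \sum_i alpha(v_1, .., X v_i, .., v_k). *)
Definition vartheta (X : 'End(g)) {k : nat} (alpha : kform g k) : kform g k :=
  fun v => - \sum_(i < k)
    alpha [tuple if j == i then X (tnth v j) else tnth v j | j < k].

(* exp(T) alpha = \sum_n T^n alpha / n!, the limit being taken pointwise. *)
Definition exp_op {k : nat} (T : kform g k -> kform g k) (alpha : kform g k) :
    kform g k :=
  fun v => limn (series (fun n => (n`!%:R)^-1 * iter n T alpha v)).

(* e^{f D} alpha = exp(f theta(D)) alpha *)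
Definition exp_act (f : R) (D : 'End(g)) {k : nat} (alpha : kform g k) :
    kform g k :=
  exp_op (fun (beta : kform g k) v => f * vartheta D beta v) alpha.

Definition metric (E : 7.-tuple g) (u v : g) : R :=
  \sum_(i < 7) coord E i u * coord E i v.

Definition transpose (E : 7.-tuple g) (T : 'End(g)) : 'End(g) :=
  linfun (fun v => \sum_(i < 7) metric E v (T (tnth E i)) *: tnth E i).

Definition vol (E : 7.-tuple g) (s : seq g) : R :=
  \det (\matrix_(i < 7, j < 7) coord E i (nth 0 s j)).

(* (hodge alpha)_J = (1/k!) \sum_I alpha_I vol_{I J}, so that
   alpha /\ hodge alpha = |alpha|^2 vol. *)
Definition hodge (E : 7.-tuple g) {k : nat} (alpha : kform g k) :
    kform g (7 - k) :=
  fun v => (k`!%:R)^-1 *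
    \sum_(I : k.-tuple 'I_7)
      alpha [tuple of map (tnth E) I] * vol E (map (tnth E) I ++ v).

(* In dimension 7 the codifferential on k-forms is
   d^* = (-1)^k hodge d hodge. *)
Definition codiff4 (br : 'Hom(g, 'End(g))) (E : 7.-tuple g) (alpha : kform g 4) :
    kform g 3 :=
  hodge E (ext_d br (hodge E alpha : kform g 3) : kform g 4).

Definition codiff5 (br : 'Hom(g, 'End(g))) (E : 7.-tuple g) (alpha : kform g 5) :
    kform g 4 :=
  fun v => - (hodge E (ext_d br (hodge E alpha : kform g 2) : kform g 3)
                : kform g 4) v.

Definition laplacian4 (br : 'Hom(g, 'End(g))) (E : 7.-tuple g)
    (alpha : kform g 4) : kform g 4 :=
  fun v => ext_d br (codiff4 br E alpha) v + codiff5 br E (ext_d br alpha) v.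

Definition phi_std (E : 7.-tuple g) : kform g 3 := fun v =>
  let e I := coform E I v in
  e [:: 1; 2; 7]%N + e [:: 3; 4; 7]%N + e [:: 5; 6; 7]%N + e [:: 1; 3; 5]%N
  - e [:: 1; 4; 6]%N - e [:: 2; 3; 6]%N - e [:: 2; 4; 5]%N.

(* [phi] is a G2-structure, and [E] is the basis dual to a coframe in which it
   has the standard expression; [metric E], [vol E] and [hodge E] are then the
   metric, volume form and Hodge star of [phi]. *)
Definition G2_frame (phi : kform g 3) (E : 7.-tuple g) : Prop :=
  basis_of fullv E /\ phi =1 phi_std E.

(* For a fixed [t] the choice of [E] is immaterial: all the G2-frames of
   [phi] have the same metric and orientation. *)
Definition is_coflow_solution (br : 'Hom(g, 'End(g))) (Phi0 : kform g 4)
    (I : set R) (Phi : R -> kform g 4) : Prop :=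
  [/\ open I, is_interval I, I 0, Phi 0 =1 Phi0 &
      forall t, I t -> exists (phi : kform g 3) (E : 7.-tuple g),
        [/\ G2_frame phi E,
            Phi t =1 (hodge E phi : kform g 4),
            ext_d br (Phi t) =1 (fun=> 0) &
            forall v, is_derive t 1 (fun s => Phi s v)
                        (- laplacian4 br E (Phi t) v)]].

Definition omega_ind (e7 : g) (phi : kform g 3) : kform g 2 := interior_prod e7 phi.

Definition psi_ind (e7 : g) (Phi : kform g 4) : kform g 3 :=
  fun v => - interior_prod e7 Phi v.

Definition adapted_frame (h : {vspace g}) (omega : kform g 2) (psi : kform g 3)
    (f : 6.-tuple g) : Prop :=
  [/\ basis_of h f,
      forall v : 2.-tuple g, {subset v <= h} ->
        let e I := coform f I v in
        omega v = e [:: 1; 2]%N + e [:: 3; 4]%N + e [:: 5; 6]%N &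
      forall v : 3.-tuple g, {subset v <= h} ->
        let e I := coform f I v in
        psi v = - e [:: 2; 4; 6]%N + e [:: 1; 3; 6]%N + e [:: 1; 4; 5]%N
                + e [:: 2; 3; 5]%N].

(* An adapted frame is read as (e_0, J e_0, e_1, J e_1, e_2, J e_2). *)
Definition fr (f : 6.-tuple g) (i : 'I_3) : g := f`_(i.*2).
Definition Jfr (f : 6.-tuple g) (i : 'I_3) : g := f`_(i.*2.+1).

(* As [ad e7] vanishes on e7 and preserves the orthogonal complement of e7, its
   transpose on the whole algebra is the transpose of A on the ideal, extended
   by 0 on e7. *)
Definition sympart (E : 7.-tuple g) (A : 'End(g)) : 'End(g) :=
  2^-1 *: (A + transpose E A).
Definition skewpart (E : 7.-tuple g) (A : 'End(g)) : 'End(g) :=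
  2^-1 *: (A - transpose E A).

(* The matrix, in the complex basis (e_0, e_1, e_2) of (h, J), of a J-linear
   endomorphism of h. *)
Definition complex_mx (f : 6.-tuple g) (L : 'End(g)) : 'M[R[i]]_3 :=
  \matrix_(i, j) Complex (coord f (inord i.*2) (L (fr f j)))
                         (coord f (inord i.*2.+1) (L (fr f j))).

Definition im_trace (f : 6.-tuple g) (L : 'End(g)) : R :=
  complex.Im (\tr (complex_mx f L)).

Definition diagonalizes (f : 6.-tuple g) (theta : R) (s : 'I_3 -> R)
    (S : 'End(g)) : Prop :=
  forall i : 'I_3,
    S (fr f i) = s i *: (cos theta *: fr f i + sin theta *: Jfr f i) /\
    S (Jfr f i) = - (s i *: (- sin theta *: fr f i + cos theta *: Jfr f i)).

Definition sqnorm (s : 'I_3 -> R) : R := \sum_i s i ^+ 2.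

Definition is_Sigma (e7 : g) (f : 6.-tuple g) (theta : R) (s : 'I_3 -> R)
    (Sigma : 'End(g)) : Prop :=
  let a := cos theta in
  let b := sin theta in
  Sigma e7 = - sqnorm s *: e7 /\
  forall i : 'I_3,
    let sjk := \prod_(m | m != i) s m in
    Sigma (fr f i) =
      sjk *: ((- 2 + 4 * a ^+ 2) *: fr f i + (- 4 * a * b) *: Jfr f i) /\
    Sigma (Jfr f i) =
      sjk *: ((- 4 * a * b) *: fr f i + (2 - 4 * a ^+ 2) *: Jfr f i).

Definition is_Lambda (h : {vspace g}) (e7 : g) (l : R) (Lambda : 'End(g)) :
    Prop :=
  (forall v, v \in h -> Lambda v = 0) /\ Lambda e7 = - l ^+ 2 *: e7.

Definition soliton_with (br : 'Hom(g, 'End(g))) (X0 : 'End(g)) (c : R) : Prop :=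
  exists D : 'End(g), is_derivation br D /\ X0 = c *: \1%VF + D.

Definition is_soliton (br : 'Hom(g, 'End(g))) (X0 : 'End(g)) : Prop :=
  exists c : R, soliton_with br X0 c.

Definition coflow_scale (c t : R) : R := (1 - 2 * c * t) ^+ 2.

Definition coflow_time (c t : R) : R :=
  if c == 0 then t else - (2 * c)^-1 * ln (1 - 2 * c * t).

End Forms.

(* Main.v *)
(** In the frame [(f, e7)], where [f] is the adapted frame of the ideal, the
    identity [- Laplacian Phi0 = vartheta X0 Phi0] is a polynomial identity
    between components, and [X0 = c + D] is a derivation condition that only
    involves the brackets [[e7, v] = A v].  If [D] is a derivation then
    [exp (m D)] is an automorphism, so the Laplacian is natural under it, and
    rescaling turns the identity at time 0 into the flow equation along
    [c(t) e^{f(t) D} Phi0].  As [X0] is symmetric, [exp (m D)] is explicit in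
    an eigenbasis.  For uniqueness, the metric is recovered from the 4-form:
    contracting two copies of [*Phi] with [Phi] gives the Gram matrix up to a
    power of the determinant, so the right-hand side of the flow is a locally
    Lipschitz function of the components of [Phi], and Gronwall's inequality
    applies. *)

From HB Require Import structures.
From mathcomp Require Import all_boot all_order all_algebra.
From mathcomp Require Import all_fingroup.
From mathcomp Require Import complex.
From mathcomp Require Import all_classical all_reals all_analysis.
From mathcomp Require Import ring lra.
Require Import Defs.

Set Implicit Arguments.
Unset Strict Implicit.
Unset Printing Implicit Defensive.

Import Order.TTheory GRing.Theory Num.Theory.
Import numFieldNormedType.Exports.

Local Open Scope ring_scope.
Local Open Scope classical_set_scope.

(** Three obstacles shape the proof. A solution supplies at each time some G2-frame, with no
    regularity in [t]; hence the Lipschitz estimates concern functions of a frame [E], with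
    distances measured on the components of [Phi_std E], and the frames themselves are never
    compared. Secondly, in dimension seven the 4-form determines the metric but not the orientation:
    [E] and [-E] give the same 4-form and opposite volume forms. A single Hodge star is thus
    controlled only up to the sign of a determinant; the flow equation is controlled because it
    contains two stars. Thirdly, the adapted frame is given only by the shape of [omega] and [psi];
    that it is orthonormal, and with [e7] has the right orientation, is derived through the cross
    product with [e7]. The scaling has a simple origin. With [q = 1 - 2ct], the map
    [q^(-1/2) e^(fD)] carries the initial frame to a frame of the solution: pullback by its inverse
    multiplies 4-forms by [q^2], beside the action of [e^(fD)], while the Laplacian, with two
    derivatives, only gets [q], which is what differentiating [q^2] leaves. *)

Section Tuples.

Lemma sum_tuple0 (V : nmodType) (n : nat) (F : 0.-tuple 'I_n -> V) :
  \sum_(I : 0.-tuple 'I_n) F I = F [tuple].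
Proof. by rewrite (big_pred1 [tuple]) // => I; apply/esym/eqP; exact: tuple0. Qed.

Lemma sum_tupleS (V : nmodType) (n k : nat) (F : k.+1.-tuple 'I_n -> V) :
  \sum_(I : k.+1.-tuple 'I_n) F I =
  \sum_(i < n) \sum_(I : k.-tuple 'I_n) F [tuple of i :: I].
Proof.
rewrite pair_big /=.
rewrite (reindex (fun p : 'I_n * k.-tuple 'I_n => [tuple of p.1 :: p.2])) //=.
exists (fun I : k.+1.-tuple 'I_n => (thead I, [tuple of behead I])).
  by move=> [i I] _ /=; congr pair; apply: val_inj.
by move=> I _ /=; rewrite [RHS]tuple_eta; apply: val_inj.
Qed.

End Tuples.

(** * Multilinear and alternating forms as functions on tuples *)

Section Multilinear.
Context {R : realType} {g : vectType R}.

Definition upd {k : nat} (v : k.-tuple g) (i : 'I_k) (x : g) : k.-tuple g :=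
  [tuple if j == i then x else tnth v j | j < k].

Lemma tnth_upd k (v : k.-tuple g) i x j :
  tnth (upd v i x) j = if j == i then x else tnth v j.
Proof. by rewrite tnth_mktuple. Qed.

Lemma upd_id k (v : k.-tuple g) i : upd v i (tnth v i) = v.
Proof. by apply: eq_from_tnth => j; rewrite tnth_upd; case: eqP => [->|]. Qed.

Lemma updC k (v : k.-tuple g) i j x y : i != j ->
  upd (upd v i x) j y = upd (upd v j y) i x.
Proof.
move=> ij; apply: eq_from_tnth => m; rewrite !tnth_upd.
by case: (eqVneq m j) => [->|//]; rewrite eq_sym (negbTE ij).
Qed.

Lemma upd_cons0 k (x y : g) (v : k.-tuple g) :
  upd [tuple of x :: v] ord0 y = [tuple of y :: v].
Proof.
apply: eq_from_tnth => j; rewrite tnth_upd.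
by case: (unliftP ord0 j) => [i|] ->; rewrite ?eqxx ?tnth0 //= !tnthS.
Qed.

Lemma upd_consS k (x y : g) (v : k.-tuple g) i :
  upd [tuple of x :: v] (lift ord0 i) y = [tuple of x :: upd v i y].
Proof.
apply: eq_from_tnth => j; rewrite tnth_upd.
case: (unliftP ord0 j) => [m|] ->; last by rewrite !tnth0.
by rewrite (inj_eq lift_inj) !tnthS tnth_upd.
Qed.

Definition mlin {k : nat} (al : kform g k) : Prop :=
  forall v i c x y,
    al (upd v i (c *: x + y)) = c * al (upd v i x) + al (upd v i y).

Definition is_alternating {k : nat} (al : kform g k) : Prop :=
  forall v i j, i != j -> tnth v i = tnth v j -> al v = 0.

Lemma mlinD k (al : kform g k) v i x y : mlin al ->
  al (upd v i (x + y)) = al (upd v i x) + al (upd v i y).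
Proof. by move=> al_lin; rewrite -[x in LHS]scale1r al_lin mul1r. Qed.

Lemma mlin0 k (al : kform g k) v i : mlin al -> al (upd v i 0) = 0.
Proof.
move=> al_lin; have := al_lin v i 1 0 0.
by rewrite scaler0 addr0 mul1r -[X in X = _]addr0 => /addrI/esym.
Qed.

Lemma mlinZ k (al : kform g k) v i c x : mlin al ->
  al (upd v i (c *: x)) = c * al (upd v i x).
Proof. by move=> al_lin; rewrite -[c *: x]addr0 al_lin mlin0 // addr0. Qed.

Lemma mlin_suml k (al : kform g k) v i (I : finType) (F : I -> g) : mlin al ->
  al (upd v i (\sum_j F j)) = \sum_j al (upd v i (F j)).
Proof.
move=> al_lin; elim/big_rec2: _ => [|j y1 y2 _ <-]; first exact: mlin0.
by rewrite mlinD.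
Qed.

Lemma mlin_cons k (al : kform g k.+1) x : mlin al ->
  mlin (fun v : k.-tuple g => al [tuple of x :: v]).
Proof. by move=> al_lin v i c y z; rewrite -!upd_consS al_lin. Qed.

Lemma mlin_expand k n (al : kform g k) (c : 'I_k -> 'I_n -> R) (b : 'I_n -> g) :
  mlin al ->
  al [tuple \sum_(i < n) c a i *: b i | a < k] =
  \sum_(I : k.-tuple 'I_n) (\prod_(a < k) c a (tnth I a)) * al (map_tuple b I).
Proof.
elim: k al c => [|k IH] al c al_lin.
  by rewrite sum_tuple0 big_ord0 mul1r; congr al; apply: eq_from_tnth => -[].
have -> : [tuple \sum_(i < n) c a i *: b i | a < k.+1] =
    upd [tuple of 0 :: [tuple \sum_(i < n) c (lift ord0 a) i *: b i | a < k]]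
        ord0 (\sum_(i < n) c ord0 i *: b i).
  apply: eq_from_tnth => j; rewrite upd_cons0 tnth_mktuple.
  by case: (unliftP ord0 j) => [i|] ->; rewrite ?tnth0 ?tnthS ?tnth_mktuple.
rewrite mlin_suml // sum_tupleS; apply: eq_bigr => i _.
rewrite mlinZ // upd_cons0.
rewrite (IH (fun v => al [tuple of b i :: v])); last exact: mlin_cons.
rewrite mulr_sumr; apply: eq_bigr => I _.
rewrite big_ord_recl tnth0 mulrA; congr (_ * _ * al _).
  by apply: eq_bigr => a _; rewrite tnthS.
exact: val_inj.
Qed.

Lemma basis_expand n (b : n.-tuple g) v : basis_of fullv b ->
  v = \sum_(i < n) coord b i v *: tnth b i.
Proof.
move=> bB; rewrite {1}(coord_basis bB (memvf v)).
by apply: eq_bigr => i _; rewrite (tnth_nth 0).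
Qed.

Lemma mlin_coord k n (b : n.-tuple g) (al : kform g k) (v : k.-tuple g) :
  basis_of fullv b -> mlin al ->
  al v = \sum_(I : k.-tuple 'I_n)
    (\prod_(a < k) coord b (tnth I a) (tnth v a)) * al (map_tuple (tnth b) I).
Proof.
move=> bB al_lin; rewrite -(mlin_expand (fun a i => coord b i (tnth v a))) //.
congr al.
by apply: eq_from_tnth => a; rewrite tnth_mktuple -basis_expand.
Qed.

Lemma mlin_ext k n (b : n.-tuple g) (al be : kform g k) :
  basis_of fullv b -> mlin al -> mlin be ->
  (forall I : k.-tuple 'I_n, al (map_tuple (tnth b) I) = be (map_tuple (tnth b) I)) ->
  al =1 be.
Proof.
move=> bB al_lin be_lin albe v; rewrite (mlin_coord _ bB al_lin).
rewrite (mlin_coord _ bB be_lin).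
by apply: eq_bigr => I _; rewrite albe.
Qed.

(* The sums on both sides are the full contraction of [al] with [be] through
   the tensor [\sum_c e_c (x) e'_c = \sum_a w_a (x) b_a]. *)
Lemma mlin_contraction k n (al be : kform g k) (M : 'I_n -> 'I_n -> R)
    (b e e' w : 'I_n -> g) :
  mlin al -> mlin be ->
  (forall a, w a = \sum_c M a c *: e c) ->
  (forall c, e' c = \sum_a M a c *: b a) ->
  \sum_(I : k.-tuple 'I_n) al (map_tuple w I) * be (map_tuple b I) =
  \sum_(L : k.-tuple 'I_n) al (map_tuple e L) * be (map_tuple e' L).
Proof.
move=> al_lin be_lin wE e'E.
have -> : \sum_(I : k.-tuple 'I_n) al (map_tuple w I) * be (map_tuple b I) =
    \sum_(I : k.-tuple 'I_n) \sum_(L : k.-tuple 'I_n)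
     (\prod_(a < k) M (tnth I a) (tnth L a)) *
       (al (map_tuple e L) * be (map_tuple b I)).
  apply: eq_bigr => I _.
  have -> : map_tuple w I = [tuple \sum_(c < n) M (tnth I a) c *: e c | a < k].
    by apply: eq_from_tnth => a; rewrite tnth_map tnth_mktuple wE.
  rewrite mlin_expand // mulr_suml; apply: eq_bigr => L _.
  by rewrite mulrA.
rewrite exchange_big; apply: eq_bigr => L _ /=.
have -> : map_tuple e' L = [tuple \sum_(a < n) M a (tnth L c) *: b a | c < k].
  by apply: eq_from_tnth => a; rewrite tnth_map tnth_mktuple e'E.
rewrite mlin_expand // mulr_sumr; apply: eq_bigr => I _.
by rewrite mulrCA.
Qed.

Lemma alternating_swap k (al : kform g k) (v : k.-tuple g) (i j : 'I_k) :
  mlin al -> is_alternating al -> i != j ->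
  al [tuple tnth v (tperm i j a) | a < k] = - al v.
Proof.
move=> al_lin al_alt ij.
set x := tnth v i; set y := tnth v j.
have swapE : [tuple tnth v (tperm i j a) | a < k] = upd (upd v i y) j x.
  apply: eq_from_tnth => a; rewrite tnth_mktuple !tnth_upd.
  case: tpermP => [->|->|/eqP/negbTE-> /eqP/negbTE-> //].
    by rewrite (negbTE ij) eqxx.
  by rewrite eqxx.
have vE : v = upd (upd v i x) j y by rewrite upd_id upd_id.
have z : al (upd (upd v i (x + y)) j (x + y)) = 0.
  by apply: (al_alt _ i j ij); rewrite !tnth_upd !eqxx (negbTE ij).
have zd u : al (upd (upd v i u) j u) = 0.
  by apply: (al_alt _ i j ij); rewrite !tnth_upd !eqxx (negbTE ij).
move: z; rewrite mlinD // !(updC _ _ _ ij) !mlinD // -!(updC _ _ _ ij) !zd.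
by rewrite add0r addr0 swapE -vE => /eqP; rewrite addr_eq0 => /eqP.
Qed.

Lemma alternating_perm k (al : kform g k) (v : k.-tuple g) (s : 'S_k) :
  mlin al -> is_alternating al ->
  al [tuple tnth v (s a) | a < k] = (-1) ^+ s * al v.
Proof.
move=> al_lin al_alt; have [ts -> /allP dts] := prod_tpermP s.
elim: ts dts v => [|t ts IH] dts v.
  rewrite big_nil odd_perm1 mul1r; congr al.
  by apply: eq_from_tnth => a; rewrite tnth_mktuple perm1.
have t12 : t.1 != t.2 := dts t (mem_head t ts).
rewrite big_cons odd_mul_tperm t12.
set p := (\prod_(_ <- _) _)%g.
have -> : [tuple tnth v ((tperm t.1 t.2 * p)%g a) | a < k] =
    [tuple tnth [tuple tnth v (p c) | c < k] (tperm t.1 t.2 a) | a < k].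
  by apply: eq_from_tnth => a; rewrite !tnth_mktuple permM.
rewrite alternating_swap // IH ?signr_addb ?expr1 ?mulN1r ?mulNr //.
by move=> u uts; apply: dts; rewrite in_cons uts orbT.
Qed.

(** A multi-index with a repetition gives zero on both sides, and any other is a permutation of its
    sorted version. Tables therefore need checking on increasing multi-indices only. *)
Lemma alternating_ext k n (b : n.-tuple g) (al be : kform g k) :
  basis_of fullv b -> mlin al -> mlin be -> is_alternating al -> is_alternating be ->
  (forall I : k.-tuple 'I_n, sorted ltn (map val I) ->
     al (map_tuple (tnth b) I) = be (map_tuple (tnth b) I)) ->
  al =1 be.
Proof.
move=> bB al_lin be_lin al_alt be_alt albe; apply: (mlin_ext bB) => // I.
have [inj|/injectivePn[i [j ij Iij]]] := boolP (injectiveb (tnth I)); last first.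
  by rewrite (al_alt _ i j ij) ?(be_alt _ i j ij) // !tnth_map Iij.
have uI : uniq I by apply/tuple_uniqP/injectiveP.
pose J := sort_tuple (fun i j : 'I_n => (i <= j)%N) I.
have [p IE] : exists p : 'S_k, I = [tuple tnth J (p a) | a < k].
  have /tuple_permP[p Ip] : perm_eq I J by rewrite perm_sym perm_sort.
  by exists p; apply: val_inj.
have bIE : map_tuple (tnth b) I = [tuple tnth (map_tuple (tnth b) J) (p a) | a < k].
  by apply: eq_from_tnth => a; rewrite {1}IE !(tnth_mktuple, tnth_map).
rewrite bIE !alternating_perm // albe //.
rewrite ltn_sorted_uniq_leq map_inj_uniq ?sort_uniq ?uI /=; last exact: val_inj.
by rewrite sorted_map; apply: sort_sorted => i j; apply: leq_total.
Qed.

End Multilinear.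

(** * Linearity and alternation of [coform], [vol], [hodge] and [vartheta] *)

Section BasicForms.
Context {R : realType} {g : vectType R}.

Lemma nth_upd k (v : k.-tuple g) (p : 'I_k) x m :
  nth 0 (upd v p x) m = if m == p :> nat then x else nth 0 v m.
Proof.
have [mk|km] := ltnP m k; last first.
  by rewrite !nth_default ?size_tuple //; case: eqP km => // ->; rewrite leqNgt ltn_ord.
by rewrite -[m]/(val (Ordinal mk)) -!tnth_nth tnth_upd.
Qed.

(** The rows are arbitrary linear functionals, so that the lemma serves both [coform] and [vol]. *)
Lemma det_col_linear k (F : 'I_k -> g -> R) (v v1 v2 : 'I_k -> g) p c :
  (forall i x y, F i (c *: x + y) = c * F i x + F i y) ->
  v p = c *: v1 p + v2 p ->
  (forall j, j != p -> v1 j = v j) -> (forall j, j != p -> v2 j = v j) ->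
  \det (\matrix_(i, j) F i (v j)) =
  c * \det (\matrix_(i, j) F i (v1 j)) + \det (\matrix_(i, j) F i (v2 j)).
Proof.
move=> Flin vp v1E v2E.
rewrite -[LHS]det_tr -[\det (\matrix_(i, j) F i (v1 j))]det_tr.
rewrite -[\det (\matrix_(i, j) F i (v2 j))]det_tr.
rewrite -[X in _ + X]mul1r; apply: (determinant_multilinear (i0 := p)).
- by apply/rowP => j; rewrite !mxE vp Flin mul1r.
- by apply/matrixP => i j; rewrite !mxE v1E // eq_sym neq_lift.
- by apply/matrixP => i j; rewrite !mxE v2E // eq_sym neq_lift.
Qed.

Lemma det_col_eq k (F : 'I_k -> g -> R) (v : 'I_k -> g) p q : p != q ->
  v p = v q -> \det (\matrix_(i, j) F i (v j)) = 0.
Proof.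
move=> pq vpq; rewrite -det_tr; apply: (determinant_alternate pq) => i.
by rewrite !mxE vpq.
Qed.

Lemma coform_mlin n (b : n.+1.-tuple g) k I : mlin (coform b I : kform g k).
Proof.
move=> v p c x y.
apply: (det_col_linear (F := fun i => coord b (inord (nth 0%N I i).-1)) (p := p)
  (v := tnth (upd v p (c *: x + y))) (v1 := tnth (upd v p x)) (v2 := tnth (upd v p y))).
- by move=> i u w; rewrite linearP.
- by rewrite !tnth_upd eqxx.
- by move=> j jp; rewrite !tnth_upd (negbTE jp).
- by move=> j jp; rewrite !tnth_upd (negbTE jp).
Qed.

Lemma coform_alternating n (b : n.+1.-tuple g) k I :
  is_alternating (coform b I : kform g k).
Proof.
move=> v i j ij vij.
exact: (det_col_eq (fun i => coord b (inord (nth 0%N I i).-1)) (v := tnth v) ij).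
Qed.

(** Slots are addressed by position in a bare list, because [hodge] applies [vol] to concatenations
    in which the varying vectors may come first or last. *)
Lemma vol_linear (E : 7.-tuple g) (s s1 s2 : seq g) (q : nat) c : (q < 7)%N ->
  nth 0 s q = c *: nth 0 s1 q + nth 0 s2 q ->
  (forall m, m != q -> nth 0 s1 m = nth 0 s m) ->
  (forall m, m != q -> nth 0 s2 m = nth 0 s m) ->
  vol E s = c * vol E s1 + vol E s2.
Proof.
move=> q7 sq s1E s2E.
apply: (det_col_linear (F := coord E) (p := Ordinal q7) (v := fun j : 'I_7 => nth 0 s j)
  (v1 := fun j : 'I_7 => nth 0 s1 j) (v2 := fun j : 'I_7 => nth 0 s2 j)) => //.
- by move=> i x y; rewrite linearP.
- by move=> j jq; rewrite s1E.
- by move=> j jq; rewrite s2E.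
Qed.

Lemma vol_eq0 (E : 7.-tuple g) (s : seq g) (p q : nat) : (p < 7)%N -> (q < 7)%N ->
  p != q -> nth 0 s p = nth 0 s q -> vol E s = 0.
Proof.
move=> p7 q7 pq spq.
exact: (@det_col_eq 7 (coord E) (fun j => nth 0 s j) (Ordinal p7) (Ordinal q7)).
Qed.

Lemma vol_catl_mlin (E : 7.-tuple g) k (s : seq g) : (k <= 7)%N ->
  mlin (fun u : k.-tuple g => vol E (u ++ s)).
Proof.
move=> k7 v p c x y; have pk := ltn_ord p.
apply: (@vol_linear E _ _ _ p) => [||m mp|m mp]; first exact: leq_trans pk k7.
- by rewrite !nth_cat !size_tuple pk !nth_upd eqxx.
- by rewrite !nth_cat !size_tuple !nth_upd (negbTE mp).
- by rewrite !nth_cat !size_tuple !nth_upd (negbTE mp).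
Qed.

Lemma vol_catr_mlin (E : 7.-tuple g) k (s : seq g) : (size s + k <= 7)%N ->
  mlin (fun u : k.-tuple g => vol E (s ++ u)).
Proof.
move=> k7 v p c x y.
have pk : (size s + p < 7)%N by apply: leq_trans k7; rewrite ltn_add2l.
have sub m : m != (size s + p)%N -> (size s <= m)%N -> (m - size s == p)%N = false.
  by move=> /negbTE <- sm; rewrite -(eqn_add2l (size s)) subnKC.
apply: (@vol_linear E _ _ _ (size s + p)%N) => // [|m mp|m mp].
- by rewrite !nth_cat ltnNge leq_addr /= addKn !nth_upd eqxx.
- by rewrite !nth_cat; case: ltnP => // sm; rewrite !nth_upd sub.
- by rewrite !nth_cat; case: ltnP => // sm; rewrite !nth_upd sub.
Qed.

Lemma vol_catr_alternating (E : 7.-tuple g) k (s : seq g) : (size s + k <= 7)%N ->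
  is_alternating (fun u : k.-tuple g => vol E (s ++ u)).
Proof.
move=> k7 v p q pq vpq.
apply: (@vol_eq0 E _ (size s + p)%N (size s + q)%N).
- by apply: leq_trans k7; rewrite ltn_add2l.
- by apply: leq_trans k7; rewrite ltn_add2l.
- by rewrite eqn_add2l.
- by rewrite !nth_cat !ltnNge !leq_addr /= !addKn -!tnth_nth.
Qed.

Lemma mlin_sum k (I : finType) (P : pred I) (F : I -> kform g k) :
  (forall i, mlin (F i)) -> mlin (fun v => \sum_(i | P i) F i v).
Proof.
move=> Fl v p c x y; rewrite mulr_sumr -big_split /=.
by apply: eq_bigr => i _; rewrite Fl.
Qed.

Lemma alternating_sum k (I : finType) (P : pred I) (F : I -> kform g k) :
  (forall i, is_alternating (F i)) -> is_alternating (fun v => \sum_(i | P i) F i v).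
Proof. by move=> Fa v p q pq vpq; rewrite big1 // => i _; rewrite (Fa i _ p q). Qed.

Lemma mlinZl k a (al : kform g k) : mlin al -> mlin (fun v => a * al v).
Proof. by move=> al_lin v i c x y; rewrite al_lin mulrDr mulrCA. Qed.

Lemma alternatingZl k a (al : kform g k) :
  is_alternating al -> is_alternating (fun v => a * al v).
Proof. by move=> al_alt v i j ij vij; rewrite (al_alt _ i j) // mulr0. Qed.

Lemma mlin_add k (al be : kform g k) :
  mlin al -> mlin be -> mlin (fun v => al v + be v).
Proof. by move=> al_lin be_lin v i c x y; rewrite al_lin be_lin mulrDr addrACA. Qed.

Lemma alternating_add k (al be : kform g k) :
  is_alternating al -> is_alternating be -> is_alternating (fun v => al v + be v).
Proof. by move=> aa ba v i j ij vij; rewrite (aa _ i j) // (ba _ i j) // addr0. Qed.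

Lemma mlin_opp k (al : kform g k) : mlin al -> mlin (fun v => - al v).
Proof. by move=> al_lin v i c x y; rewrite al_lin opprD mulrN. Qed.

Lemma alternating_opp k (al : kform g k) :
  is_alternating al -> is_alternating (fun v => - al v).
Proof. by move=> aa v i j ij vij; rewrite (aa _ i j) // oppr0. Qed.

Lemma phi_std_mlin (E : 7.-tuple g) : mlin (phi_std E).
Proof.
rewrite /phi_std /=.
by do ![apply: mlin_add | apply: mlin_opp | apply: coform_mlin].
Qed.

Lemma phi_std_alternating (E : 7.-tuple g) : is_alternating (phi_std E).
Proof.
rewrite /phi_std /=.
by do ![apply: alternating_add | apply: alternating_opp | apply: coform_alternating].
Qed.

Lemma hodge_mlin (E : 7.-tuple g) k (al : kform g k) : (k <= 7)%N ->
  mlin (hodge E al).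
Proof.
move=> k7; apply: mlinZl; apply: mlin_sum => I; apply: mlinZl.
by apply: vol_catr_mlin; rewrite size_map size_tuple subnKC.
Qed.

Lemma hodge_alternating (E : 7.-tuple g) k (al : kform g k) : (k <= 7)%N ->
  is_alternating (hodge E al).
Proof.
move=> k7; apply: alternatingZl; apply: alternating_sum => I.
apply: alternatingZl.
by apply: vol_catr_alternating; rewrite size_map size_tuple subnKC.
Qed.

Lemma hodge_ext (E : 7.-tuple g) k (al be : kform g k) :
  al =1 be -> hodge E al =1 hodge E be.
Proof.
by move=> albe v; congr (_ * _); apply: eq_bigr => I _; rewrite albe.
Qed.

Lemma hodgeZ (E : 7.-tuple g) k c (al : kform g k) v :
  hodge E (fun u => c * al u) v = c * hodge E al v.
Proof.
rewrite /hodge mulrCA; congr (_ * _); rewrite mulr_sumr.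
by apply: eq_bigr => I _; rewrite mulrA.
Qed.

Lemma ext_d_ext (br : 'Hom(g, 'End(g))) k (al be : kform g k.+1) :
  al =1 be -> ext_d br al =1 ext_d br be.
Proof.
by move=> albe v; apply: eq_bigr => j _; apply: eq_bigr => i _; rewrite albe.
Qed.

Lemma ext_dZ (br : 'Hom(g, 'End(g))) k c (al : kform g k.+1) v :
  ext_d br (fun u => c * al u) v = c * ext_d br al v.
Proof.
rewrite /ext_d mulr_sumr; apply: eq_bigr => j _.
by rewrite mulr_sumr; apply: eq_bigr => i _; rewrite mulrCA.
Qed.

Lemma ext_d0 (br : 'Hom(g, 'End(g))) k v :
  ext_d br (fun _ : k.+1.-tuple g => 0) v = 0.
Proof. by apply: big1 => j _; apply: big1 => i _; rewrite mulr0. Qed.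

Lemma hodge0 (E : 7.-tuple g) k v : hodge E (fun _ : k.-tuple g => 0) v = 0.
Proof. by rewrite /hodge big1 ?mulr0 // => I _; rewrite mul0r. Qed.

Lemma vartheta_mlin k (X : 'End(g)) (al : kform g k) :
  mlin al -> mlin (vartheta X al).
Proof.
move=> al_lin; apply: mlin_opp; apply: mlin_sum => i v p c x y.
pose w := upd v i (X (tnth v i)).
have E z : [tuple if j == i then X (tnth (upd v p z) j) else tnth (upd v p z) j | j < k]
    = upd w p (if p == i then X z else z).
  apply: eq_from_tnth => j; rewrite tnth_mktuple ?/w !tnth_upd.
  by case: (eqVneq j p) => [->|_] //; case: (eqVneq j i) => [->|].
by rewrite !E; case: eqP => // _; rewrite ?linearP al_lin.
Qed.

(** When slots [p] and [q] agree, the terms [i = p] and [i = q] differ by a transposition and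
    cancel; every other term still has two equal arguments. *)
Lemma vartheta_alternating k (X : 'End(g)) (al : kform g k) :
  mlin al -> is_alternating al -> is_alternating (vartheta X al).
Proof.
move=> al_lin al_alt v p q pq vpq; apply/eqP; rewrite oppr_eq0.
pose F i := al (upd v i (X (tnth v i))).
have FE i : al [tuple if j == i then X (tnth v j) else tnth v j | j < k] = F i.
  congr al; apply: eq_from_tnth => j; rewrite tnth_mktuple tnth_upd.
  by case: eqP => [->|].
under eq_bigr => i _ do rewrite FE.
rewrite (bigD1 p) // (bigD1 q) 1?eq_sym //= big1 => [|i /andP[ip iq]].
  rewrite addr0 eq_sym addr_eq0 /F; apply/eqP.
  rewrite -(@alternating_swap _ _ _ al (upd v q (X (tnth v q))) p q) //.
  congr al; apply: eq_from_tnth => j; rewrite tnth_mktuple !tnth_upd.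
  case: tpermP => [->|->|/eqP/negbTE-> /eqP/negbTE-> //].
    by rewrite !eqxx vpq.
  by rewrite (negbTE pq) eq_sym (negbTE pq).
apply: (al_alt _ p q pq); rewrite !tnth_upd.
by rewrite ![_ == i]eq_sym (negbTE ip) (negbTE iq).
Qed.

End BasicForms.

(** * Forms of degree three and four, slot by slot *)

Section SmallForms.
Context {R : realType} {g : vectType R}.

Lemma tuple3_eta (v : 3.-tuple g) :
  v = [tuple v`_0; v`_1; v`_2].
Proof. by apply: eq_from_tnth => -[[|[|[|//]]] p]; rewrite !(tnth_nth 0). Qed.

Lemma tuple4_eta (v : 4.-tuple g) :
  v = [tuple v`_0; v`_1; v`_2; v`_3].
Proof. by apply: eq_from_tnth => -[[|[|[|[|//]]]] p]; rewrite !(tnth_nth 0). Qed.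

Lemma mlin4 (al : kform g 4) :
  (forall c x y u v w, al [tuple c *: x + y; u; v; w] =
     c * al [tuple x; u; v; w] + al [tuple y; u; v; w]) ->
  (forall c x y u v w, al [tuple u; c *: x + y; v; w] =
     c * al [tuple u; x; v; w] + al [tuple u; y; v; w]) ->
  (forall c x y u v w, al [tuple u; v; c *: x + y; w] =
     c * al [tuple u; v; x; w] + al [tuple u; v; y; w]) ->
  (forall c x y u v w, al [tuple u; v; w; c *: x + y] =
     c * al [tuple u; v; w; x] + al [tuple u; v; w; y]) ->
  mlin al.
Proof.
move=> l0 l1 l2 l3 v -[[|[|[|[|//]]]] p] c x y;
  by rewrite [upd _ _ (c *: x + y)]tuple4_eta [upd _ _ x]tuple4_eta
    [upd _ _ y]tuple4_eta !nth_upd /= ?(l0, l1, l2, l3).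
Qed.

Lemma mlin3_slots (al : kform g 3) : mlin al ->
  (forall c x y u v, al [tuple c *: x + y; u; v] =
     c * al [tuple x; u; v] + al [tuple y; u; v]) /\
  (forall c x y u v, al [tuple u; c *: x + y; v] =
     c * al [tuple u; x; v] + al [tuple u; y; v]) /\
  (forall c x y u v, al [tuple u; v; c *: x + y] =
     c * al [tuple u; v; x] + al [tuple u; v; y]).
Proof.
move=> al_lin; split; [|split] => c x y u v.
- have := al_lin [tuple 0; u; v] (@Ordinal 3 0 isT) c x y.
  by rewrite [upd _ _ (c *: x + y)]tuple3_eta [upd _ _ x]tuple3_eta
    [upd _ _ y]tuple3_eta !nth_upd.
- have := al_lin [tuple u; 0; v] (@Ordinal 3 1 isT) c x y.
  by rewrite [upd _ _ (c *: x + y)]tuple3_eta [upd _ _ x]tuple3_eta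
    [upd _ _ y]tuple3_eta !nth_upd.
- have := al_lin [tuple u; v; 0] (@Ordinal 3 2 isT) c x y.
  by rewrite [upd _ _ (c *: x + y)]tuple3_eta [upd _ _ x]tuple3_eta
    [upd _ _ y]tuple3_eta !nth_upd.
Qed.

Lemma alternating3_slots (al : kform g 3) : mlin al -> is_alternating al ->
  [/\ forall x y, al [tuple x; x; y] = 0, forall x y, al [tuple x; y; x] = 0,
      forall x y, al [tuple y; x; x] = 0,
      forall x y z, al [tuple y; x; z] = - al [tuple x; y; z] &
      forall x y z, al [tuple x; z; y] = - al [tuple x; y; z]].
Proof.
move=> al_lin al_alt; split=> [x y|x y|x y|x y z|x y z].
- exact: (al_alt _ (@Ordinal 3 0 isT) (@Ordinal 3 1 isT)).
- exact: (al_alt _ (@Ordinal 3 0 isT) (@Ordinal 3 2 isT)).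
- exact: (al_alt _ (@Ordinal 3 1 isT) (@Ordinal 3 2 isT)).
- rewrite -(@alternating_swap _ _ _ al _ (@Ordinal 3 0 isT) (@Ordinal 3 1 isT)) //.
  by congr al; apply: eq_from_tnth => -[[|[|[|//]]] p]; rewrite tnth_mktuple permE.
- rewrite -(@alternating_swap _ _ _ al _ (@Ordinal 3 1 isT) (@Ordinal 3 2 isT)) //.
  by congr al; apply: eq_from_tnth => -[[|[|[|//]]] p]; rewrite tnth_mktuple permE.
Qed.

End SmallForms.

(** * The exterior derivative of a 3-form *)

Section ExtD.
Context {R : realType} {g : vectType R}.

Lemma sum_lt4 (F : 'I_4 -> 'I_3 -> R) :
  \sum_(j < 4) \sum_(i < 3 | (i < j)%N) F j i =
  F (@Ordinal 4 1 isT) (@Ordinal 3 0 isT) +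
  (F (@Ordinal 4 2 isT) (@Ordinal 3 0 isT) + F (@Ordinal 4 2 isT) (@Ordinal 3 1 isT)) +
  (F (@Ordinal 4 3 isT) (@Ordinal 3 0 isT) + F (@Ordinal 4 3 isT) (@Ordinal 3 1 isT) +
   F (@Ordinal 4 3 isT) (@Ordinal 3 2 isT)).
Proof.
under eq_bigr => j _ do rewrite big_mkcond /=.
rewrite !big_ord_recl !big_ord0 /= !addr0 !add0r -!addrA.
by do ![congr (_ + _)|congr F]; apply: val_inj.
Qed.

Lemma ext_d3E (br : 'Hom(g, 'End(g))) (al : kform g 3) a b c d :
  ext_d br al [tuple a; b; c; d] =
  - al [tuple br a b; c; d] + al [tuple br a c; b; d] - al [tuple br a d; b; c]
  - al [tuple br b c; a; d] + al [tuple br b d; a; c] - al [tuple br c d; a; b].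
Proof.
have tE x (F : 'I_2 -> g) : [tuple of x :: [tuple F m | m < 2]] =
    [tuple x; F (@Ordinal 2 0 isT); F (@Ordinal 2 1 isT)].
  apply: eq_from_tnth => m; case: (unliftP ord0 m) => [p|] -> //.
  by rewrite tnthS tnth_mktuple; case: p => [[|[|//]]] p; rewrite (tnth_nth 0) /=;
    congr F; apply: val_inj.
rewrite /ext_d sum_lt4 !tE.
set t1 := al _; set t2 := al _; set t3 := al _; set t4 := al _; set t5 := al _.
set t6 := al _.
have -> : t1 = al [tuple br a b; c; d] by [].
have -> : t2 = al [tuple br a c; b; d] by [].
have -> : t3 = al [tuple br b c; a; d] by [].
have -> : t4 = al [tuple br a d; b; c] by [].
have -> : t5 = al [tuple br b d; a; c] by [].
have -> : t6 = al [tuple br c d; a; b] by [].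
by rewrite /=; ring.
Qed.

Lemma bracket_linearl (br : 'Hom(g, 'End(g))) c x y u :
  br (c *: x + y) u = c *: br x u + br y u.
Proof. by rewrite linearP !lfun_simp. Qed.

Lemma bracket_linearr (br : 'Hom(g, 'End(g))) c x y u :
  br u (c *: x + y) = c *: br u x + br u y.
Proof. by rewrite linearP. Qed.

Lemma bracketC (br : 'Hom(g, 'End(g))) : (forall x, br x x = 0) ->
  forall x y, br x y = - br y x.
Proof.
move=> brxx x y; have := brxx (1 *: x + y).
rewrite bracket_linearl !bracket_linearr !brxx !scale1r add0r addr0.
by move/eqP; rewrite addr_eq0 => /eqP.
Qed.

Lemma ext_d3_mlin (br : 'Hom(g, 'End(g))) (al : kform g 3) :
  mlin al -> mlin (ext_d br al).
Proof.
move=> /mlin3_slots[l0 [l1 l2]].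
by apply: mlin4 => c x y u v w;
  rewrite !ext_d3E ?bracket_linearl ?bracket_linearr ?l0 ?l1 ?l2; ring.
Qed.

Lemma alternating4 (al : kform g 4) :
  (forall x y z, al [tuple x; x; y; z] = 0) ->
  (forall x y z, al [tuple x; y; x; z] = 0) ->
  (forall x y z, al [tuple x; y; z; x] = 0) ->
  (forall x y z, al [tuple y; x; x; z] = 0) ->
  (forall x y z, al [tuple y; x; z; x] = 0) ->
  (forall x y z, al [tuple y; z; x; x] = 0) -> is_alternating al.
Proof.
move=> a01 a02 a03 a12 a13 a23 v i j; rewrite !(tnth_nth 0) (tuple4_eta v).
case: i j => [[|[|[|[|//]]]] pi] [[|[|[|[|//]]]] pj] //= _ => ->;
  by rewrite ?(a01, a02, a03, a12, a13, a23).
Qed.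

Lemma ext_d3_alternating (br : 'Hom(g, 'End(g))) (al : kform g 3) :
  (forall x, br x x = 0) -> mlin al -> is_alternating al ->
  is_alternating (ext_d br al).
Proof.
move=> brxx al_lin al_alt.
have [a01 a02 a12 s01 s12] := alternating3_slots al_lin al_alt.
have [l0 _] := mlin3_slots al_lin.
have brN := bracketC brxx.
have lN x u v : al [tuple - x; u; v] = - al [tuple x; u; v].
  have := l0 (-1) x 0 u v; rewrite scaleN1r addr0 => ->.
  have := l0 0 0 0 u v; rewrite scale0r mul0r !add0r => _.
  have := l0 1 0 0 u v; rewrite scale1r addr0 mul1r -[X in X = _]addr0 => /addrI <-.
  by rewrite mulN1r addr0.
have l00 u v : al [tuple 0; u; v] = 0.
  by have := lN 0 u v; rewrite oppr0 => /eqP; rewrite -addr_eq0 -mulr2n mulrn_eq0 => /eqP.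
apply: alternating4 => x y z;
  rewrite !ext_d3E ?(brN y x) ?(brN z x) ?brxx ?lN ?l00 ?a12;
  by rewrite ?(s12 _ x z) ?(s12 _ x y); ring.
Qed.

End ExtD.

(** * Integer tables of the standard forms, with indices from 0 *)

Section IntegerTables.

Definition del_nth (j : nat) (K : seq nat) : seq nat := take j K ++ drop j.+1 K.

(* Laplace expansion of the determinant of the matrix with entries
   [nth I i == nth K j], in a form that computes. *)
Fixpoint kdet (I K : seq nat) : int :=
  if I is i :: I' then
    foldr (fun j acc =>
      (if nth 0%N K j == i then
         if odd j then - kdet I' (del_nth j K) else kdet I' (del_nth j K)
       else 0) + acc) 0 (iota 0 (size K))
  else 1.

Definition phiZ (K : seq nat) : int :=
  kdet [:: 0; 1; 6]%N K + kdet [:: 2; 3; 6]%N K + kdet [:: 4; 5; 6]%N K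
  + kdet [:: 0; 2; 4]%N K - kdet [:: 0; 3; 5]%N K - kdet [:: 1; 2; 5]%N K
  - kdet [:: 1; 3; 4]%N K.

Definition PhiZ (K : seq nat) : int :=
  kdet [:: 0; 1; 2; 3]%N K + kdet [:: 2; 3; 4; 5]%N K + kdet [:: 0; 1; 4; 5]%N K
  - kdet [:: 1; 3; 5; 6]%N K + kdet [:: 0; 2; 5; 6]%N K
  + kdet [:: 0; 3; 4; 6]%N K + kdet [:: 1; 2; 4; 6]%N K.

Fixpoint index_tuples (k : nat) : seq (seq nat) :=
  if k is k'.+1 then [seq i :: s | i <- iota 0 7, s <- index_tuples k'] else [:: [::]].

(** Sparsity keeps the sums small: [phiZ] has 42 nonzero values among 343 triples, [PhiZ] has 168
    among 2401 quadruples. *)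
Definition nonzero_terms (k : nat) (F : seq nat -> int) : seq (seq nat * int) :=
  [seq t <- [seq (s, F s) | s <- index_tuples k] | t.2 != 0].

Definition weighted_sum (l : seq (seq nat * int)) (G : seq nat -> int) : int :=
  foldr (fun t acc => t.2 * G t.1 + acc) 0 l.

Fixpoint tall (k : nat) (P : seq nat -> bool) : bool :=
  if k is k'.+1 then all (fun i => tall k' (fun s => P (i :: s))) (iota 0 7)
  else P [::].

Lemma foldr_sum (V : nmodType) n (F : nat -> V) :
  foldr (fun i acc => F i + acc) 0 (iota 0 n) = \sum_(i < n) F i.
Proof.
by rewrite -(big_mkord xpredT F) unlock /reducebig /index_iota subn0.
Qed.

Lemma sum_iota (V : nmodType) n (F : nat -> V) : \sum_(m <- iota 0 n) F m = \sum_(m < n) F m.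
Proof. by rewrite -(big_mkord xpredT F) /index_iota subn0. Qed.

Lemma sum_index_tuples (V : nmodType) k (F : seq nat -> V) :
  \sum_(s <- index_tuples k) F s = \sum_(I : k.-tuple 'I_7) F (map val I).
Proof.
elim: k F => [|k IH] F; first by rewrite sum_tuple0 big_seq1.
rewrite -[index_tuples _]/([seq i :: s | i <- iota 0 7, s <- index_tuples k]).
rewrite sum_tupleS big_allpairs_dep sum_iota; apply: eq_bigr => i _.
exact: (IH (fun s => F (val i :: s))).
Qed.

Lemma weighted_sumE (R : pzRingType) k (F G : seq nat -> int) :
  \sum_(I : k.-tuple 'I_7) (F (map val I) * G (map val I))%:~R =
  (weighted_sum (nonzero_terms k F) G)%:~R :> R.
Proof.
rewrite -(sum_index_tuples k (fun s => (F s * G s)%:~R)) -rmorph_sum /=.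
congr _%:~R; have -> l : weighted_sum l G = \sum_(t <- l) t.2 * G t.1.
  by rewrite unlock.
rewrite big_filter big_map [RHS]big_mkcond /=; apply: eq_bigr => s _.
by case: eqP => //= ->; rewrite mul0r.
Qed.

Lemma tallP k (P : seq nat -> bool) : tall k P ->
  forall I : k.-tuple 'I_7, P (map val I).
Proof.
elim: k P => [|k IH] P; first by move=> PN I; rewrite [I]tuple0.
move=> /allP PI I; case/tupleP: I => i I.
by apply: (IH (fun s => P (val i :: s))); apply: PI; rewrite mem_iota ltn_ord.
Qed.

Lemma nth_del_nth j K m : nth 0%N (del_nth j K) m = nth 0%N K (bump j m).
Proof.
rewrite /del_nth nth_cat size_take /bump.
have [jK|Kj] := ltnP j (size K).
  by case: ltnP => mj; rewrite ?nth_take // nth_drop add1n addSn subnKC.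
rewrite take_oversize // drop_oversize ?(leq_trans Kj) // nth_nil.
case: ltnP => mK; last by rewrite nth_default // (leq_trans mK) ?leq_addl.
by rewrite leqNgt (leq_trans mK Kj).
Qed.

Lemma kdetE (R : comNzRingType) k (I K : seq nat) : size I = k -> size K = k ->
  \det (\matrix_(i < k, j < k) (nth 0%N I i == nth 0%N K j)%:R) =
  (kdet I K)%:~R :> R.
Proof.
elim: k I K => [|k IH] [|i I] //= K => [_ _|[sI] sK]; first by rewrite det_mx00.
rewrite (expand_det_row _ ord0) sK.
rewrite (foldr_sum k.+1 (fun j => if nth 0%N K j == i then
  if odd j then - kdet I (del_nth j K) else kdet I (del_nth j K) else 0)).
rewrite rmorph_sum /=.
apply: eq_bigr => j _; rewrite mxE /= eq_sym /cofactor.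
case: eqP => [Kj|_]; last by rewrite mul0r.
rewrite mul1r add0n -signr_odd.
have -> : row' ord0 (col' j (\matrix_(i0, j0)
      (nth 0%N (i :: I) i0 == nth 0%N K j0)%:R)) =
    \matrix_(i0 < k, j0 < k) (nth 0%N I i0 == nth 0%N (del_nth j K) j0)%:R :> 'M[R]_k.
  by apply/matrixP => a b; rewrite !mxE nth_del_nth.
rewrite IH //; last first.
  rewrite /del_nth size_cat size_take size_drop sK ltn_ord.
  by rewrite subSS subnKC // -ltnS.
by case: odd; rewrite ?expr1 ?expr0 ?mulN1r ?mul1r ?rmorphN.
Qed.

(* The list of terms is an argument, so that the kernel evaluates it only once. *)
Definition hodge_table (k m : nat) (be : seq nat -> int) (l : seq (seq nat * int)) : bool :=
  tall m (fun K => if sorted ltn K then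
    k`!%:Z * be K == weighted_sum l (fun I => kdet (iota 0 7) (I ++ K)) else true).

Lemma PhiZ_hodge : hodge_table 3 4 PhiZ (nonzero_terms 3 phiZ).
Proof. by vm_cast_no_check (erefl true). Qed.

Lemma phiZ_hodge : hodge_table 4 3 phiZ (nonzero_terms 4 PhiZ).
Proof. by vm_cast_no_check (erefl true). Qed.

(** The G2 contraction identity: summing [phi_cij phi_dkl Phi_ijkl] over [i, j, k, l] gives 24 times
    the Kronecker delta of [c] and [d]. It is the source of the constant 24 in
    [gram_contraction]. *)
Definition contraction_table (l : seq (seq nat * int)) : bool :=
  tall 2 (fun p => (24 *+ (nth 0%N p 0 == nth 0%N p 1) : int) ==
    weighted_sum l (fun I => phiZ (nth 0%N p 0 :: take 2 I) * phiZ (nth 0%N p 1 :: drop 2 I))).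

Lemma phiZ_contraction : contraction_table (nonzero_terms 4 PhiZ).
Proof. by vm_cast_no_check (erefl true). Qed.

End IntegerTables.

(** * Values of the standard forms on their own frame *)

Section FrameTables.
Context {R : realType} {g : vectType R}.

Lemma coord_tnth_free n (b : n.-tuple g) i j : free b ->
  coord b i (tnth b j) = (i == j)%:R.
Proof. by move=> bF; rewrite (tnth_nth 0) coord_free // eq_sym. Qed.

Lemma coord_tnth n (b : n.-tuple g) i j : basis_of fullv b ->
  coord b i (tnth b j) = (i == j)%:R.
Proof. by move/basis_free/coord_tnth_free. Qed.

(** The shift [predn] passes from indices numbered from 1 to the tables. Freeness is what is assumed
    of [b], since the adapted frame spans only the ideal. *)
Lemma coform_free n (b : n.+1.-tuple g) k I (K : k.-tuple 'I_n.+1) :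
  free b -> size I = k -> all (fun i => 0 < i <= n.+1)%N I ->
  coform b I (map_tuple (tnth b) K) = (kdet (map predn I) (map val K))%:~R.
Proof.
move=> bF sI /allP I_n; rewrite -(kdetE _ (k := k)) ?size_map ?size_tuple //.
congr (\det _); apply/matrixP => i j; rewrite !mxE tnth_map coord_tnth_free //.
rewrite (nth_map 0%N) ?sI // (nth_map (tnth K j)) ?size_tuple // -tnth_nth.
have /andP[i0 In] : (0 < nth 0%N I i <= n.+1)%N by apply: I_n; rewrite mem_nth ?sI.
by rewrite -val_eqE /= inordK // prednK.
Qed.

Lemma coform_basis n (b : n.+1.-tuple g) k I (K : k.-tuple 'I_n.+1) :
  basis_of fullv b -> size I = k -> all (fun i => 0 < i <= n.+1)%N I ->
  coform b I (map_tuple (tnth b) K) = (kdet (map predn I) (map val K))%:~R.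
Proof. by move/basis_free; apply: coform_free. Qed.

Lemma vol_basis (E : 7.-tuple g) (K : seq 'I_7) : basis_of fullv E -> size K = 7 ->
  vol E (map (tnth E) K) = (kdet (iota 0 7) (map val K))%:~R.
Proof.
move=> EB sK; rewrite -(kdetE _ (k := 7)) ?size_map //.
congr (\det _); apply/matrixP => i j; rewrite !mxE nth_iota // add0n.
by rewrite !(nth_map i) ?sK // coord_tnth.
Qed.

Lemma phi_std_basis (E : 7.-tuple g) (K : 3.-tuple 'I_7) : basis_of fullv E ->
  phi_std E (map_tuple (tnth E) K) = (phiZ (map val K))%:~R.
Proof.
by move=> EB; rewrite /phi_std /= !coform_basis // /phiZ !(rmorphD, rmorphN).
Qed.

(** The factor [k!] clears the only denominator, so that the comparison takes place among
    integers. *)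
Lemma hodge_basis (E : 7.-tuple g) k (al : kform g k) (alZ : seq nat -> int)
    (K : (7 - k).-tuple 'I_7) : (k <= 7)%N -> basis_of fullv E ->
  (forall I : k.-tuple 'I_7, al (map_tuple (tnth E) I) = (alZ (map val I))%:~R) ->
  k`!%:R * hodge E al (map_tuple (tnth E) K) =
  (weighted_sum (nonzero_terms k alZ) (fun I => kdet (iota 0 7) (I ++ map val K)))%:~R.
Proof.
move=> k7 EB alE; rewrite /hodge mulVKf ?pnatr_eq0 -?lt0n ?fact_gt0 //.
rewrite -weighted_sumE; apply: eq_bigr => I _.
rewrite intrM -alE -!map_cat -(vol_basis EB) //.
by rewrite size_cat !size_tuple subnKC.
Qed.

Definition Phi_std (E : 7.-tuple g) : kform g 4 := fun v =>
  let e I := coform E I v in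
  e [:: 1; 2; 3; 4]%N + e [:: 3; 4; 5; 6]%N + e [:: 1; 2; 5; 6]%N
  - e [:: 2; 4; 6; 7]%N + e [:: 1; 3; 6; 7]%N + e [:: 1; 4; 5; 7]%N
  + e [:: 2; 3; 5; 7]%N.

Lemma Phi_std_mlin (E : 7.-tuple g) : mlin (Phi_std E).
Proof.
rewrite /Phi_std /=.
by do ![apply: mlin_add | apply: mlin_opp | apply: coform_mlin].
Qed.

Lemma Phi_std_alternating (E : 7.-tuple g) : is_alternating (Phi_std E).
Proof.
rewrite /Phi_std /=.
by do ![apply: alternating_add | apply: alternating_opp | apply: coform_alternating].
Qed.

Lemma Phi_std_basis (E : 7.-tuple g) (K : 4.-tuple 'I_7) : basis_of fullv E ->
  Phi_std E (map_tuple (tnth E) K) = (PhiZ (map val K))%:~R.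
Proof.
by move=> EB; rewrite /Phi_std /= !coform_basis // /PhiZ !(rmorphD, rmorphN).
Qed.

Lemma hodge_phi_std (E : 7.-tuple g) : basis_of fullv E ->
  hodge E (phi_std E) =1 Phi_std E.
Proof.
move=> EB; apply: (alternating_ext EB).
- exact: hodge_mlin.
- exact: Phi_std_mlin.
- exact: hodge_alternating.
- exact: Phi_std_alternating.
- move=> K sK; rewrite Phi_std_basis //.
  have := hodge_basis K isT EB (fun I => phi_std_basis I EB).
  have := tallP PhiZ_hodge K; rewrite sK => /eqP <-; rewrite rmorphM.
  by apply: mulfI; rewrite pnatr_eq0.
Qed.

Lemma hodge_Phi_std (E : 7.-tuple g) : basis_of fullv E ->
  hodge E (Phi_std E) =1 phi_std E.
Proof.
move=> EB; apply: (alternating_ext EB).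
- exact: hodge_mlin.
- exact: phi_std_mlin.
- exact: hodge_alternating.
- exact: phi_std_alternating.
- move=> K sK; rewrite phi_std_basis //.
  have := hodge_basis (k := 4) K isT EB (fun I => Phi_std_basis I EB).
  have := tallP phiZ_hodge K; rewrite sK => /eqP <-; rewrite rmorphM.
  by apply: mulfI; rewrite pnatr_eq0.
Qed.

End FrameTables.

Lemma tuple4_ord_eta n (I : 4.-tuple 'I_n) :
  I = [tuple tnth I (@Ordinal 4 0 isT); tnth I (@Ordinal 4 1 isT);
             tnth I (@Ordinal 4 2 isT); tnth I (@Ordinal 4 3 isT)].
Proof.
by apply: eq_from_tnth => -[[|[|[|[|//]]]] p]; congr tnth; apply: val_inj.
Qed.

(** * Metric and Hodge star of a frame [E] seen from a fixed basis [B] *)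

Section FrameChange.
Context {R : realType} {g : vectType R}.
Variables (B E : 7.-tuple g).
Hypotheses (BB : basis_of fullv B) (EB : basis_of fullv E).

Definition frame_mx : 'M[R]_7 := \matrix_(a, c) coord B a (tnth E c).

(** The inverse metric of [E] in the basis [B]: it is the sum of the squares of the vectors of [E]
    in the tensor square. *)
Definition gram (a b : 'I_7) : R := \sum_c frame_mx a c * frame_mx b c.

(** The vector that [metric E] associates with the [a]-th coordinate function of [B]. *)
Definition frame_dual (a : 'I_7) : g := \sum_c frame_mx a c *: tnth E c.

Lemma frame_expand c : tnth E c = \sum_a frame_mx a c *: tnth B a.
Proof.
rewrite [LHS](basis_expand _ BB).
by apply: eq_bigr => a _; rewrite mxE.
Qed.

Lemma frame_dual_gram a : frame_dual a = \sum_b gram a b *: tnth B b.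
Proof.
rewrite /frame_dual; under eq_bigr => c _ do rewrite frame_expand scaler_sumr.
rewrite exchange_big; apply: eq_bigr => b _ /=.
by rewrite scaler_suml; apply: eq_bigr => c _; rewrite scalerA.
Qed.

Lemma vol_frame s : vol B s = \det frame_mx * vol E s.
Proof.
rewrite /vol -det_mulmx; congr (\det _); apply/matrixP => i j; rewrite !mxE.
rewrite {1}(basis_expand (nth 0 s j) EB) linear_sum /=.
by apply: eq_bigr => c _; rewrite linearZ /= !mxE mulrC.
Qed.

Lemma det_frame_neq0 : \det frame_mx != 0.
Proof.
apply/eqP => d0; have := vol_frame (map (tnth B) (enum 'I_7)).
rewrite d0 mul0r => /eqP; apply/negP.
rewrite /vol (_ : \matrix_(i, j) _ = 1%:M) ?det1 ?oner_eq0 //.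
apply/matrixP => i j; rewrite !mxE (nth_map i) ?size_enum_ord //.
by rewrite nth_ord_enum coord_tnth.
Qed.

(** The usual index formula for the star: indices are raised with the inverse metric and contracted
    with the volume form, whose ratio to the one of [B] is the determinant. The frame [E] enters
    only through [gram], the determinant and [al]. *)
Lemma hodge_frame_gram k (al : kform g k) v : (k <= 7)%N -> mlin al ->
  hodge E al v = (\det frame_mx)^-1 * (k`!%:R^-1 * \sum_(I : k.-tuple 'I_7)
    (\sum_(K : k.-tuple 'I_7) (\prod_(a < k) gram (tnth I a) (tnth K a)) *
       al (map_tuple (tnth B) K)) * vol B (map (tnth B) I ++ v)).
Proof.
move=> k7 al_lin; rewrite /hodge mulrCA; congr (_ * _).
rewrite -[X in X = _](mulKf det_frame_neq0); congr (_ * _).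
have -> : \det frame_mx * (\sum_(I : k.-tuple 'I_7)
      al (map_tuple (tnth E) I) * vol E (map (tnth E) I ++ v)) =
    \sum_(I : k.-tuple 'I_7) al (map_tuple (tnth E) I) *
      vol B (map_tuple (tnth E) I ++ v).
  by rewrite mulr_sumr; apply: eq_bigr => I _; rewrite vol_frame mulrCA.
rewrite -(mlin_contraction (be := fun u => vol B (u ++ v)) al_lin
  (vol_catl_mlin B v k7) (w := frame_dual) (M := frame_mx) _ frame_expand) //.
apply: eq_bigr => I _; congr (_ * _).
rewrite -(mlin_expand (fun a => gram (tnth I a)) (tnth B) al_lin); congr al.
by apply: eq_from_tnth => a; rewrite tnth_map tnth_mktuple frame_dual_gram.
Qed.

(** [hodge B] treats the fixed basis as orthonormal, so it is linear in [al] with constant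
    coefficients. This compares it with the true star, of which it computes the components with
    raised indices up to a determinant. *)
Lemma hodge_frame_dual k (al : kform g k) (J : (7 - k).-tuple 'I_7) :
  (k <= 7)%N -> mlin al ->
  hodge B al (map_tuple (tnth B) J) =
  (\det frame_mx)^-1 * hodge E al (map_tuple frame_dual J).
Proof.
move=> k7 al_lin; rewrite /hodge [RHS]mulrCA; congr (_ * _).
rewrite -[X in X = _](mulKf det_frame_neq0); congr (_ * _).
have vE (I : k.-tuple 'I_7) : vol E (map frame_dual (I ++ J)) =
    \det frame_mx * vol B (map (tnth B) (I ++ J)).
  rewrite /vol -(det_tr frame_mx) -det_mulmx; congr (\det _).
  apply/matrixP => i j; rewrite !mxE.
  have sIJ : size (I ++ J) = 7 by rewrite size_cat !size_tuple subnKC.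
  rewrite !(nth_map j) ?sIJ // /frame_dual linear_sum (bigD1 i) //=.
  rewrite linearZ /= coord_tnth // eqxx mulr1 big1 ?addr0; last first.
    by move=> c ci; rewrite linearZ /= coord_tnth // eq_sym (negbTE ci) mulr0.
  rewrite (bigD1 (nth j (I ++ J) j)) //= !mxE (nth_map j) ?sIJ // coord_tnth //.
  rewrite eqxx mulr1 big1 ?addr0 // => a ai.
  by rewrite !mxE (nth_map j) ?sIJ // coord_tnth // (negbTE ai) mulr0.
have con := mlin_contraction (al := fun u => vol E (u ++ map_tuple frame_dual J))
  (be := al) (w := frame_dual) (b := tnth B) (M := frame_mx) (vol_catl_mlin _ _ k7)
  al_lin (fun=> erefl) frame_expand.
rewrite (eq_bigr _ (fun L _ => mulrC (al _) (vol E _))) -{}con mulr_sumr.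
apply: eq_bigr => I _; rewrite /= -!map_cat vE.
by rewrite -mulrA [vol _ _ * _]mulrC.
Qed.

Lemma mlin_product22 (al be : kform g 3) x y : mlin al -> mlin be ->
  mlin (fun u : 4.-tuple g => al [tuple x; u`_0; u`_1] * be [tuple y; u`_2; u`_3]).
Proof.
move=> /mlin3_slots[_ [a1 a2]] /mlin3_slots[_ [b1 b2]].
by apply: mlin4 => c z t u v w /=; rewrite ?(a1, a2, b1, b2); ring.
Qed.

Lemma mlin3_sum0 (al : kform g 3) n (c : 'I_n -> R) (e : 'I_n -> g) u v :
  mlin al ->
  al [tuple \sum_i c i *: e i; u; v] = \sum_i c i * al [tuple e i; u; v].
Proof.
move=> al_lin.
have updE z : [tuple z; u; v] = upd [tuple 0; u; v] ord0 z.
  by apply: eq_from_tnth => -[[|[|[|//]]] p]; rewrite tnth_upd.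
rewrite updE mlin_suml //; apply: eq_bigr => i _.
by rewrite mlinZ // -updE.
Qed.

(* The left-hand side is polynomial in the components of the 4-form
   [Phi_std E]: it lets one recover the metric from the 4-form. *)
Lemma gram_contraction a b :
  \sum_(I : 4.-tuple 'I_7)
    hodge B (Phi_std E) [tuple tnth B a; (map (tnth B) I)`_0; (map (tnth B) I)`_1] *
    hodge B (Phi_std E) [tuple tnth B b; (map (tnth B) I)`_2; (map (tnth B) I)`_3] *
    Phi_std E (map_tuple (tnth B) I) =
  24 * (\det frame_mx ^- 2 * gram a b).
Proof.
set phi := phi_std E; have phi_lin : mlin phi := @phi_std_mlin _ _ E.
have hB i j k : hodge B (Phi_std E) [tuple tnth B i; tnth B j; tnth B k] =
    (\det frame_mx)^-1 * phi [tuple frame_dual i; frame_dual j; frame_dual k].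
  have := @hodge_frame_dual 4 (Phi_std E) [tuple i; j; k] isT (@Phi_std_mlin _ _ E).
  rewrite hodge_Phi_std // => hE.
  have -> : [tuple tnth B i; tnth B j; tnth B k] = map_tuple (tnth B) [tuple i; j; k].
    exact: val_inj.
  by rewrite hE; congr (_ * phi _); apply: val_inj.
have -> : \sum_(I : 4.-tuple 'I_7)
    hodge B (Phi_std E) [tuple tnth B a; (map (tnth B) I)`_0; (map (tnth B) I)`_1] *
    hodge B (Phi_std E) [tuple tnth B b; (map (tnth B) I)`_2; (map (tnth B) I)`_3] *
    Phi_std E (map_tuple (tnth B) I) =
    \det frame_mx ^- 2 * \sum_(I : 4.-tuple 'I_7)
    phi [tuple frame_dual a; (map_tuple frame_dual I)`_0; (map_tuple frame_dual I)`_1] *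
    phi [tuple frame_dual b; (map_tuple frame_dual I)`_2; (map_tuple frame_dual I)`_3] *
    Phi_std E (map_tuple (tnth B) I).
  rewrite mulr_sumr; apply: eq_bigr => I _.
  by rewrite (tuple4_ord_eta I) /= !hB; field; rewrite det_frame_neq0.
(* Four dual vectors are summed against four vectors of [B]; transferred to the orthonormal frame,
   the sum involves only integer values of both forms. *)
rewrite (mlin_contraction (mlin_product22 (frame_dual a) (frame_dual b) phi_lin phi_lin)
  (@Phi_std_mlin _ _ E) (fun=> erefl) frame_expand) /=.
have expand (I : 4.-tuple 'I_7) :
    phi [tuple frame_dual a; (map (tnth E) I)`_0; (map (tnth E) I)`_1] *
    phi [tuple frame_dual b; (map (tnth E) I)`_2; (map (tnth E) I)`_3] *
    Phi_std E (map_tuple (tnth E) I) =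
    \sum_c \sum_d frame_mx a c * frame_mx b d * (PhiZ (map val I) *
      (phiZ (val c :: take 2 (map val I)) * phiZ (val d :: drop 2 (map val I))))%:~R.
  rewrite (tuple4_ord_eta I) /= Phi_std_basis //.
  rewrite !mlin3_sum0 //= mulr_suml mulr_suml; apply: eq_bigr => c _.
  rewrite mulr_sumr mulr_suml; apply: eq_bigr => d _.
  set i := tnth I _; set j := tnth I _; set k := tnth I _; set l := tnth I _.
  have phiE p q r : phi [tuple tnth E p; tnth E q; tnth E r] =
      (phiZ [:: val p; val q; val r])%:~R.
    by rewrite -(phi_std_basis [tuple p; q; r] EB); congr phi; apply: val_inj.
  by rewrite !phiE !intrM; ring.
rewrite (eq_bigr _ (fun I _ => expand I)) exchange_big /=.
under eq_bigr => c _ do rewrite exchange_big /=.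
have sumE c d : \sum_(I : 4.-tuple 'I_7) frame_mx a c * frame_mx b d *
    (PhiZ (map val I) *
      (phiZ (val c :: take 2 (map val I)) * phiZ (val d :: drop 2 (map val I))))%:~R =
    24 * (frame_mx a c * frame_mx b d *+ (c == d)).
  rewrite -mulr_sumr (weighted_sumE _ _ PhiZ (fun I =>
      phiZ (val c :: take 2 I) * phiZ (val d :: drop 2 I))).
  rewrite -(eqP (tallP phiZ_contraction [tuple c; d])) /= (inj_eq val_inj).
  by case: eqP => _; rewrite ?mulr0n ?mulr0 // !mulr1n mulrC.
under eq_bigr => c _ do under eq_bigr => d _ do rewrite sumE.
rewrite [RHS]mulrCA; congr (_ * _); rewrite /gram mulr_sumr; apply: eq_bigr => c _.
rewrite (bigD1 c) //= eqxx mulr1n big1 ?addr0 // => d dc.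
by rewrite eq_sym (negbTE dc) mulr0n mulr0.
Qed.

End FrameChange.

(** * Locally Lipschitz dependence on finitely many components *)

Section LocallyLipschitz.
Context {R : realType} {T : Type} {I : finType}.
Variables (P : T -> Prop) (y : I -> T -> R) (x0 : T).
Hypothesis Px0 : P x0.

(** Only a pseudo-distance: distinct frames with the same 4-form have gap zero. A Lipschitz bound
    thus also says that a quantity depends, near the base point, on the components alone. *)
Definition gap (x x' : T) : R := \sum_i `|y i x - y i x'|.

(* [f x] is, for [x] satisfying [P], a locally Lipschitz function of the vector
   of the [y i x], near the value of this vector at [x0].  The radius of the
   ball is [C^-1], so that the property is monotone in [C]. *)
Definition loclip_with (C : R) (f : T -> R) : Prop :=
  forall x x', P x -> P x' -> C * gap x x0 <= 1 -> C * gap x' x0 <= 1 ->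
    `|f x - f x'| <= C * gap x x'.

Definition loclip (f : T -> R) : Prop := exists2 C, 0 <= C & loclip_with C f.

Lemma gap_ge0 x x' : 0 <= gap x x'.
Proof. exact: sumr_ge0. Qed.

Lemma gapxx x : gap x x = 0.
Proof. by apply: big1 => i _; rewrite subrr normr0. Qed.

Lemma loclip_with_le C C' f : C <= C' -> loclip_with C f -> loclip_with C' f.
Proof.
move=> CC' fC x x' Px Px' xC x'C.
have le u v : C * gap u v <= C' * gap u v by rewrite ler_wpM2r ?gap_ge0.
by apply: le_trans (le _ _); apply: fC => //; apply: le_trans (le _ _) _.
Qed.

Lemma loclip_with_bound C f x : P x -> C * gap x x0 <= 1 -> 0 <= C ->
  loclip_with C f -> `|f x| <= `|f x0| + 1.
Proof.
move=> Px xC C0 fC; have := fC x x0 Px Px0 xC; rewrite gapxx mulr0 => /(_ ler01) fx.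
by rewrite addrC -lerBlDr (le_trans (lerB_dist _ _)) ?(le_trans fx).
Qed.

Lemma loclip_ext f f' : (forall x, P x -> f x = f' x) -> loclip f -> loclip f'.
Proof.
by move=> ff' [C C0 fC]; exists C => // x x' Px Px'; rewrite -!ff' //; apply: fC.
Qed.

Lemma loclip_cst c : loclip (fun=> c).
Proof. by exists 0 => // x x' _ _ _ _; rewrite subrr normr0 mul0r. Qed.

Lemma loclip_coord i : loclip (y i).
Proof.
exists 1 => // x x' _ _ _ _; rewrite mul1r /gap (bigD1 i) //= lerDl.
exact: sumr_ge0.
Qed.

Lemma loclipD f f' : loclip f -> loclip f' -> loclip (fun x => f x + f' x).
Proof.
move=> [C C0 fC] [C' C'0 f'C]; exists (C + C'); first exact: addr_ge0.
have {}fC : loclip_with C f := fC.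
move=> x x' Px Px' xC x'C.
have le1 u : (C + C') * gap u x0 <= 1 -> C * gap u x0 <= 1 /\ C' * gap u x0 <= 1.
  rewrite mulrDl => le1; split; apply: le_trans le1.
    by rewrite lerDl mulr_ge0 ?gap_ge0.
  by rewrite lerDr mulr_ge0 ?gap_ge0.
have [x1 x2] := le1 _ xC; have [x'1 x'2] := le1 _ x'C.
rewrite opprD addrACA mulrDl (le_trans (ler_normD _ _)) // lerD //.
  exact: fC.
exact: f'C.
Qed.

Lemma loclipM f f' : loclip f -> loclip f' -> loclip (fun x => f x * f' x).
Proof.
move=> [C C0 fC] [C' C'0 f'C].
pose D := C + C'; have D0 : 0 <= D by exact: addr_ge0.
have {}fC : loclip_with D f by apply: loclip_with_le fC; rewrite lerDl.
have {}f'C : loclip_with D f' by apply: loclip_with_le f'C; rewrite lerDr.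
(* On the ball of radius [D^-1] each function moves by at most 1, so [K] bounds both factors. *)
pose K := (`|f x0| + 1) + (`|f' x0| + 1).
have K1 : 1 <= K by rewrite /K -addrA addrCA lerDl !addr_ge0.
have DK : D <= K * D by rewrite ler_peMl.
exists (K * D); first by rewrite mulr_ge0 // (le_trans ler01).
move=> x x' Px Px' xC x'C.
have le1 u : K * D * gap u x0 <= 1 -> D * gap u x0 <= 1.
  by apply: le_trans; rewrite ler_wpM2r ?gap_ge0.
have fx := loclip_with_bound Px (le1 _ xC) D0 fC.
have f'x' := loclip_with_bound Px' (le1 _ x'C) D0 f'C.
have -> : f x * f' x - f x' * f' x' = f x * (f' x - f' x') + (f x - f x') * f' x'.
  by ring.
rewrite (le_trans (ler_normD _ _)) // !normrM -mulrA mulrDl lerD //.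
  by rewrite ler_pM // f'C // ?le1.
by rewrite mulrC ler_pM // fC // ?le1.
Qed.

Lemma loclip_sum (J : finType) (Q : pred J) (f : J -> T -> R) :
  (forall j, loclip (f j)) -> loclip (fun x => \sum_(j | Q j) f j x).
Proof.
move=> fl; rewrite (_ : (fun _ => _) = \sum_(j | Q j) f j); last first.
  by apply/funext => x; rewrite fct_sumE.
by elim/big_ind: _ => [|u v|j _] //; [exact: loclip_cst|exact: loclipD].
Qed.

Lemma loclip_prod n (f : 'I_n -> T -> R) :
  (forall j, loclip (f j)) -> loclip (fun x => \prod_(j < n) f j x).
Proof.
move=> fl; rewrite (_ : (fun _ => _) = \prod_(j < n) f j); last first.
  by apply/funext => x; rewrite fct_prodE.
by elim/big_ind: _ => [|u v|j _] //; [exact: loclip_cst|exact: loclipM].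
Qed.

Lemma loclipV f : f x0 != 0 -> loclip f -> loclip (fun x => (f x)^-1).
Proof.
move=> f0 [C C0 fC]; set m := `|f x0|; have m0 : 0 < m by rewrite normr_gt0.
have m20 : 0 < m / 2 by rewrite divr_gt0.
have E1 : 0 <= C / (m / 2) by rewrite divr_ge0 // ltW.
have E2 : 0 <= C / (m / 2 * (m / 2)) by rewrite divr_ge0 // ltW // mulr_gt0.
(* The first term stays in the ball where [f] is Lipschitz, the second keeps its absolute value
   above [m / 2], and the third is the Lipschitz constant of the inverse there. *)
pose D := C + C / (m / 2) + C / (m / 2 * (m / 2)).
have D1 : C <= D by rewrite /D -addrA lerDl addr_ge0.
have D2 : C / (m / 2) <= D by rewrite /D addrAC lerDr addr_ge0.
have D3 : C / (m / 2 * (m / 2)) <= D by rewrite /D lerDr addr_ge0.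
exists D => [|x x' Px Px' xD x'D]; first exact: le_trans D1.
have low u : P u -> D * gap u x0 <= 1 -> m / 2 <= `|f u|.
  move=> Pu uD.
  have uC : C * gap u x0 <= 1 by apply: le_trans uD; rewrite ler_wpM2r ?gap_ge0.
  have : C / (m / 2) * gap u x0 <= 1 by apply: le_trans uD; rewrite ler_wpM2r ?gap_ge0.
  rewrite mulrAC ler_pdivrMr // mul1r => uC2.
  have := fC u x0 Pu Px0 uC; rewrite gapxx mulr0 => /(_ ler01) fu.
  have := le_trans (lerB_dist (f x0) (f u)); rewrite distrC.
  move=> /(_ _ (le_trans fu uC2)); rewrite -/m => fm.
  by rewrite {1}[m]splitr in fm; lra.
have fx := low _ Px xD; have fx' := low _ Px' x'D.
have nz u : m / 2 <= `|f u| -> f u != 0.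
  by move=> fu; rewrite -normr_gt0 (lt_le_trans m20).
have -> : (f x)^-1 - (f x')^-1 = (f x' - f x) / (f x * f x').
  by field; rewrite !nz.
rewrite normrM normrV ?unitfE ?mulf_neq0 ?nz // distrC normrM.
apply: le_trans (ler_wpM2r (gap_ge0 x x') D3); rewrite mulrAC.
apply: ler_pM => //.
- apply: fC => //.
    by apply: le_trans xD; rewrite ler_wpM2r ?gap_ge0.
  by apply: le_trans x'D; rewrite ler_wpM2r ?gap_ge0.
- by rewrite lef_pV2 ?posrE ?mulr_gt0 // ?(lt_le_trans m20) // ler_pM // ltW.
Qed.

(** In the factorization of [u ^+ n.+1 - v ^+ n.+1] by [u - v], the cofactor is at least [u ^+ n]
    for positive [u] and [v], hence bounded below near the base point. *)
Lemma loclip_root n f : (forall x, P x -> 0 < f x) ->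
  loclip (fun x => f x ^+ n.+1) -> loclip f.
Proof.
move=> f0 [C C0 fC].
have m0 := f0 _ Px0; set m := f x0 in m0; have m20 : 0 < m / 2 by rewrite divr_gt0.
(* As long as the power of [f] moves by at most [d], [f] itself stays above [m / 2]. *)
pose d := m ^+ n.+1 - (m / 2) ^+ n.+1.
have d0 : 0 < d.
  by rewrite subr_gt0 ltrXn2r // ?nnegrE ?ltW // ltr_pdivrMr // ltr_pMr // ltr1n.
have e0 : 0 < (m / 2) ^+ n by rewrite exprn_gt0.
have E1 : 0 <= C / d by rewrite divr_ge0 // ltW.
have E2 : 0 <= C / (m / 2) ^+ n by rewrite divr_ge0 // ltW.
pose D := C + C / d + C / (m / 2) ^+ n.
have D1 : C <= D by rewrite /D -addrA lerDl addr_ge0.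
have D2 : C / d <= D by rewrite /D addrAC lerDr addr_ge0.
have D3 : C / (m / 2) ^+ n <= D by rewrite /D lerDr addr_ge0.
exists D => [|x x' Px Px' xD x'D]; first exact: le_trans D1.
have Cle u : D * gap u x0 <= 1 -> C * gap u x0 <= 1.
  by apply: le_trans; rewrite ler_wpM2r ?gap_ge0.
have low u : P u -> D * gap u x0 <= 1 -> m / 2 <= f u.
  move=> Pu uD.
  have : C / d * gap u x0 <= 1 by apply: le_trans uD; rewrite ler_wpM2r ?gap_ge0.
  rewrite mulrAC ler_pdivrMr // mul1r => uC2.
  have := fC u x0 Pu Px0 (Cle _ uD); rewrite gapxx mulr0 => /(_ ler01) fu.
  rewrite -(@ler_pXn2r _ n.+1) //; [|exact: ltW|exact/ltW/f0].
  have := le_trans fu uC2; rewrite distrC => /ler_normlW; rewrite -/m /d.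
  by rewrite lerD2l lerN2.
have fx := low _ Px xD; have fx' := low _ Px' x'D.
have fpos := f0 _ Px; have f'pos := f0 _ Px'.
apply: le_trans (ler_wpM2r (gap_ge0 x x') D3); rewrite mulrAC ler_pdivlMr //.
apply: le_trans (fC x x' Px Px' (Cle _ xD) (Cle _ x'D)).
rewrite subrXX normrM ler_wpM2l // ger0_norm; last first.
  by apply: sumr_ge0 => i _; rewrite mulr_ge0 // exprn_ge0 // ltW.
rewrite big_ord_recl /= subn0 expr0 mulr1.
apply: (@le_trans _ _ (f x ^+ n)); first by rewrite lerXn2r // nnegrE ltW.
rewrite lerDl; apply: sumr_ge0 => i _.
by rewrite mulr_ge0 // exprn_ge0 // ltW.
Qed.

Lemma loclip_uniform (J : finType) (f : J -> T -> R) :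
  (forall j, loclip (f j)) -> exists2 C, 0 <= C & forall j, loclip_with C (f j).
Proof.
move=> fl; have /choice[C Cp] : forall j, exists C, 0 <= C /\ loclip_with C (f j).
  by move=> j; have [C C0 fC] := fl j; exists C.
exists (\sum_j C j) => [|j]; first by apply: sumr_ge0 => j _; case: (Cp j).
apply: loclip_with_le (Cp j).2; rewrite (bigD1 j) //= lerDl.
by apply: sumr_ge0 => i _; case: (Cp i).
Qed.

End LocallyLipschitz.

(** * Gronwall's inequality *)

Section Uniqueness.
Context {R : realType}.

(** The integrating factor [expR (C * s)] makes the function monotone. The sign [k] allows one
    statement for both directions of time. *)
Lemma gronwall_sign (w w' : R -> R) (k C a b : R) : a <= b ->
  (forall s, a <= s <= b -> is_derive s 1 w (w' s)) ->
  (forall s, a <= s <= b -> k * (w' s + C * w s) <= 0) ->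
  k * (w b * expR (C * b) - w a * expR (C * a)) <= 0.
Proof.
move=> ab wd wk.
have ud s : a <= s <= b -> is_derive s 1 (fun x => w x * expR (C * x))
    ((w' s + C * w s) * expR (C * s)).
  move=> sab; have ws := wd s sab.
  have es : is_derive s 1 (fun x => expR (C * x)) (C * expR (C * s)).
    have lin : is_derive s 1 (fun x : R => C * x) C.
      by have := is_deriveZ C (is_derive_id s (1 : R)); rewrite /GRing.scale /= mulr1.
    by apply: is_derive_eq (is_derive1_comp _ lin) _; rewrite mulrC.
  by apply: is_derive_eq (is_deriveM ws es) _; rewrite /GRing.scale /=; ring.
have ucont : {within `[a, b], continuous (fun x => w x * expR (C * x))}.
  apply: derivable_within_continuous => x; rewrite in_itv /= => xab.
  by have [] := ud x xab.
have ud' x : x \in `]a, b[%R -> is_derive x 1 (fun x => w x * expR (C * x))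
    ((w' x + C * w x) * expR (C * x)).
  by rewrite in_itv /= => /andP[ax xb]; apply: ud; rewrite !ltW.
have [c] := MVT_segment ab ud' ucont.
rewrite in_itv /= => cab ->; rewrite !mulrA.
by rewrite mulr_le0_ge0 ?subr_ge0 // mulr_le0_ge0 ?expR_ge0 // wk.
Qed.

Lemma gronwall_eq0 (w w' : R -> R) (C a b t : R) : a < t < b ->
  (forall s, a < s < b -> is_derive s 1 w (w' s)) ->
  (forall s, a < s < b -> `|w' s| <= C * w s) ->
  (forall s, 0 <= w s) -> w t = 0 -> forall s, a < s < b -> w s = 0.
Proof.
move=> /andP[at_ tb] wd wC w0 wt s /andP[as_ sb].
apply/eqP; rewrite eq_le w0 andbT.
have [ts|st] := leP t s.
  have sub x : t <= x <= s -> a < x < b.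
    by move=> /andP[tx xs]; rewrite (lt_le_trans at_ tx) (le_lt_trans xs sb).
  have := @gronwall_sign w w' 1 (- C) t s ts (fun x xi => wd x (sub x xi)).
  rewrite wt mul0r subr0 mul1r pmulr_lle0 ?expR_gt0 //; apply => x /sub xi.
  by rewrite mul1r mulNr subr_le0 (le_trans (ler_norm _)) // wC.
have sub x : s <= x <= t -> a < x < b.
  by move=> /andP[tx xs]; rewrite (lt_le_trans as_ tx) (le_lt_trans xs tb).
have := @gronwall_sign w w' (- 1) C s t (ltW st) (fun x xi => wd x (sub x xi)).
rewrite wt mul0r sub0r mulrN mulN1r opprK pmulr_lle0 ?expR_gt0 //; apply => x /sub xi.
by rewrite mulN1r oppr_le0 -lerBlDr sub0r lerNl; apply: le_trans (wC x xi);
  rewrite -normrN ler_norm.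
Qed.

Lemma cvg_sum_fin (J : finType) (h : J -> R -> R) (l : J -> R) (x : R) :
  (forall j, h j s @[s --> x] --> l j) ->
  \sum_j h j s @[s --> x] --> \sum_j l j.
Proof.
move=> hl; rewrite (_ : (fun _ => _) = \sum_j h j); last first.
  by apply/funext => s; rewrite fct_sumE.
apply: (big_ind2 (fun f y => f s @[s --> x] --> y)) => [|f y f' y' fy fy'|j _].
- exact: cvg_cst.
- exact: cvgD.
- exact: hl.
Qed.

(** The left-hand side is the derivative of the sum of the [u j ^+ 2] when [D j] is that of [u j].
    The bound is [2 |u_j| |u_i| <= u_j^2 + u_i^2], summed over both indices. *)
Lemma sum_mul_le (J : finType) (u : J -> R) (C : R) (D : J -> R) : 0 <= C ->
  (forall j, `|D j| <= C * \sum_i `|u i|) ->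
  `|\sum_j 2 * (u j * D j)| <= 2 * C * #|J|%:R * \sum_j u j ^+ 2.
Proof.
move=> C0 DC; apply: (@le_trans _ _ (\sum_j \sum_i C * (u j ^+ 2 + u i ^+ 2))).
  apply: le_trans (ler_norm_sum _ _ _) _; apply: ler_sum => j _.
  rewrite !normrM ger0_norm // mulrCA.
  apply: (le_trans (ler_wpM2l (normr_ge0 _) (ler_wpM2l _ (DC j)))) => //.
  rewrite !mulr_sumr; apply: ler_sum => i _.
  rewrite -!(real_normK (num_real (u _))).
  have -> : `|u j| * (2 * (C * `|u i|)) = C * (2 * `|u j| * `|u i|) by ring.
  rewrite ler_wpM2l // -subr_ge0.
  have -> : `|u j| ^+ 2 + `|u i| ^+ 2 - 2 * `|u j| * `|u i| = (`|u j| - `|u i|) ^+ 2 by ring.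
  exact: sqr_ge0.
set S := \sum_j u j ^+ 2.
have -> : \sum_j \sum_i C * (u j ^+ 2 + u i ^+ 2) = C * (#|J|%:R * S + #|J|%:R * S).
  under eq_bigr => j _ do
    rewrite -mulr_sumr big_split /= sumr_const -(mulr_natl (u j ^+ 2)).
  by rewrite -mulr_sumr big_split /= -mulr_sumr sumr_const -(mulr_natl S).
by rewrite le_eqVlt; apply/orP; left; apply/eqP; ring.
Qed.

Lemma is_derive_sum_fin (J : finType) (h : J -> R -> R) (dh : J -> R) (x : R) :
  (forall j, is_derive x 1 (h j) (dh j)) ->
  is_derive x 1 (fun s => \sum_j h j s) (\sum_j dh j).
Proof.
move=> hd; rewrite (_ : (fun _ => _) = \sum_j h j); last first.
  by apply/funext => s; rewrite fct_sumE.
apply: (big_ind2 (fun f df => is_derive x 1 f df)) => [|f df f' df' fd f'd|j _].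
- exact: is_derive_cst.
- exact: is_deriveD.
- exact: hd.
Qed.

End Uniqueness.

(** * Uniqueness of the coflow *)

Section CoflowUnique.
Context {R : realType} {g : vectType R}.
Variables (br : 'Hom(g, 'End(g))) (B : 7.-tuple g).
Hypotheses (brxx : forall x, br x x = 0) (BB : basis_of fullv B).

Let P (E : 7.-tuple g) : Prop := basis_of fullv E.
Let y (K : 4.-tuple 'I_7) (E : 7.-tuple g) : R := Phi_std E (map_tuple (tnth B) K).

(** For a closed 4-form the term of the Laplacian containing the codifferential of [d Phi] vanishes;
    this is what remains, as a function of the frame alone. *)
Definition coflow_rhs (E : 7.-tuple g) (v : 4.-tuple g) : R :=
  - ext_d br (hodge E (ext_d br (hodge E (Phi_std E) : kform g 3) : kform g 4)
              : kform g 3) v.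

Section BasePoint.
Variable E0 : 7.-tuple g.
Hypothesis E0B : P E0.

Let LL := loclip P y E0.

Lemma loclip_Phi_std v : LL (fun E => Phi_std E v).
Proof.
apply: (@loclip_ext _ _ _ _ _ _ (fun E => \sum_(I : 4.-tuple 'I_7)
    (\prod_(a < 4) coord B (tnth I a) (tnth v a)) * y I E)).
  by move=> E EB; rewrite -mlin_coord //; apply: Phi_std_mlin.
apply: loclip_sum => I; apply: (loclipM E0B); first exact: loclip_cst.
exact: loclip_coord.
Qed.

Lemma loclip_hodge_Phi_std v : LL (fun E => hodge B (Phi_std E) v).
Proof.
apply: (loclipM E0B); first exact: loclip_cst.
apply: loclip_sum => I; apply: (loclipM E0B); last exact: loclip_cst.
exact: loclip_Phi_std.
Qed.

(** The density that accompanies the inverse metric in [gram_contraction]; unlike the determinant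
    itself it does not see the orientation. *)
Let z E := \det (frame_mx B E) ^- 2.

Lemma z_gt0 E : P E -> 0 < z E.
Proof.
move=> EB; rewrite /z invr_gt0 exprn_even_gt0 //=.
exact: det_frame_neq0.
Qed.

Lemma loclip_zgram a b : LL (fun E => z E * gram B E a b).
Proof.
apply: (@loclip_ext _ _ _ _ _ _ (fun E => 24^-1 * (24 * (z E * gram B E a b)))).
  by move=> E EB; rewrite mulKf.
apply: (loclipM E0B); first exact: loclip_cst.
apply: (loclip_ext (fun E EB => gram_contraction BB EB a b)).
apply: loclip_sum => I; apply: (loclipM E0B); last exact: loclip_Phi_std.
by apply: (loclipM E0B); exact: loclip_hodge_Phi_std.
Qed.

(** The determinant of the 7 by 7 matrix [z * gram] is [z^7] times the squared determinant of the
    frame, that is [z^6]. So [z] is the positive sixth root of a polynomial in quantities already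
    known to be Lipschitz. *)
Lemma loclip_z : LL z.
Proof.
apply: (@loclip_root _ _ _ _ _ _ E0B 5); first exact: z_gt0.
apply: (@loclip_ext _ _ _ _ _ _ (fun E => \sum_(s : 'S_7) (-1) ^+ s *
    \prod_(i < 7) (z E * gram B E i (s i)))); last first.
  apply: loclip_sum => s; apply: (loclipM E0B); first exact: loclip_cst.
  by apply: (loclip_prod E0B) => i; exact: loclip_zgram.
move=> E EB; have d0 := det_frame_neq0 BB EB.
transitivity (\det (z E *: (frame_mx B E *m (frame_mx B E)^T))).
  apply: eq_bigr => s _; congr (_ * _); apply: eq_bigr => i _.
  by rewrite !mxE; congr (_ * _); apply: eq_bigr => c _; rewrite !mxE.
by rewrite detZ det_mulmx det_tr /z; field.
Qed.

Lemma loclip_gram a b : LL (fun E => gram B E a b).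
Proof.
apply: (@loclip_ext _ _ _ _ _ _ (fun E => (z E)^-1 * (z E * gram B E a b))).
  by move=> E EB; rewrite mulKf // gt_eqF // z_gt0.
apply: (loclipM E0B); last exact: loclip_zgram.
by apply: (loclipV E0B); [rewrite gt_eqF // z_gt0|exact: loclip_z].
Qed.

(** Multiplication by the determinant removes the ambiguity of orientation: what is left is a
    polynomial in [gram] and in the components of [al]. *)
Lemma loclip_hodge k (al : 7.-tuple g -> kform g k) v : (k <= 7)%N ->
  (forall E, P E -> mlin (al E)) -> (forall w, LL (fun E => al E w)) ->
  LL (fun E => \det (frame_mx B E) * hodge E (al E) v).
Proof.
move=> k7 al_lin all.
apply: (@loclip_ext _ _ _ _ _ _ (fun E => k`!%:R^-1 * \sum_(I : k.-tuple 'I_7)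
    (\sum_(K : k.-tuple 'I_7) (\prod_(a < k) gram B E (tnth I a) (tnth K a)) *
       al E (map_tuple (tnth B) K)) * vol B (map (tnth B) I ++ v))).
  move=> E EB; rewrite (hodge_frame_gram BB EB) ?mulVKf //; last exact: al_lin.
  exact: det_frame_neq0.
apply: (loclipM E0B); first exact: loclip_cst.
apply: loclip_sum => I; apply: (loclipM E0B); last exact: loclip_cst.
apply: loclip_sum => K; apply: (loclipM E0B); last exact: all.
by apply: (loclip_prod E0B) => a; exact: loclip_gram.
Qed.

Lemma loclip_ext_d k (al : 7.-tuple g -> kform g k.+1) v :
  (forall w, LL (fun E => al E w)) -> LL (fun E => ext_d br (al E) v).
Proof.
move=> all; apply: loclip_sum => j; apply: loclip_sum => i.
by apply: (loclipM E0B); [exact: loclip_cst|exact: all].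
Qed.

(** The two stars contribute two determinants, whose product is the inverse of [z]; the sign
    disappears and every remaining factor is Lipschitz. *)
Lemma loclip_coflow_rhs v : LL (fun E => coflow_rhs E v).
Proof.
pose H k E (al : kform g k) : kform g (7 - k) :=
  fun w => \det (frame_mx B E) * hodge E al w.
apply: (@loclip_ext _ _ _ _ _ _ (fun E => - z E *
    ext_d br (H 4 E (ext_d br (H 4 E (Phi_std E) : kform g 3)) : kform g 3) v)).
  move=> E EB; have d0 := det_frame_neq0 BB EB.
  rewrite /coflow_rhs mulNr; congr (- _).
  rewrite /H (@ext_dZ _ _ _ 2) mulrA.
  rewrite (@ext_d_ext _ _ _ 2 _ (fun w => \det (frame_mx B E) *
    hodge E (ext_d br (hodge E (Phi_std E) : kform g 3)) w)); last first.
    move=> w; rewrite -hodgeZ; apply: hodge_ext => u.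
    by rewrite (@ext_dZ _ _ _ 2).
  by rewrite (@ext_dZ _ _ _ 2) /z mulrA; field.
have Hlin E : mlin (H 4 E (Phi_std E) : kform g 3).
  exact: (mlinZl _ (@hodge_mlin _ _ E 4 _ isT)).
apply: (loclipM E0B).
  by apply: (loclip_ext (fun E EB => mulN1r (z E))); apply: (loclipM E0B);
    [exact: loclip_cst|exact: loclip_z].
apply: (@loclip_ext_d 2) => w; apply: (loclip_hodge (k := 4)) => //.
  by move=> E EB; apply: ext_d3_mlin; exact: Hlin.
move=> u; apply: (@loclip_ext_d 2) => u'; apply: (loclip_hodge (k := 4)) => //.
  by move=> E EB; apply: Phi_std_mlin.
exact: loclip_Phi_std.
Qed.

End BasePoint.

Lemma laplacian4_Phi_std (E : 7.-tuple g) (Psi : kform g 4) :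
  basis_of fullv E -> Psi =1 Phi_std E -> ext_d br Psi =1 (fun=> 0) ->
  forall v, - laplacian4 br E Psi v = coflow_rhs E v.
Proof.
move=> EB PsiE dPsi v; rewrite /laplacian4 /coflow_rhs /codiff5.
rewrite (_ : hodge (k := 3) E _ v = 0) ?oppr0 ?addr0; last first.
  rewrite (@hodge_ext _ _ _ 3 _ (fun=> 0)) ?hodge0 // => w.
  rewrite (@ext_d_ext _ _ _ 1 _ (fun=> 0)) ?ext_d0 // => u.
  by rewrite (@hodge_ext _ _ _ 5 _ (fun=> 0)) ?hodge0.
congr (- _); apply: (@ext_d_ext _ _ _ 2) => w; apply: (@hodge_ext _ _ _ 4) => u.
by apply: (@ext_d_ext _ _ _ 2) => x; apply: hodge_ext.
Qed.

(** Frames obtained in this way at different times bear no relation to each other. *)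
Lemma coflow_frame (Psi0 : kform g 4) I Psi t :
  is_coflow_solution br Psi0 I Psi -> I t ->
  exists E, [/\ P E, Psi t =1 Phi_std E &
    forall v, is_derive t 1 (fun s => Psi s v) (coflow_rhs E v)].
Proof.
move=> [_ _ _ _ sol] /sol[phi [E [[EB phiE] PsiE dPsi Psi']]].
have PsiE' : Psi t =1 Phi_std E.
  move=> v; rewrite PsiE (hodge_ext E phiE).
  by rewrite (hodge_phi_std EB).
by exists E; split=> // v; rewrite -(laplacian4_Phi_std EB PsiE' dPsi).
Qed.

Let comp (Psi : R -> kform g 4) (K : 4.-tuple 'I_7) (s : R) :=
  Psi s (map_tuple (tnth B) K).

(** By continuity both solutions stay, near [t], in a ball where all components of the right-hand
    side share one Lipschitz constant; Gronwall applies to the squared distance [w]. *)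
Lemma coflow_unique_near (Psi0 Psi0' : kform g 4) I I' Psi Psi' t :
  is_coflow_solution br Psi0 I Psi -> is_coflow_solution br Psi0' I' Psi' ->
  I t -> I' t -> Psi t =1 Psi' t ->
  \forall s \near t, [/\ I s, I' s & Psi s =1 Psi' s].
Proof.
move=> sol sol' It I't eqt.
have [E0 [E0B PsiE0 dPsi0]] := coflow_frame sol It.
have [E1 [_ PsiE1 dPsi1]] := coflow_frame sol' I't.
have [C C0 lip] := loclip_uniform (fun K : 4.-tuple 'I_7 =>
  loclip_coflow_rhs E0B (map_tuple (tnth B) K)).
have near_gap F E : (forall v, is_derive t 1 (fun s => F s v) (coflow_rhs E v)) ->
    (forall K, comp F K t = y K E0) ->
    \forall s \near t, C * (\sum_K `|comp F K s - y K E0|) <= 1.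
  move=> dF FE0.
  have cF K : (fun s => comp F K s) @ t --> y K E0.
    rewrite -FE0; have [dK _] := dF (map_tuple (tnth B) K).
    by apply: differentiable_continuous; apply/derivable1_diffP.
  have cS : (fun s => C * (\sum_K `|comp F K s - y K E0|)) @ t -->
      C * (\sum_(K : 4.-tuple 'I_7) `|y K E0 - y K E0|).
    apply: cvgMl_tmp; apply: cvg_sum_fin => K.
    by apply: cvg_norm; apply: cvgB; [exact: cF|exact: cvg_cst].
  rewrite [X in C * X]big1 ?mulr0 in cS; last by move=> K _; rewrite subrr normr0.
  exact: (cvgr_le _ cS _ ltr01).
have nI : \forall s \near t, I s by have [oI _ _ _ _] := sol; exact: open_nbhs_nbhs.
have nI' : \forall s \near t, I' s by have [oI _ _ _ _] := sol'; exact: open_nbhs_nbhs.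
have n1 := near_gap Psi E0 dPsi0 (fun K => PsiE0 _).
(* The frame [E1] serves only for the derivative of [Psi']; the base point of the estimate is [E0]
   for both solutions, as their 4-forms agree at [t]. *)
have n2 := near_gap Psi' E1 dPsi1 (fun K => etrans (esym (eqt _)) (PsiE0 _)).
have nn : nbhs t (fun s => (I s /\ I' s) /\
    (C * (\sum_K `|comp Psi K s - y K E0|) <= 1 /\
     C * (\sum_K `|comp Psi' K s - y K E0|) <= 1)).
  by apply: filterI; apply: filterI.
move/nbhs_ballP: nn => [d /= d0 dsub].
pose u K s := comp Psi K s - comp Psi' K s.
pose w s := \sum_K u K s ^+ 2.
(* Written with actual derivatives, so that no choice of a frame at every time is needed. *)
pose w' s := \sum_K 2 * (u K s * ('D_1 (comp Psi K) s - 'D_1 (comp Psi' K) s)).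
have inb s : t - d < s < t + d -> ball t d s.
  by move=> sd; rewrite /ball /= distrC ltr_distl.
have wd s : t - d < s < t + d -> is_derive s 1 w (w' s) /\
    `|w' s| <= 2 * C * #|{: 4.-tuple 'I_7}|%:R * w s.
  move=> /inb/dsub[[Is I's] [g1 g2]].
  have [E [EB PsiE dPsi]] := coflow_frame sol Is.
  have [E' [E'B PsiE' dPsi']] := coflow_frame sol' I's.
  have DE K : 'D_1 (comp Psi K) s = coflow_rhs E (map_tuple (tnth B) K).
    by have [_ e] := dPsi (map_tuple (tnth B) K); exact: e.
  have DE' K : 'D_1 (comp Psi' K) s = coflow_rhs E' (map_tuple (tnth B) K).
    by have [_ e] := dPsi' (map_tuple (tnth B) K); exact: e.
  split.
    apply: is_derive_sum_fin => K; rewrite DE DE'.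
    have ud : is_derive s 1 (u K) (coflow_rhs E (map_tuple (tnth B) K) -
      coflow_rhs E' (map_tuple (tnth B) K)) by apply: is_deriveB.
    rewrite (_ : (fun r => u K r ^+ 2) = u K * u K); last first.
      by apply/funext => r; rewrite expr2.
    by apply: is_derive_eq (is_deriveM ud ud) _; rewrite /GRing.scale /=; ring.
  apply: sum_mul_le => // K; rewrite DE DE'.
  have -> : \sum_J `|u J s| = gap y E E'.
    by apply: eq_bigr => J _; rewrite /u /comp PsiE PsiE'.
  apply: lip => //.
    by rewrite /gap; under eq_bigr => J _ do rewrite /y -PsiE.
  by rewrite /gap; under eq_bigr => J _ do rewrite /y -PsiE'.
have w0 s : t - d < s < t + d -> w s = 0.
  apply: (@gronwall_eq0 R w w' (2 * C * #|{: 4.-tuple 'I_7}|%:R) _ _ t).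
  - by rewrite ltrBlDr ltrDl d0 /=.
  - by move=> r /wd[].
  - by move=> r /wd[].
  - by move=> r; apply: sumr_ge0 => K _; apply: sqr_ge0.
  - by apply: big1 => K _; rewrite /u /comp eqt subrr expr0n.
apply/nbhs_ballP; exists d => //= s sd.
have [[Is I's] _] := dsub _ sd; split=> // v.
have [E [EB PsiE _]] := coflow_frame sol Is.
have [E' [E'B PsiE' _]] := coflow_frame sol' I's.
rewrite PsiE PsiE'; apply: (mlin_ext BB); [exact: Phi_std_mlin|exact: Phi_std_mlin|].
move=> K; apply/eqP; rewrite -subr_eq0 -PsiE -PsiE' -sqrf_eq0.
have /eqP := w0 s (ltac:(by move: sd; rewrite /ball /= distrC ltr_distl)).
rewrite psumr_eq0; last by move=> J _; apply: sqr_ge0.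
by move=> /allP/(_ K (mem_index_enum _)).
Qed.

(** The set of coincidence contains 0, is open by local uniqueness and relatively closed by
    continuity; the intersection of the two intervals is connected. *)
Lemma coflow_unique (Psi0 : kform g 4) I I' Psi Psi' :
  is_coflow_solution br Psi0 I Psi -> is_coflow_solution br Psi0 I' Psi' ->
  forall t, I t -> I' t -> Psi t =1 Psi' t.
Proof.
move=> sol sol'; pose Z := [set t | I t /\ I' t /\ Psi t =1 Psi' t].
have [oI itvI I0 Psi00 _] := sol; have [oI' itvI' I'0 Psi'00 _] := sol'.
suff ZE : Z = I `&` I'.
  by move=> t It I't; have [_ []] : Z t by rewrite ZE; split.
have /connected_intervalP : is_interval (I `&` I').
  move=> a b [Ia I'a] [Ib I'b] c cab; split; first exact: itvI Ia Ib _ cab.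
  exact: itvI' I'a I'b _ cab.
have oZ : open Z.
  rewrite openE => t [It [I't eqt]]; rewrite /interior.
  apply: filterS (coflow_unique_near sol sol' It I't eqt) => s [Is I's eqs].
  by [].
apply.
- by exists 0; split=> //; split=> // v; rewrite Psi00 Psi'00.
- exists Z => //; apply/seteqP; split=> [t [It [I't eqt]]|t []//].
  by split; [split|split].
- exists (closure Z); first exact: closed_closure.
  apply/seteqP; split=> [t Zt|t [[It I't] cZt]].
    split; last exact: subset_closure.
    by case: Zt => It [I't _].
  split=> //; split=> // v.
  have [E [_ _ dPsi]] := coflow_frame sol It.
  have [E' [_ _ dPsi']] := coflow_frame sol' I't.
  have c : (fun s => Psi s v - Psi' s v) @ t --> Psi t v - Psi' t v.
    apply: (differentiable_continuous (f := fun s => Psi s v - Psi' s v)).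
    apply/derivable1_diffP; apply: derivableB.
      by have [] := dPsi v.
    by have [] := dPsi' v.
  (* A nonzero difference at [t] would persist nearby, whereas points of [Z] accumulate at [t]. *)
  apply/eqP; rewrite -subr_eq0; apply: contraT => nz.
  have [s [[_ [_ eqs]]]] := cZt _ (cvgr_neq0 _ c nz).
  by rewrite /= eqs subrr eqxx.
Qed.

End CoflowUnique.

(** * Diagonalization of real symmetric matrices and endomorphisms *)

Section RealSpectral.
Context {R : realType}.

(** Over the complex numbers the matrix is Hermitian, hence diagonalizable with real spectrum. A
    product of distinct real linear factors therefore annihilates it; this descends to the reals,
    where such an annihilator implies diagonalizability. *)
Lemma symmetric_diagonalizable n (A : 'M[R]_n.+1) : A^T = A ->
  exists2 Q : 'M[R]_n.+1, Q \in unitmx &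
    exists d : 'rV[R]_n.+1, Q *m A = diag_mx d *m Q.
Proof.
move=> As; pose C := R[i]; pose iota := real_complex R.
pose Ac : 'M[C]_n.+1 := map_mx iota A.
have Ac_herm : Ac \is hermsymmx.
  apply: realsym_hermsym.
    apply/is_hermitianmxP; rewrite expr0 scale1r map_mx_id //.
    by apply/matrixP => i j; rewrite !mxE -[in LHS]As mxE.
  by apply/mxOverP => i j; rewrite mxE; apply/complex_realP; exists (A i j).
have /orthomx_spectralP AcE := hermitian_normalmx Ac_herm.
have /mxOverP d_real := hermitian_spectral_diag_real Ac_herm.
set P := spectralmx Ac in AcE; set sp := spectral_diag Ac in AcE d_real.
have Punit : P \in unitmx := spectral_unit Ac.
clearbody P sp.
pose r i := complex.Re (sp 0 i).
have spE i : sp 0 i = iota (r i).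
  by have /complex_realP[x xE] := d_real 0 i; rewrite /r xE.
(* Repetitions are removed because the criterion asks for simple roots. *)
pose rs := undup [seq r i | i <- enum 'I_n.+1].
suff /diagonalizableP[Q Qunit /diagonalizable_forPex[d /(simmxP Qunit) QA]] :
    exists2 rs, uniq rs & mxminpoly A %| \prod_(x <- rs) ('X - x%:P).
  by exists Q => //; exists d.
exists rs; first exact: undup_uniq.
apply: mxminpoly_min; apply: (map_mx_inj (f := iota)).
rewrite map_horner_mx.
rewrite -/Ac AcE.
rewrite horner_mx_uconjC; last by [].
rewrite horner_mx_diag.
suff -> : map_mx (horner (map_poly iota (\prod_(x <- rs) ('X - x%:P)))) sp = 0.
  by rewrite (_ : diag_mx 0 = 0) ?mulmx0 ?mul0mx ?raddf0.
apply/rowP => j; rewrite !mxE spE horner_map; apply/eqP.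
rewrite (_ : _.[r j] = 0) ?rmorph0 //; apply/eqP; rewrite -/(root _ _) root_prod_XsubC.
by rewrite mem_undup map_f // mem_enum.
Qed.

End RealSpectral.

Section Eigenbasis.
Context {R : realType} {g : vectType R}.

Lemma basis_of_unitmx n (B : n.-tuple g) (Q : 'M[R]_n) :
  basis_of fullv B -> Q \in unitmx ->
  basis_of fullv [tuple \sum_a Q i a *: tnth B a | i < n].
Proof.
move=> BB Qu; set U := [tuple _ | _ < _].
rewrite basisEdim size_tuple; apply/andP; split; last by rewrite (size_basis BB).
apply/subvP => v _; rewrite (basis_expand v BB); apply: memv_suml => b _.
apply: memvZ; rewrite (_ : tnth B b = \sum_i invmx Q b i *: tnth U i).
  by apply: memv_suml => i _; apply: memvZ; apply: memv_span; apply: mem_tnth.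
under eq_bigr => i _ do rewrite tnth_mktuple scaler_sumr.
rewrite exchange_big /= (bigD1 b) //= [X in _ = _ + X]big1 => [|a ab].
  under eq_bigr => i _ do rewrite scalerA.
  rewrite -scaler_suml (_ : \sum_i _ = (invmx Q *m Q) b b); last by rewrite mxE.
  by rewrite mulVmx // mxE eqxx scale1r addr0.
under eq_bigr => i _ do rewrite scalerA.
rewrite -scaler_suml (_ : \sum_i _ = (invmx Q *m Q) b a); last by rewrite mxE.
by rewrite mulVmx // mxE eq_sym (negbTE ab) scale0r.
Qed.

(** Symmetry refers to the matrix in [B], which thus stands for an orthonormal basis; the eigenbasis
    only has to be a basis, since it serves to compute exponentials. *)
Lemma symmetric_eigenbasis n (B : n.+1.-tuple g) (D : 'End(g)) :
  basis_of fullv B ->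
  (forall a b, coord B a (D (tnth B b)) = coord B b (D (tnth B a))) ->
  exists (U : n.+1.-tuple g) (d : 'I_n.+1 -> R),
    basis_of fullv U /\ forall i, D (tnth U i) = d i *: tnth U i.
Proof.
move=> BB Dsym; pose A := \matrix_(a, b) coord B a (D (tnth B b)).
have As : A^T = A by apply/matrixP => a b; rewrite !mxE Dsym.
have [Q Qu [d QA]] := symmetric_diagonalizable As.
exists [tuple \sum_a Q i a *: tnth B a | i < n.+1], (fun i => d 0 i); split.
  exact: basis_of_unitmx.
move=> i; rewrite tnth_mktuple linear_sum scaler_sumr /=.
under eq_bigr => a _ do rewrite linearZ /= (basis_expand (D (tnth B a)) BB) scaler_sumr.
rewrite exchange_big /=; apply: eq_bigr => b _.
under eq_bigr => a _ do rewrite scalerA.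
rewrite -scaler_suml scalerA; congr (_ *: _).
have := congr1 (fun M : 'M[R]_(n.+1) => M i b) QA; rewrite mul_diag_mx !mxE => <-.
by apply: eq_bigr => a _; rewrite mxE Dsym.
Qed.

End Eigenbasis.

(** * Transport of the flow equation along a linear isomorphism *)

Section Naturality.
Context {R : realType} {g : vectType R}.

Lemma linfunE (F : g -> g) : linear F -> forall v, linfun F v = F v.
Proof.
move=> Flin v.
pose mF := GRing.isLinear.Build R g g *:%R F Flin.
pose F' : {linear g -> g} := HB.pack F mF.
exact: (lfunE F' v).
Qed.

Lemma coord_mxlin n (b : n.-tuple g) (m : 'I_n -> R) : basis_of fullv b ->
  exists T : 'End(g), forall i v, coord b i (T v) = m i * coord b i v.
Proof.
move=> bB; pose F v := \sum_j (m j * coord b j v) *: tnth b j.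
have Flin : linear F.
  move=> c x y; rewrite /F scaler_sumr -big_split; apply: eq_bigr => j _ /=.
  by rewrite linearP /= mulrDr scalerDl scalerA mulrCA.
exists (linfun F) => i v; rewrite linfunE // linear_sum (bigD1 i) //=.
rewrite linearZ /= coord_tnth // eqxx mulr1 big1 ?addr0 // => j ji.
by rewrite linearZ /= coord_tnth // eq_sym (negbTE ji) mulr0.
Qed.

Section InverseMaps.
Variables (E : 7.-tuple g) (T T' : 'End(g)).
Hypotheses (EB : basis_of fullv E) (TK : cancel T T') (T'K : cancel T' T).

Let TE := map_tuple T E.

Lemma basis_map : basis_of fullv TE.
Proof.
rewrite basisEdim size_tuple; apply/andP; split; last by rewrite (size_basis EB).
apply/subvP => v _; rewrite -[v]T'K (basis_expand (T' v) EB) linear_sum.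
apply: memv_suml => i _; rewrite linearZ; apply: memvZ; apply: memv_span => /=.
by rewrite map_f // mem_tnth.
Qed.

Lemma coord_map i v : coord TE i v = coord E i (T' v).
Proof.
rewrite -{1}[v]T'K {1}(basis_expand (T' v) EB) !linear_sum.
rewrite (bigD1 i) //= big1 => [|j ji].
  by rewrite !linearZ /= -tnth_map coord_tnth ?basis_map // eqxx mulr1 addr0.
rewrite !linearZ /= -tnth_map coord_tnth ?basis_map //.
by rewrite eq_sym (negbTE ji) mulr0.
Qed.

Lemma coform_map k I v : (coform TE I : kform g k) v = coform E I (map_tuple T' v).
Proof.
by congr (\det _); apply/matrixP => i j; rewrite !mxE coord_map tnth_map.
Qed.

Lemma Phi_std_map v : Phi_std TE v = Phi_std E (map_tuple T' v).
Proof. by rewrite /Phi_std /= !coform_map. Qed.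

Lemma hodge_map k (al : kform g k) v : (k <= 7)%N ->
  hodge TE (fun w => al (map_tuple T' w)) v = hodge E al (map_tuple T' v).
Proof.
move=> k7; congr (_ * _); apply: eq_bigr => I _; congr (al _ * _).
  by apply: eq_from_tnth => a; rewrite !tnth_map TK.
congr (\det _); apply/matrixP => i j; rewrite !mxE coord_map; congr coord.
have sI : size (map (tnth E) I ++ map_tuple T' v) = 7.
  by rewrite size_cat !size_tuple subnKC.
have -> : map (tnth E) I ++ map_tuple T' v = map T' (map (tnth TE) I ++ v).
  rewrite map_cat -map_comp; congr (_ ++ _); apply: eq_map => i0 /=.
  by rewrite tnth_map TK.
by rewrite (nth_map 0) // size_cat !size_tuple subnKC.
Qed.

(** Each term of the differential contains exactly one bracket, so the factor [la] comes out
    once. *)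
Lemma ext_d_map (br : 'Hom(g, 'End(g))) (la : R) k (al : kform g k.+1) v :
  (forall x y, T' (br x y) = la *: br (T' x) (T' y)) -> mlin al ->
  ext_d br (fun w => al (map_tuple T' w)) v = la * ext_d br al (map_tuple T' v).
Proof.
move=> T'br al_lin; rewrite /ext_d mulr_sumr; apply: eq_bigr => j _.
rewrite mulr_sumr; apply: eq_bigr => i _; rewrite mulrCA; congr (_ * _).
set w := [tuple _ | _ < _]; set x := br _ _.
have -> : map_tuple T' [tuple of x :: w] = [tuple of T' x :: map_tuple T' w].
  exact: val_inj.
rewrite T'br -(upd_cons0 0) mlinZ // upd_cons0; congr (_ * al _).
apply: eq_from_tnth => a; case: (unliftP ord0 a) => [b|] ->.
  by rewrite !tnthS tnth_map !tnth_mktuple tnth_map.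
by rewrite !tnth0 !tnth_map.
Qed.

(** The stars are natural without any factor, because the frame is transported too; each of the two
    differentials costs one [la]. *)
Lemma coflow_rhs_map (br : 'Hom(g, 'End(g))) (la : R) v :
  (forall x y, T' (br x y) = la *: br (T' x) (T' y)) ->
  coflow_rhs br TE v = la ^+ 2 * coflow_rhs br E (map_tuple T' v).
Proof.
move=> T'br; rewrite /coflow_rhs mulrN; congr (- _).
pose al1 : kform g 3 := hodge E (Phi_std E).
pose al2 : kform g 4 := ext_d br al1.
pose al3 : kform g 3 := hodge E al2.
have al1_lin : mlin al1 by exact: (@hodge_mlin _ _ E 4).
have al3_lin : mlin al3 by exact: (@hodge_mlin _ _ E 4).
have E1 : (hodge TE (Phi_std TE) : kform g 3) =1 (fun w => al1 (map_tuple T' w)).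
  move=> w; rewrite (@hodge_ext _ _ _ 4 _ _ Phi_std_map).
  exact: (@hodge_map 4).
have E2 : ext_d br (hodge TE (Phi_std TE) : kform g 3) =1
    (fun w => la * al2 (map_tuple T' w)).
  by move=> w; rewrite (@ext_d_ext _ _ _ 2 _ _ E1) (ext_d_map (k := 2) w T'br al1_lin).
have E3 : (hodge TE (ext_d br (hodge TE (Phi_std TE) : kform g 3) : kform g 4)
    : kform g 3) =1 (fun w => la * al3 (map_tuple T' w)).
  move=> w; rewrite (@hodge_ext _ _ _ 4 _ _ E2) hodgeZ; congr (_ * _).
  exact: (@hodge_map 4).
rewrite (@ext_d_ext _ _ _ 2 _ _ E3) (@ext_dZ _ _ _ 2) expr2 -mulrA; congr (_ * _).
exact: (ext_d_map (k := 2) v T'br al3_lin).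
Qed.

End InverseMaps.

End Naturality.

(** * The exponential action in an eigenbasis *)

Section Eigenvalues.
Context {R : realType} {g : vectType R}.
Variables (U : 7.-tuple g) (d : 'I_7 -> R) (D : 'End(g)).
Hypotheses (UB : basis_of fullv U) (DU : forall i, D (tnth U i) = d i *: tnth U i).

Definition weight {k : nat} (K : k.-tuple 'I_7) : R := \sum_(a < k) d (tnth K a).

Lemma vartheta_eigen k (be : kform g k) (K : k.-tuple 'I_7) : mlin be ->
  vartheta D be (map_tuple (tnth U) K) = - weight K * be (map_tuple (tnth U) K).
Proof.
move=> be_lin; rewrite /vartheta mulNr mulr_suml; congr (- _).
apply: eq_bigr => i _.
set w := map_tuple _ _.
rewrite (_ : [tuple _ | _ < _] = upd w i (d (tnth K i) *: tnth U (tnth K i))); last first.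
  by apply: eq_from_tnth => j; rewrite tnth_mktuple tnth_upd; case: eqP => // ->;
    rewrite tnth_map DU.
by rewrite mlinZ // (_ : upd w i _ = w) // -[RHS](upd_id w i) tnth_map.
Qed.

(** On tuples of eigenvectors [vartheta D] multiplies by minus the weight. The series defining
    [exp_act] is therefore a finite combination of scalar exponential series, which also gives its
    convergence. *)
Lemma exp_act_eigen k (f : R) (al : kform g k) v : mlin al ->
  exp_act f D al v = \sum_(K : k.-tuple 'I_7)
    (\prod_(a < k) coord U (tnth K a) (tnth v a)) *
    al (map_tuple (tnth U) K) * expR (- f * weight K).
Proof.
move=> al_lin; pose T (be : kform g k) v := f * vartheta D be v.
rewrite /exp_act /exp_op -/T.
have iter_lin n : mlin (iter n T al).
  by elim: n => // n IH; apply: mlinZl; apply: vartheta_mlin.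
have iterE n K : iter n T al (map_tuple (tnth U) K) =
    (- f * weight K) ^+ n * al (map_tuple (tnth U) K).
  elim: n => [|n IH]; first by rewrite expr0 mul1r.
  by rewrite /= /T vartheta_eigen // -/T IH exprS; ring.
have -> : series (fun n => (n`!%:R)^-1 * iter n T al v) =
    (fun n => \sum_(K : k.-tuple 'I_7)
      (\prod_(a < k) coord U (tnth K a) (tnth v a)) * al (map_tuple (tnth U) K) *
       series (exp_coeff (- f * weight K)) n).
  apply/funext => n; rewrite /series /=.
  under [RHS]eq_bigr => K _ do rewrite mulr_sumr.
  rewrite exchange_big /=; apply: eq_bigr => i _.
  rewrite (mlin_coord _ UB (iter_lin i)) mulr_sumr; apply: eq_bigr => K _.
  by rewrite iterE /exp_coeff /=; set p := _ ^+ i; ring.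
apply/cvg_lim => //.
rewrite (_ : (fun _ => _) = \sum_(K : k.-tuple 'I_7) fun n =>
    (\prod_(a < k) coord U (tnth K a) (tnth v a)) * al (map_tuple (tnth U) K) *
       series (exp_coeff (- f * weight K)) n); last first.
  by apply/funext => n; rewrite fct_sumE.
apply: (big_ind2 (fun (f : R^nat) y => f n @[n --> \oo] --> y)) => [|u y u' y' uy uy'|K _].
- exact: cvg_cst.
- exact: cvgD.
- apply: cvgMl_tmp; exact: is_cvg_series_exp_coeff.
Qed.

End Eigenvalues.

(** * The scaling [c(t)] and the time change [f(t)] *)

Section CoflowTime.
Context {R : realType}.
Implicit Types c t : R.

Lemma is_derive_affine c t : is_derive t 1 (fun s : R => 1 - 2 * c * s) (- (2 * c)).
Proof.
have := is_deriveB (is_derive_cst (1 : R) t 1) (is_deriveZ (2 * c) (is_derive_id t (1 : R))).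
by rewrite sub0r /GRing.scale /= mulr1.
Qed.

Lemma is_derive_coflow_time c t : 0 < 1 - 2 * c * t ->
  is_derive t 1 (coflow_time c) (1 - 2 * c * t)^-1.
Proof.
move=> q0; rewrite /coflow_time; have [->|c0] := eqVneq c 0.
  by rewrite mulr0 mul0r subr0 invr1; exact: is_derive_id.
have lnd := @is_derive1_comp R (@ln R) (fun s => 1 - 2 * c * s) t _ _
  (is_derive1_ln q0) (is_derive_affine c t).
have := is_deriveZ (- (2 * c)^-1) lnd; rewrite /GRing.scale /=.
rewrite (_ : - (2 * c)^-1 * _ = (1 - 2 * c * t)^-1) //.
by field; rewrite c0 gt_eqF.
Qed.

(** With [q = 1 - 2ct], the derivative of [q^2] is [-4cq] and that of [f] is [1/q]. Both terms carry
    one factor [q], and [4c + w] is the weight that [X0 = c + D] gives to a 4-form component of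
    weight [w] under [D]. *)
Lemma is_derive_coflow_mode c t (w : R) : 0 < 1 - 2 * c * t ->
  is_derive t 1 (fun s => coflow_scale c s * expR (- coflow_time c s * w))
    ((1 - 2 * c * t) * expR (- coflow_time c t * w) * - (4 * c + w)).
Proof.
move=> q0; have qd := is_derive_affine c t.
have sd : is_derive t 1 (coflow_scale c) (- (4 * c) * (1 - 2 * c * t)).
  rewrite (_ : coflow_scale c = (fun s => 1 - 2 * c * s) * (fun s => 1 - 2 * c * s)).
    by apply: is_derive_eq (is_deriveM qd qd) _; rewrite /GRing.scale /=; ring.
  by apply/funext => s; rewrite /coflow_scale expr2.
have fd : is_derive t 1 (fun s => - coflow_time c s * w) (- w * (1 - 2 * c * t)^-1).
  have := is_deriveZ (- w) (is_derive_coflow_time q0); rewrite /GRing.scale /=.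
  rewrite (_ : (- w \*: coflow_time c) = (fun s => - coflow_time c s * w)) //.
  apply/funext => s; change (- w * coflow_time c s = - coflow_time c s * w).
  by ring.
have ed := @is_derive1_comp R (@expR R) (fun s => - coflow_time c s * w) t _ _
  (is_derive_expR (- coflow_time c t * w)) fd.
apply: is_derive_eq (is_deriveM sd ed) _; rewrite /GRing.scale /= /coflow_scale.
by field; rewrite gt_eqF.
Qed.

Lemma is_interval_coflow c : is_interval [set t | 0 < 1 - 2 * c * t].
Proof.
move=> x y /= x0 y0 z /andP[xz zy]; rewrite /=.
have [c0|c0] := leP 0 c.
  have : c * z <= c * y by rewrite ler_wpM2l.
  by lra.
have : c * z <= c * x by rewrite ler_wnM2l // ltW.
by lra.
Qed.

Lemma open_coflow c : open [set t | 0 < 1 - 2 * c * t].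
Proof.
apply: (open_comp (f := fun t : R => 1 - 2 * c * t) (D := [set x : R | 0 < x])).
  move=> t _; apply: differentiable_continuous; apply/derivable1_diffP.
  by have [] := is_derive_affine c t.
exact: open_gt.
Qed.

End CoflowTime.

(** * Existence: the explicit solution *)

Section Existence.
Context {R : realType} {g : vectType R}.
Variables (br : 'Hom(g, 'End(g))) (E U : 7.-tuple g) (d : 'I_7 -> R).
Variables (D X0 : 'End(g)) (c : R).
Hypotheses (EB : basis_of fullv E) (UB : basis_of fullv U).
Hypotheses (DU : forall i, D (tnth U i) = d i *: tnth U i).
Hypotheses (Dder : is_derivation br D) (X0E : X0 = c *: \1%VF + D).
Hypothesis dPhi : ext_d br (Phi_std E) =1 (fun=> 0).
Hypothesis lapE : forall v, coflow_rhs br E v = vartheta X0 (Phi_std E) v.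

(** [G] is [exp (m D)]. The bracket of eigenvectors for [d i] and [d j] lies in the eigenspace for
    [d i + d j], so its coordinate along [U k] vanishes unless [d k] is this sum, and the
    exponentials multiply. *)
Lemma diag_automorphism (m : R) (G : 'End(g)) :
  (forall i v, coord U i (G v) = expR (m * d i) * coord U i v) ->
  forall x y, G (br x y) = br (G x) (G y).
Proof.
move=> GU; have GUi i : G (tnth U i) = expR (m * d i) *: tnth U i.
  rewrite (basis_expand (G _) UB) (bigD1 i) //= GU coord_tnth // eqxx mulr1.
  by rewrite big1 ?addr0 // => j ji; rewrite GU coord_tnth // (negbTE ji) mulr0 scale0r.
have Gb i j : G (br (tnth U i) (tnth U j)) = br (G (tnth U i)) (G (tnth U j)).
  set z := br _ _.
  have Dz : D z = (d i + d j) *: z.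
    by rewrite /z Dder !DU !linearZ /= scale_lfunE scalerDl.
  have -> : br (G (tnth U i)) (G (tnth U j)) = expR (m * (d i + d j)) *: z.
    by rewrite !GUi !linearZ /= scale_lfunE scalerA -expRD -mulrDr addrC.
  rewrite (basis_expand (G z) UB) {2}(basis_expand z UB) scaler_sumr.
  apply: eq_bigr => k _; rewrite GU scalerA; congr (_ *: _).
  have : coord U k (D z) = d k * coord U k z.
    rewrite {1}(basis_expand z UB) !linear_sum (bigD1 k) //= big1 => [|l lk].
      by rewrite linearZ /= DU !linearZ /= coord_tnth // eqxx mulr1 addr0 mulrC.
    by rewrite linearZ /= DU !linearZ /= coord_tnth // eq_sym (negbTE lk) !mulr0.
  rewrite Dz linearZ /= => /eqP; rewrite -subr_eq0 -mulrBl mulf_eq0 => /orP[|/eqP->].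
    by rewrite subr_eq0 => /eqP ->.
  by rewrite !mulr0.
move=> x y; rewrite (basis_expand x UB) !linear_sum /= sum_lfunE linear_sum sum_lfunE.
apply: eq_bigr => i _; rewrite !linearZ /= !scale_lfunE linearZ /=; congr (_ *: _).
rewrite (basis_expand y UB) !linear_sum /=; apply: eq_bigr => j _.
by rewrite !linearZ /=; congr (_ *: _).
Qed.

Lemma coflow_existence (Phi0 : kform g 4) : Phi0 =1 Phi_std E ->
  is_coflow_solution br Phi0 [set t | 0 < 1 - 2 * c * t]
    (fun t v => coflow_scale c t * exp_act (coflow_time c t) D Phi0 v).
Proof.
move=> Phi0E'; have -> : Phi0 = Phi_std E by apply/funext.
pose C v (K : 4.-tuple 'I_7) :=
  (\prod_(a < 4) coord U (tnth K a) (tnth v a)) * Phi_std E (map_tuple (tnth U) K).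
have PhiE t v : coflow_scale c t * exp_act (coflow_time c t) D (Phi_std E) v =
    \sum_K C v K * (coflow_scale c t * expR (- coflow_time c t * weight d K)).
  rewrite (exp_act_eigen UB DU); last exact: Phi_std_mlin.
  by rewrite mulr_sumr; apply: eq_bigr => K _; rewrite mulrCA.
split.
- exact: open_coflow.
- exact: is_interval_coflow.
- by rewrite /= mulr0 subr0.
- move=> v; rewrite PhiE (mlin_coord _ UB (@Phi_std_mlin _ _ E)).
  apply: eq_bigr => K _; rewrite /coflow_scale /coflow_time mulr0 subr0 ln1 expr1n.
  by rewrite mulr0 if_same oppr0 mul0r expR0 !mulr1.
move=> t /= q0; set q : R := 1 - 2 * c * t in q0 *; set f := coflow_time c t.
(* A 4-form pulled back by [la^-1] is multiplied by [la^-4 = q^2], which has to be the scale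
   [c(t)]. *)
pose la : R := (Num.sqrt q)^-1.
have sq0 : 0 < Num.sqrt q by rewrite sqrtr_gt0.
have la0 : la != 0 by rewrite invr_eq0 gt_eqF.
have laq : la ^+ 2 * q = 1.
  by rewrite /la exprVn sqr_sqrtr ?ltW // mulVf // gt_eqF.
have [T TU] := coord_mxlin (fun i => la * expR (f * d i)) UB.
have [T' T'U] := coord_mxlin (fun i => la^-1 * expR (- f * d i)) UB.
have expK w : expR (f * w) * expR (- f * w) = 1.
  by rewrite -expRD mulNr subrr expR0.
clearbody la.
have laK (a b x : R) : a * b = 1 -> la^-1 * b * (la * a * x) = x.
  by move=> ab; rewrite -[RHS]mul1r -ab; field.
have laK' (a b x : R) : a * b = 1 -> la * a * (la^-1 * b * x) = x.
  by move=> ab; rewrite -[RHS]mul1r -ab; field.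
have TK : cancel T T'.
  move=> x; rewrite (basis_expand (T' _) UB) [RHS](basis_expand x UB).
  by apply: eq_bigr => i _; rewrite T'U TU laK.
have T'K : cancel T' T.
  move=> x; rewrite (basis_expand (T _) UB) [RHS](basis_expand x UB).
  by apply: eq_bigr => i _; rewrite TU T'U laK'.
have T'br x y : T' (br x y) = la *: br (T' x) (T' y).
  (* [T'] is [la^-1] times the automorphism [G]; the bracket being quadratic, one factor [la] is
     left over. *)
  have [G GU] := coord_mxlin (fun i => expR (- f * d i)) UB.
  have T'G v : T' v = la^-1 *: G v.
    rewrite (basis_expand (T' v) UB) (basis_expand (G v) UB) scaler_sumr.
    by apply: eq_bigr => i _; rewrite T'U GU scalerA mulrA.
  rewrite !T'G (diag_automorphism GU) !linearZ /= scale_lfunE !scalerA.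
  by congr (_ *: _); field.
pose TE := map_tuple T E.
have TEB : basis_of fullv TE := basis_map EB T'K.
have coordT' v (K : 4.-tuple 'I_7) :
    \prod_(a < 4) coord U (tnth K a) (tnth (map_tuple T' v) a) =
    q ^+ 2 * expR (- f * weight d K) * \prod_(a < 4) coord U (tnth K a) (tnth v a).
  under eq_bigr => a _ do rewrite tnth_map T'U.
  rewrite !big_split /= prodr_const card_ord; congr (_ * _ * _).
    have -> : q = la ^- 2 by apply: (mulfI (expf_neq0 2 la0)); rewrite laq mulfV // expf_neq0.
    by field.
  by rewrite /weight mulr_sumr expR_sum.
have PhiT v : coflow_scale c t * exp_act f D (Phi_std E) v = Phi_std TE v.
  rewrite PhiE (Phi_std_map EB T'K) (mlin_coord _ UB (@Phi_std_mlin _ _ E)).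
  by apply: eq_bigr => K _; rewrite coordT' /C /coflow_scale -/q; ring.
have PhiT' : (fun v => coflow_scale c t * exp_act f D (Phi_std E) v) =1
  (fun v => Phi_std E (map_tuple T' v)).
  by move=> v; rewrite PhiT (Phi_std_map EB T'K).
have dPhiT : ext_d br (fun v => coflow_scale c t * exp_act f D (Phi_std E) v) =1 (fun=> 0).
  move=> v; rewrite (@ext_d_ext _ _ _ 3 _ _ PhiT').
  by rewrite (ext_d_map (k := 3) v T'br (@Phi_std_mlin _ _ E)) dPhi mulr0.
exists (phi_std TE), TE; split; [exact: (conj TEB (fun=> erefl)) | | exact: dPhiT |].
- by move=> v; rewrite PhiT (hodge_phi_std TEB).
- move=> v; rewrite (laplacian4_Phi_std TEB PhiT dPhiT).
  rewrite (coflow_rhs_map EB TK T'K v T'br) lapE.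
  rewrite (mlin_coord _ UB (vartheta_mlin X0 (@Phi_std_mlin _ _ E))) mulr_sumr.
  rewrite (_ : (fun s => _) = (fun s => \sum_K C v K *
      (coflow_scale c s * expR (- coflow_time c s * weight d K)))); last first.
    by apply/funext => s; rewrite PhiE.
  apply: is_derive_sum_fin => K.
  have := is_deriveZ (C v K) (is_derive_coflow_mode (weight d K) q0).
  rewrite /GRing.scale /= => hK; apply: is_derive_eq hK _; rewrite coordT' -/q -/f.
  have X0U i : X0 (tnth U i) = (c + d i) *: tnth U i.
    by rewrite X0E add_lfunE scale_lfunE id_lfunE DU scalerDl.
  rewrite (vartheta_eigen X0U) ?/weight; last exact: Phi_std_mlin.
  (* Each of the four slots contributes one [c], whence [4c]; and [la^2 q^2 = q] is the factor in
     [is_derive_coflow_mode]. *)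
  rewrite big_split /= sumr_const card_ord -/(weight d K) /C.
  have -> : la ^+ 2 = q^-1 by rewrite -[RHS]mul1r -laq mulfK // gt_eqF.
  rewrite -mulr_natl.
  by field; rewrite gt_eqF.
Qed.

End Existence.

(** * The G2 cross product *)

Section CrossProductPolynomials.
Context {R : comNzRingType}.
Implicit Types (M : nat -> nat -> R) (x u v w : nat -> R).

(** An explicit expansion along the first column, which [ring] can normalize. *)
Definition det3 M : R :=
  M 0 0 * (M 1 1 * M 2 2 - M 1 2 * M 2 1) - M 1 0 * (M 0 1 * M 2 2 - M 0 2 * M 2 1)
  + M 2 0 * (M 0 1 * M 1 2 - M 0 2 * M 1 1).
Arguments det3 M%_function_scope.

Definition det4 M : R :=
  M 0 0 * det3 (fun i j => M (bump 0 i) j.+1)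
  - M 1 0 * det3 (fun i j => M (bump 1 i) j.+1)
  + M 2 0 * det3 (fun i j => M (bump 2 i) j.+1)
  - M 3 0 * det3 (fun i j => M (bump 3 i) j.+1).

Lemma det_mx3 M : \det (\matrix_(i < 3, j < 3) M i j) = det3 M.
Proof.
by rewrite (expand_det_col _ ord0) !big_ord_recl big_ord0 /cofactor !mxE
  !(expand_det_col _ ord0) !big_ord_recl !big_ord0 /cofactor !det_mx11 !mxE /=
  /bump /= /det3; ring.
Qed.

Lemma det_mx4 M : \det (\matrix_(i < 4, j < 4) M i j) = det4 M.
Proof.
have minor i : \det (row' i (col' ord0 (\matrix_(i < 4, j < 4) M i j))) =
    det3 (fun k j => M (bump i k) j.+1).
  by rewrite -det_mx3; congr (\det _); apply/matrixP => k j; rewrite !mxE.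
rewrite (expand_det_col _ ord0) !big_ord_recl big_ord0 /cofactor !minor !mxE /=.
by rewrite /det4; ring.
Qed.

Definition row3 u v w (j : nat) : nat -> R :=
  match j with 0 => u | 1 => v | _ => w end.

Definition row4 x u v w (j : nat) : nat -> R :=
  match j with 0 => x | 1 => u | 2 => v | _ => w end.

Definition phi_poly u v w : R :=
  let e i j k := det3 (fun a b => row3 u v w b (nth 0 [:: i; j; k] a)) in
  e 0 1 6 + e 2 3 6 + e 4 5 6 + e 0 2 4 - e 0 3 5 - e 1 2 5 - e 1 3 4.

Definition Phi_poly x u v w : R :=
  let e i j k l := det4 (fun a b => row4 x u v w b (nth 0 [:: i; j; k; l] a)) in
  e 0 1 2 3 + e 2 3 4 5 + e 0 1 4 5 - e 1 3 5 6 + e 0 2 5 6 + e 0 3 4 6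
  + e 1 2 4 6.

Definition dot7 u v : R :=
  u 0 * v 0 + u 1 * v 1 + u 2 * v 2 + u 3 * v 3 + u 4 * v 4 + u 5 * v 5 + u 6 * v 6.

Definition cross_poly x u (k : nat) : R := phi_poly x u (fun i => (i == k)%:R).

(** This is [cross x (cross x u) = <x, u> x - |x|^2 u], paired with [w]. For a unit vector [x] it
    makes the cross product a complex structure on the orthogonal complement of [x]. *)
Lemma phi_cross_poly x u w :
  phi_poly x (cross_poly x u) w = dot7 x u * dot7 x w - dot7 x x * dot7 u w.
Proof.
by rewrite /cross_poly /phi_poly /dot7 /det3 /= ; ring.
Qed.

(** For a unit [x] orthogonal to [u], [v], [w] only the last term survives: the contraction of [Phi]
    with [x], twisted by the complex structure, is minus the restriction of [phi]. *)
Lemma Phi_cross_poly x u v w :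
  Phi_poly x (cross_poly x u) v w =
  dot7 x u * phi_poly x v w + dot7 x v * phi_poly u x w + dot7 x w * phi_poly u v x
  - dot7 x x * phi_poly u v w.
Proof.
by rewrite /cross_poly /Phi_poly /phi_poly /dot7 /det4 /det3 /bump /=; ring.
Qed.

End CrossProductPolynomials.

Section CrossProduct.
Context {R : realType} {g : vectType R}.
Variable E : 7.-tuple g.
Hypothesis EB : basis_of fullv E.

Definition co (v : g) (n : nat) : R := coord E (inord n) v.

Lemma coform3_poly (u v w : g) I : coform E I [tuple u; v; w] =
  det3 (fun a b => row3 (co u) (co v) (co w) b (nth 0%N I a).-1).
Proof.
rewrite -det_mx3; congr (\det _); apply/matrixP => i j; rewrite !mxE.
by case: j => [[|[|[|//]]] p].
Qed.

Lemma coform4_poly (x u v w : g) I : coform E I [tuple x; u; v; w] =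
  det4 (fun a b => row4 (co x) (co u) (co v) (co w) b (nth 0%N I a).-1).
Proof.
rewrite -det_mx4; congr (\det _); apply/matrixP => i j; rewrite !mxE.
by case: j => [[|[|[|[|//]]]] p].
Qed.

Lemma phi_std_poly u v w : phi_std E [tuple u; v; w] = phi_poly (co u) (co v) (co w).
Proof. by rewrite /phi_std /= !coform3_poly. Qed.

Lemma Phi_std_poly x u v w :
  Phi_std E [tuple x; u; v; w] = Phi_poly (co x) (co u) (co v) (co w).
Proof. by rewrite /Phi_std /= !coform4_poly. Qed.

Lemma metric_poly u v : metric E u v = dot7 (co u) (co v).
Proof.
rewrite /metric !big_ord_recl big_ord0 addr0 /dot7 -!addrA.
by do ![congr (_ + _) | congr (_ * _) | congr coord]; apply: val_inj; rewrite /= inordK.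
Qed.

Lemma co_sum (c : nat -> R) n : (n < 7)%N ->
  co (\sum_(k < 7) c k *: tnth E k) n = c n.
Proof.
move=> n7; rewrite /co linear_sum (bigD1 (inord n)) //= linearZ /= coord_tnth //.
rewrite eqxx mulr1 inordK // big1 ?addr0 // => k kn.
by rewrite linearZ /= coord_tnth // eq_sym (negbTE kn) mulr0.
Qed.

Definition cross (x u : g) : g :=
  \sum_(k < 7) cross_poly (co x) (co u) k *: tnth E k.

Lemma metric_cross x u w : metric E (cross x u) w = phi_std E [tuple x; u; w].
Proof.
rewrite metric_poly phi_std_poly {1}/dot7 /cross !co_sum //.
by rewrite /cross_poly /phi_poly /det3 /=; ring.
Qed.

Lemma phi_cross x u w : phi_std E [tuple x; cross x u; w] =
  metric E x u * metric E x w - metric E x x * metric E u w.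
Proof.
rewrite phi_std_poly !metric_poly -phi_cross_poly.
by rewrite /phi_poly /det3 /= /cross !co_sum.
Qed.

Lemma Phi_cross x u v w : Phi_std E [tuple x; cross x u; v; w] =
  metric E x u * phi_std E [tuple x; v; w] + metric E x v * phi_std E [tuple u; x; w]
  + metric E x w * phi_std E [tuple u; v; x] - metric E x x * phi_std E [tuple u; v; w].
Proof.
rewrite Phi_std_poly !phi_std_poly !metric_poly -Phi_cross_poly.
by rewrite /Phi_poly /det4 /det3 /bump /= /cross !co_sum.
Qed.

End CrossProduct.

(** * Tables of the SU(3)-structure in an adapted frame *)

Section SU3Tables.

Definition omZ (K : seq nat) : int :=
  kdet [:: 0; 1]%N K + kdet [:: 2; 3]%N K + kdet [:: 4; 5]%N K.

Definition psZ (K : seq nat) : int :=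
  - kdet [:: 1; 3; 5]%N K + kdet [:: 0; 2; 5]%N K + kdet [:: 0; 3; 4]%N K
  + kdet [:: 1; 2; 4]%N K.

(** The coefficient of the [m]-th frame vector in [J] of the [i]-th one; with indices from 0, even
    vectors go to their successor and odd ones to minus their predecessor. *)
Definition JZ (m i : nat) : int :=
  if odd i then - (m.+1 == i)%:R else (m == i.+1)%:R.

Lemma phiZ_omZ : all (fun i => all (fun j =>
  phiZ [:: i; j; 6]%N == omZ [:: i; j]) (iota 0 6)) (iota 0 6).
Proof. by vm_compute. Qed.

Lemma JZ_omZ : all (fun i => all (fun j =>
  foldr (fun m acc => JZ m i * omZ [:: m; j] + acc) 0 (iota 0 6) == - (i == j)%:R)
  (iota 0 6)) (iota 0 6).
Proof. by vm_compute. Qed.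

Lemma JZ_psZ : all (fun i => all (fun j => all (fun k =>
  foldr (fun m acc => JZ m i * psZ [:: m; j; k] + acc) 0 (iota 0 6) ==
  phiZ [:: i; j; k]) (iota 0 6)) (iota 0 6)) (iota 0 6).
Proof. by vm_compute. Qed.

End SU3Tables.

Ltac table_values :=
  repeat match goal with
  | |- context [psZ ?l] => let v := eval vm_compute in (psZ l) in change (psZ l) with v
  | |- context [omZ ?l] => let v := eval vm_compute in (omZ l) in change (omZ l) with v
  end.

(** * The metric of a frame *)

Section Metric.
Context {R : realType} {g : vectType R}.
Variable E : 7.-tuple g.

Lemma metricC u v : metric E u v = metric E v u.
Proof. by apply: eq_bigr => i _; rewrite mulrC. Qed.

Lemma metric_linearl c x y v : metric E (c *: x + y) v = c * metric E x v + metric E y v.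
Proof.
rewrite /metric mulr_sumr -big_split; apply: eq_bigr => i _ /=.
by rewrite linearP /= mulrDl mulrA.
Qed.

Lemma metric0l v : metric E 0 v = 0.
Proof. by apply: big1 => i _; rewrite linear0 mul0r. Qed.

Lemma metric_suml n (c : 'I_n -> R) (e : 'I_n -> g) v :
  metric E (\sum_i c i *: e i) v = \sum_i c i * metric E (e i) v.
Proof.
elim/big_rec2: _ => [|i y1 y2 _ <-]; first exact: metric0l.
by rewrite metric_linearl.
Qed.

Lemma metric_tnth i v : basis_of fullv E -> metric E (tnth E i) v = coord E i v.
Proof.
move=> EB; rewrite /metric (bigD1 i) //= coord_tnth // eqxx mul1r big1 ?addr0 // => j ji.
by rewrite coord_tnth // (negbTE ji) mul0r.
Qed.

End Metric.

(** * The adapted frame with [e7] is an oriented orthonormal G2-frame *)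

Section AdaptedFrame.
Context {R : realType} {g : vectType R}.
Variables (E : 7.-tuple g) (h : {vspace g}) (e7 : g) (f : 6.-tuple g).
Hypotheses (EB : basis_of fullv E) (fB : basis_of h f).
Hypotheses (e7u : metric E e7 e7 = 1) (e7h : forall v, v \in h -> metric E e7 v = 0).

Definition full_frame : 7.-tuple g := [tuple of rcons f e7].
Let B := full_frame.

Lemma full_frame_last : tnth B ord_max = e7.
Proof. by rewrite (tnth_nth 0) /= nth_rcons size_tuple ltnn eqxx. Qed.

Lemma full_frame_nth (i : 'I_7) : (i < 6)%N -> tnth B i = f`_i.
Proof. by move=> i6; rewrite (tnth_nth 0) /= nth_rcons size_tuple i6. Qed.

Lemma frame_mem i : (i < 6)%N -> f`_i \in h.
Proof. by move=> i6; rewrite (basis_mem fB) // mem_nth // size_tuple. Qed.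

Lemma full_frame_basis : basis_of fullv B.
Proof.
rewrite basisEfree; apply/and3P; split.
- rewrite (perm_free (Y := e7 :: f)) ?perm_rcons // free_cons (basis_free fB) andbT.
  rewrite (span_basis fB); apply/negP => /e7h /eqP.
  by rewrite e7u oner_eq0.
- exact: subvf.
- by rewrite size_tuple -(size_basis EB).
Qed.

Lemma coord_full_frame (i : 'I_6) v : v \in h ->
  coord B (widen_ord (leqnSn 6) i) v = coord f i v.
Proof.
move=> vh; rewrite {1}(coord_basis fB vh) linear_sum (bigD1 i) //=.
have fE (j : 'I_6) : f`_j = tnth B (widen_ord (leqnSn 6) j) by rewrite full_frame_nth //=.
rewrite linearZ /= fE coord_tnth ?full_frame_basis // eqxx mulr1 big1 ?addr0 // => j ji.
rewrite linearZ /= fE coord_tnth ?full_frame_basis //.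
by rewrite -val_eqE /= eq_sym val_eqE (negbTE ji) mulr0.
Qed.

Lemma coord_full_frame_last v : coord B ord_max v = metric E e7 v.
Proof.
rewrite [in RHS](basis_expand v full_frame_basis) metricC metric_suml.
rewrite (bigD1 ord_max) //= full_frame_last e7u mulr1 big1 ?addr0 // => j jm.
have j6 : (j < 6)%N by rewrite ltn_neqAle -ltnS ltn_ord andbT.
by rewrite full_frame_nth // metricC e7h ?frame_mem // mulr0.
Qed.

Lemma memh v : (v \in h) = (metric E e7 v == 0).
Proof.
apply/idP/eqP => [/e7h //|v0]; rewrite (basis_expand v full_frame_basis).
apply: memv_suml => j _; have [j6|j6] := ltnP j 6.
  by apply: memvZ; rewrite full_frame_nth ?frame_mem.
have -> : j = ord_max by apply/val_inj/eqP; rewrite eqn_leq j6 -ltnS ltn_ord.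
by rewrite coord_full_frame_last v0 scale0r mem0v.
Qed.

Let phi := phi_std E.
Let Phi := Phi_std E.

Hypothesis om : forall i j, (i < 6)%N -> (j < 6)%N ->
  phi [tuple e7; f`_i; f`_j] = (omZ [:: i; j])%:~R.
Hypothesis ps : forall i j k, (i < 6)%N -> (j < 6)%N -> (k < 6)%N ->
  Phi [tuple e7; f`_i; f`_j; f`_k] = - (psZ [:: i; j; k])%:~R.

Let phi_lin : mlin phi := @phi_std_mlin _ _ E.
Let Phi_lin : mlin Phi := @Phi_std_mlin _ _ E.
Let J := cross E e7.
Let tt (m i : nat) : R := coord f (inord m) (J f`_i).

Lemma cross_mem u : J u \in h.
Proof.
rewrite memh metricC (metric_cross EB).
have [_ z02 _ _ _] := alternating3_slots phi_lin (@phi_std_alternating _ _ E).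
by rewrite -/phi z02.
Qed.

Lemma cross_frame i : J f`_i = \sum_(m < 6) tt m i *: f`_m.
Proof.
rewrite [LHS](coord_basis fB (cross_mem _)); apply: eq_bigr => m _.
by rewrite /tt inord_val.
Qed.

Lemma sum6 (V : nmodType) (F : nat -> V) :
  \sum_(m < 6) F m = F 0 + F 1 + F 2 + F 3 + F 4 + F 5.
Proof. by rewrite !big_ord_recl big_ord0 addr0 /= !addrA. Qed.

(** [Phi_cross] at the unit vector [e7] gives [psi (J u, v, w) = phi (u, v, w)] on the ideal; its
    minus sign cancels the one in the definition of [psi]. *)
Lemma psi_cross i j k : (i < 6)%N -> (j < 6)%N -> (k < 6)%N ->
  \sum_(m < 6) tt m i * (psZ [:: val m; j; k])%:~R = phi [tuple f`_i; f`_j; f`_k].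
Proof.
move=> i6 j6 k6; have hz m : (m < 6)%N -> metric E e7 f`_m = 0.
  by move=> m6; rewrite e7h // frame_mem.
have := Phi_cross EB e7 f`_i f`_j f`_k.
rewrite !hz // !mul0r !add0r e7u mul1r -/J -/phi -/Phi.
move=> /(congr1 -%R); rewrite opprK => <-; rewrite cross_frame.
have slot z : [tuple e7; z; f`_j; f`_k] = upd [tuple e7; 0; f`_j; f`_k] (@Ordinal 4 1 isT) z.
  by apply: eq_from_tnth => -[[|[|[|[|//]]]] p]; rewrite tnth_upd.
rewrite slot mlin_suml // -sumrN; apply: eq_bigr => m _.
by rewrite mlinZ // -slot ps // mulrN opprK.
Qed.

(** The metric on the ideal is thereby recovered from [omega] as soon as [J] is known. *)
Lemma omega_cross i j : (i < 6)%N -> (j < 6)%N ->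
  \sum_(m < 6) tt m i * (omZ [:: val m; j])%:~R = - metric E f`_i f`_j.
Proof.
move=> i6 j6; have hz m : (m < 6)%N -> metric E e7 f`_m = 0.
  by move=> m6; rewrite e7h // frame_mem.
have := phi_cross EB e7 f`_i f`_j.
rewrite !hz // mul0r sub0r e7u mul1r -/J -/phi => <-; rewrite cross_frame.
have slot z : [tuple e7; z; f`_j] = upd [tuple e7; 0; f`_j] (@Ordinal 3 1 isT) z.
  by apply: eq_from_tnth => -[[|[|[|//]]] p]; rewrite tnth_upd.
rewrite slot mlin_suml //; apply: eq_bigr => m _.
by rewrite mlinZ // -slot om.
Qed.

Lemma metric_cross_frame i j : (i < 6)%N -> (j < 6)%N ->
  \sum_(m < 6) tt m i * metric E f`_m f`_j = (omZ [:: i; j])%:~R.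
Proof.
by move=> i6 j6; rewrite -om // /phi -metric_cross // -/J cross_frame metric_suml.
Qed.

Ltac table_eq := table_values;
  rewrite ?[(Posz 0)%:~R]mulr0z ?[(Posz 1)%:~R]mulr1z ?[(Negz 0)%:~R]mulrN1z;
  rewrite ?mulr0 ?mulr1 ?mulrN1 ?addr0 ?add0r.

Ltac tab := cbv beta zeta; table_eq.

Ltac tab_eq := rewrite ?opprK => /eqP;
  rewrite ?eqr_opp ?eqr_oppLR ?opprK => /eqP ->; rewrite ?opprK.

(* [psi_cross] says that [psi (J u, v, w)] is alternating: these linear
   equations force [J] to be [al + be J0], where [J0] is the complex structure
   of the frame; then [J ^ 2 = - 1] and positivity give [al = 0], [be = 1]. *)
Lemma cross_frame_JZ m i : (m < 6)%N -> (i < 6)%N -> tt m i = (JZ m i)%:~R.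
Proof.
have [z01 _ _ s01 _] := alternating3_slots phi_lin (@phi_std_alternating _ _ E).
(* Equal arguments in [phi]: as two indices of [psi] determine the third, each instance isolates a
   single entry of [J]. *)
have z i0 k0 : (i0 < 6)%N -> (k0 < 6)%N ->
    let F m0 := tt m0 i0 * (psZ [:: m0; i0; k0])%:~R in
    F 0 + F 1 + F 2 + F 3 + F 4 + F 5 = 0.
  move=> i06 k06 /=; rewrite -(sum6 (fun m0 => tt m0 i0 * (psZ [:: m0; i0; k0])%:~R)).
  by rewrite psi_cross // z01.
(* Skew-symmetry of [phi] in two different arguments compares the entries of [J] on different
   planes. *)
have r i0 j0 k0 : (i0 < 6)%N -> (j0 < 6)%N -> (k0 < 6)%N ->
    let F m0 := tt m0 i0 * (psZ [:: m0; j0; k0])%:~R in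
    let G m0 := tt m0 j0 * (psZ [:: m0; i0; k0])%:~R in
    F 0 + F 1 + F 2 + F 3 + F 4 + F 5 = - (G 0 + G 1 + G 2 + G 3 + G 4 + G 5).
  move=> i06 j06 k06 /=.
  rewrite -(sum6 (fun m0 => tt m0 i0 * (psZ [:: m0; j0; k0])%:~R)).
  rewrite -(sum6 (fun m0 => tt m0 j0 * (psZ [:: m0; i0; k0])%:~R)).
  by rewrite !psi_cross // s01.
have z50 : tt 5 0 = 0 by have := z 0 2 isT isT; tab; move/eqP; rewrite ?oppr_eq0 => /eqP.
have z20 : tt 2 0 = 0 by have := z 0 5 isT isT; tab; move/eqP; rewrite ?oppr_eq0 => /eqP.
have z40 : tt 4 0 = 0 by have := z 0 3 isT isT; tab; move/eqP; rewrite ?oppr_eq0 => /eqP.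
have z30 : tt 3 0 = 0 by have := z 0 4 isT isT; tab; move/eqP; rewrite ?oppr_eq0 => /eqP.
have z51 : tt 5 1 = 0 by have := z 1 3 isT isT; tab; move/eqP; rewrite ?oppr_eq0 => /eqP.
have z31 : tt 3 1 = 0 by have := z 1 5 isT isT; tab; move/eqP; rewrite ?oppr_eq0 => /eqP.
have z41 : tt 4 1 = 0 by have := z 1 2 isT isT; tab; move/eqP; rewrite ?oppr_eq0 => /eqP.
have z21 : tt 2 1 = 0 by have := z 1 4 isT isT; tab; move/eqP; rewrite ?oppr_eq0 => /eqP.
have z52 : tt 5 2 = 0 by have := z 2 0 isT isT; tab; move/eqP; rewrite ?oppr_eq0 => /eqP.
have z02 : tt 0 2 = 0 by have := z 2 5 isT isT; tab; move/eqP; rewrite ?oppr_eq0 => /eqP.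
have z42 : tt 4 2 = 0 by have := z 2 1 isT isT; tab; move/eqP; rewrite ?oppr_eq0 => /eqP.
have z12 : tt 1 2 = 0 by have := z 2 4 isT isT; tab; move/eqP; rewrite ?oppr_eq0 => /eqP.
have z53 : tt 5 3 = 0 by have := z 3 1 isT isT; tab; move/eqP; rewrite ?oppr_eq0 => /eqP.
have z13 : tt 1 3 = 0 by have := z 3 5 isT isT; tab; move/eqP; rewrite ?oppr_eq0 => /eqP.
have z43 : tt 4 3 = 0 by have := z 3 0 isT isT; tab; move/eqP; rewrite ?oppr_eq0 => /eqP.
have z03 : tt 0 3 = 0 by have := z 3 4 isT isT; tab; move/eqP; rewrite ?oppr_eq0 => /eqP.
have z34 : tt 3 4 = 0 by have := z 4 0 isT isT; tab; move/eqP; rewrite ?oppr_eq0 => /eqP.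
have z04 : tt 0 4 = 0 by have := z 4 3 isT isT; tab; move/eqP; rewrite ?oppr_eq0 => /eqP.
have z24 : tt 2 4 = 0 by have := z 4 1 isT isT; tab; move/eqP; rewrite ?oppr_eq0 => /eqP.
have z14 : tt 1 4 = 0 by have := z 4 2 isT isT; tab; move/eqP; rewrite ?oppr_eq0 => /eqP.
have z35 : tt 3 5 = 0 by have := z 5 1 isT isT; tab; move/eqP; rewrite ?oppr_eq0 => /eqP.
have z15 : tt 1 5 = 0 by have := z 5 3 isT isT; tab; move/eqP; rewrite ?oppr_eq0 => /eqP.
have z25 : tt 2 5 = 0 by have := z 5 0 isT isT; tab; move/eqP; rewrite ?oppr_eq0 => /eqP.
have z05 : tt 0 5 = 0 by have := z 5 2 isT isT; tab; move/eqP; rewrite ?oppr_eq0 => /eqP.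
have t22 : tt 2 2 = tt 0 0 by have := r 0 2 5 isT isT isT; tab; tab_eq.
have t33 : tt 3 3 = tt 0 0 by have := r 0 3 4 isT isT isT; tab; tab_eq.
have t44 : tt 4 4 = tt 0 0 by have := r 0 4 3 isT isT isT; tab; tab_eq.
have t55 : tt 5 5 = tt 0 0 by have := r 0 5 2 isT isT isT; tab; tab_eq.
have t11 : tt 1 1 = tt 0 0 by have := r 1 2 4 isT isT isT; tab; tab_eq.
have t32 : tt 3 2 = tt 1 0 by have := r 0 2 4 isT isT isT; tab; tab_eq.
have t01 : tt 0 1 = - tt 1 0 by have := r 1 2 5 isT isT isT; tab; lra.
have t54 : tt 5 4 = tt 1 0 by have := r 0 4 2 isT isT isT; tab; tab_eq.
have t23 : tt 2 3 = - tt 1 0 by have := r 1 3 4 isT isT isT; tab; lra.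
have t45 : tt 4 5 = - tt 1 0 by have := r 1 5 2 isT isT isT; tab; lra.
have om_tt i0 j0 : (i0 < 6)%N -> (j0 < 6)%N ->
    let F m0 := tt m0 i0 * (omZ [:: m0; j0])%:~R in
    F 0 + F 1 + F 2 + F 3 + F 4 + F 5 = - metric E f`_i0 f`_j0.
  move=> i06 j06 /=; rewrite -(sum6 (fun m0 => tt m0 i0 * (omZ [:: m0; j0])%:~R)).
  exact: omega_cross.
have met_tt i0 j0 : (i0 < 6)%N -> (j0 < 6)%N ->
    let F m0 := tt m0 i0 * metric E f`_m0 f`_j0 in
    F 0 + F 1 + F 2 + F 3 + F 4 + F 5 = (omZ [:: i0; j0])%:~R.
  move=> i06 j06 /=; rewrite -(sum6 (fun m0 => tt m0 i0 * metric E f`_m0 f`_j0)).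
  exact: metric_cross_frame.
have g00 : metric E f`_0 f`_0 = tt 1 0 by have := om_tt 0 0 isT isT; tab; lra.
have g01 : metric E f`_0 f`_1 = - tt 0 0 by have := om_tt 0 1 isT isT; tab; lra.
have g11 : metric E f`_1 f`_1 = tt 1 0 by have := om_tt 1 1 isT isT; tab; lra.
(* The relation [g (J u, v) = omega (u, v)] on the first plane, taken in both orders, gives two
   equations for the squares of the two unknowns. *)
have e1 : tt 0 0 ^+ 2 = tt 1 0 ^+ 2 - 1.
  by have := met_tt 0 1 isT isT; tab; rewrite z20 z30 z40 z50 g01 g11; lra.
have e2 : tt 1 0 ^+ 2 + tt 0 0 ^+ 2 = 1.
  by have := met_tt 1 0 isT isT; tab;
    rewrite z21 z31 z41 z51 t01 t11 [metric E f`_1 _]metricC g01 g00; lra.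
have t00 : tt 0 0 = 0 by apply/eqP; rewrite -sqrf_eq0; apply/eqP; lra.
have t10 : tt 1 0 = 1.
  have : tt 1 0 ^+ 2 == 1 by apply/eqP; lra.
  rewrite sqrf_eq1 => /orP[/eqP //|/eqP t10].
  have := g00; rewrite t10 => m1.
  have : 0 <= metric E f`_0 f`_0 by apply: sumr_ge0 => a _; rewrite -expr2 sqr_ge0.
  by rewrite m1; lra.
move: m i => [|[|[|[|[|[|//]]]]]] [|[|[|[|[|[|//]]]]]] _ _;
  rewrite /JZ /= ?(z20, z30, z40, z50, z21, z31, z41, z51, z02, z12, z42, z52,
    z03, z13, z43, z53, z04, z14, z24, z34, z05, z15, z25, z35) ?(t22, t33, t44, t55,
    t11, t32, t01, t54, t23, t45) ?t00 ?t10 ?oppr0 ?rmorph0 ?rmorph1 ?rmorphN1 //.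
Qed.

Lemma adapted_metric i j : (i < 6)%N -> (j < 6)%N ->
  metric E f`_i f`_j = (i == j)%:R.
Proof.
move=> i6 j6; rewrite -[LHS]opprK -omega_cross //.
have /allP/(_ i) := JZ_omZ; rewrite mem_iota i6 => /(_ isT)/allP/(_ j).
rewrite mem_iota j6 => /(_ isT); rewrite (foldr_sum 6 (fun m => JZ m i * omZ [:: m; j])).
move=> /eqP/(congr1 (fun x : int => x%:~R : R)); rewrite rmorphN rmorph_nat rmorph_sum /=.
move=> /(congr1 -%R); rewrite opprK => <-; congr (- _); apply: eq_bigr => m _.
by rewrite rmorphM cross_frame_JZ.
Qed.

Lemma adapted_phi i j k : (i < 6)%N -> (j < 6)%N -> (k < 6)%N ->
  phi [tuple f`_i; f`_j; f`_k] = (phiZ [:: i; j; k])%:~R.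
Proof.
move=> i6 j6 k6; rewrite -psi_cross //.
have /allP/(_ i) := JZ_psZ; rewrite mem_iota i6 => /(_ isT)/allP/(_ j).
rewrite mem_iota j6 => /(_ isT)/allP/(_ k); rewrite mem_iota k6 => /(_ isT).
rewrite (foldr_sum 6 (fun m => JZ m i * psZ [:: m; j; k])) => /eqP <-.
by rewrite rmorph_sum; apply: eq_bigr => m _; rewrite rmorphM cross_frame_JZ.
Qed.

Lemma adapted_phi_std : phi =1 phi_std B.
Proof.
apply: (alternating_ext full_frame_basis) => //.
- exact: phi_std_mlin.
- exact: phi_std_alternating.
- exact: phi_std_alternating.
case/tupleP => i /= K; case/tupleP: K => j K; case/tupleP: K => k K.
rewrite [K]tuple0 /= andbT => /andP[ij jk].
rewrite phi_std_basis ?full_frame_basis //=.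
have [k7 j7] := (ltn_ord k, ltn_ord j); have j6 : (j < 6)%N by apply: leq_trans jk _.
have i6 : (i < 6)%N := ltn_trans ij j6.
have -> : map_tuple (tnth B) [tuple of i :: [tuple of j :: [tuple of k :: [tuple]]]] =
    [tuple f`_i; f`_j; tnth B k] :> 3.-tuple g.
  by apply: val_inj; rewrite /= (full_frame_nth i6) (full_frame_nth j6).
have [k6|k6] := ltnP k 6; first by rewrite full_frame_nth // adapted_phi.
have kE : k = ord_max by apply/val_inj/eqP; rewrite eqn_leq k6 -ltnS ltn_ord.
have [_ _ _ s01 s12] := alternating3_slots phi_lin (@phi_std_alternating _ _ E).
rewrite kE full_frame_last s12 s01 opprK om //.
have /allP/(_ i) := phiZ_omZ; rewrite mem_iota i6 => /(_ isT)/allP/(_ j).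
by rewrite mem_iota j6 => /(_ isT)/eqP <-.
Qed.

Lemma adapted_orthonormal a b : metric E (tnth B a) (tnth B b) = (a == b)%:R.
Proof.
have last (i : 'I_7) : (6 <= i)%N -> i = ord_max.
  by move=> i6; apply/val_inj/eqP; rewrite eqn_leq i6 -ltnS ltn_ord.
have [a6|/last ->] := ltnP a 6; have [b6|/last ->] := ltnP b 6.
- by rewrite !full_frame_nth // adapted_metric // -val_eqE.
- rewrite full_frame_nth // full_frame_last metricC e7h ?frame_mem //.
  by rewrite -val_eqE /= ltn_eqF.
- rewrite full_frame_last full_frame_nth // e7h ?frame_mem //.
  by rewrite -val_eqE /= gtn_eqF.
- by rewrite full_frame_last e7u eqxx.
Qed.

Lemma adapted_gram a b : gram E B a b = (a == b)%:R.
Proof.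
have NN : (frame_mx E B)^T *m frame_mx E B = 1%:M.
  apply/matrixP => c d; rewrite !mxE -adapted_orthonormal.
  by apply: eq_bigr => i _; rewrite !mxE.
have := congr1 (fun M : 'M[R]_7 => M a b) (mulmx1C NN); rewrite !mxE => <-.
by apply: eq_bigr => c _; rewrite !mxE.
Qed.

(** The frames [E] and [B] induce the same metric and the same 3-form, so the two 4-forms agree up
    to the determinant of the change of frame. One component containing [e7], known from [psi],
    shows that this determinant is 1. *)
Lemma adapted_Phi_std : Phi =1 Phi_std B.
Proof.
have BB := full_frame_basis.
have hodgeB v : Phi_std B v = (\det (frame_mx E B))^-1 * Phi v.
  rewrite -(hodge_phi_std BB) /Phi -(hodge_phi_std EB).
  rewrite -(hodge_ext B adapted_phi_std).
  rewrite (hodge_frame_gram EB BB) //; congr (_ * (_ * _)).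
  apply: eq_bigr => I _; congr (_ * _).
  rewrite -(mlin_expand (fun a => gram E B (tnth I a)) (tnth E) phi_lin); congr phi.
  apply: eq_from_tnth => a; rewrite tnth_mktuple tnth_map (bigD1 (tnth I a)) //=.
  rewrite adapted_gram eqxx scale1r big1 ?addr0 // => b ba.
  by rewrite adapted_gram eq_sym (negbTE ba) scale0r.
pose o i (i7 : (i < 7)%N) := Ordinal i7.
pose K : 4.-tuple 'I_7 := [tuple ord_max; o 1 isT; o 3 isT; o 5 isT].
have vE : map_tuple (tnth B) K = [tuple e7; f`_1; f`_3; f`_5] :> 4.-tuple g.
  by apply: val_inj; rewrite /= full_frame_last !full_frame_nth.
have := hodgeB (map_tuple (tnth B) K); rewrite Phi_std_basis // vE ps //=.
have -> : PhiZ [:: 6; 1; 3; 5]%N = 1 by vm_compute.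
have -> : psZ [:: 1; 3; 5]%N = -1 by vm_compute.
rewrite rmorph1 rmorphN1 opprK mulr1 => d1 v.
by rewrite hodgeB -d1 mul1r.
Qed.

End AdaptedFrame.

(** * The Hodge star as a single complementary term *)

Section HodgeComplement.
Context {R : realType} {g : vectType R}.
Variable B : 7.-tuple g.

Lemma sum_perm_tuple (V : nmodType) k (I0 : k.-tuple 'I_7) (F : k.-tuple 'I_7 -> V) :
  uniq I0 ->
  \sum_(I : k.-tuple 'I_7 | perm_eq I I0) F I =
  \sum_(s : 'S_k) F [tuple tnth I0 (s a) | a < k].
Proof.
move=> uI0; pose tau (s : 'S_k) := [tuple tnth I0 (s a) | a < k].
have inj : {in predT &, injective tau}.
  move=> s s' _ _ ss'; apply/permP => a.
  have := congr1 (fun t => tnth t a) ss'; rewrite !tnth_mktuple.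
  by move/tuple_uniqP: uI0; apply.
rewrite (eq_bigl (fun I => I \in tau @: predT)) => [|I]; last first.
  apply/tuple_permP/imsetP => [[s sI]|[s _ ->]]; last by exists s.
  by exists s => //; apply: val_inj.
by rewrite big_imset.
Qed.

Lemma uniq_size7 (s : seq 'I_7) : uniq s -> size s = 7 -> forall x, x \in s.
Proof.
move=> us ss x; have /subset_cardP : #|s| = #|'I_7| by rewrite (card_uniqP us) ss card_ord.
by move=> /(_ (introT fintype.subsetP (fun _ _ => isT))) ->.
Qed.

(** Only rearrangements of the complementary indices contribute. They are [k!] equal terms, as the
    sign of the permutation occurs both in [al] and in [vol], and they cancel the factorial. *)
Lemma hodge_complement k (al : kform g k) (I0 : k.-tuple 'I_7)
    (J : (7 - k).-tuple 'I_7) : (k <= 7)%N -> mlin al -> is_alternating al ->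
  uniq (I0 ++ J) ->
  hodge B al (map_tuple (tnth B) J) =
  al (map_tuple (tnth B) I0) * vol B (map (tnth B) (I0 ++ J)).
Proof.
move=> k7 al_lin al_alt uIJ.
have size_IJ (I : k.-tuple 'I_7) : size (I ++ J) = 7.
  by rewrite size_cat !size_tuple subnKC.
rewrite /hodge (bigID (fun I : k.-tuple 'I_7 => perm_eq I I0)) /=.
rewrite [X in _ + X]big1 ?addr0 => [|I nIJ]; last first.
  have /(uniqPn ord0)[p [q [pq q7 IJpq]]] : ~~ uniq (I ++ J).
    apply: contra nIJ => uIJ'; rewrite -(perm_cat2r J); apply: uniq_perm => // x.
    by rewrite !uniq_size7.
  rewrite size_IJ in q7; rewrite -map_cat (@vol_eq0 _ _ B _ p q) ?mulr0 ?ltn_eqF //.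
    exact: ltn_trans q7.
  by rewrite !(nth_map ord0) ?size_IJ ?IJpq // (ltn_trans pq).
have uI0 : uniq I0 by move: uIJ; rewrite cat_uniq => /and3P[].
rewrite sum_perm_tuple //; set F := al _ * _.
rewrite (eq_bigr (fun=> F)) => [|s _].
  rewrite sumr_const card_Sn -(mulr_natl F) mulKf //.
have tE : map_tuple (tnth B) [tuple tnth I0 (s a) | a < k] =
    [tuple tnth (map_tuple (tnth B) I0) (s a) | a < k].
  by apply: eq_from_tnth => a; rewrite !(tnth_mktuple, tnth_map).
have vlin : mlin (fun u : k.-tuple g => vol B (u ++ map (tnth B) J)).
  exact: vol_catl_mlin.
have valt : is_alternating (fun u : k.-tuple g => vol B (u ++ map (tnth B) J)).
  move=> u p q pq upq; have [pk qk] := (ltn_ord p, ltn_ord q).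
  apply: (@vol_eq0 _ _ B _ p q) => //; try exact: leq_trans k7.
  by rewrite !nth_cat !size_tuple pk qk -!tnth_nth.
have volE : vol B (map (tnth B) [tuple tnth I0 (s a) | a < k] ++ map (tnth B) J) =
    (-1) ^+ s * vol B (map (tnth B) I0 ++ map (tnth B) J).
  have := alternating_perm (map_tuple (tnth B) I0) s vlin valt.
  by rewrite -tE.
have alE : al (map_tuple (tnth B) [tuple tnth I0 (s a) | a < k]) =
    (-1) ^+ s * al (map_tuple (tnth B) I0) by rewrite tE alternating_perm.
rewrite volE alE mulrACA -signr_addb addbb mul1r.
by rewrite /F map_cat.
Qed.

End HodgeComplement.

(** * Formal computation of components with symbolic matrix entries *)

Section FormalForms.

(* A formal component of a form is a list of pairs (coefficient, monomial),
   where the monomial [:: (m1, j1); ..] stands for [am m1 j1 * ..], the [am m j]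
   being the entries of the matrix of [ad e7]. *)
Definition fpoly : Type := seq (int * seq (nat * nat)).

Definition prune (l : fpoly) : fpoly := [seq t <- l | t.1 != 0].

(** Index 6 stands for [e7]: the bracket with it on the left reads column [y] of the matrix, on the
    right minus column [x]. In the last case the pair is a dummy under a zero coefficient. *)
Definition bracket_coef (x y m : nat) : int * (nat * nat) :=
  if x == 6 then (1, (m, y)) else if y == 6 then (-1, (m, x)) else (0, (0, 0)%N).

(** The six terms of [ext_d3E]: sign, positions bracketed, positions left. *)
Definition ext_d_slots : seq (int * (nat * nat) * (nat * nat)) :=
  [:: ((-1)%R, (0, 1), (2, 3)); (1%R, (0, 2), (1, 3)); ((-1)%R, (0, 3), (1, 2));
      ((-1)%R, (1, 2), (0, 3)); (1%R, (1, 3), (0, 2)); ((-1)%R, (2, 3), (0, 1))]%N.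

Definition ext_dL (al : seq nat -> fpoly) (K : seq nat) : fpoly :=
  prune (flatten [seq flatten [seq
    (let c := bracket_coef (nth 0%N K p.1.2.1) (nth 0%N K p.1.2.2) m in
     if c.1 == 0 then [::] else
     [seq (p.1.1 * c.1 * t.1, c.2 :: t.2)
       | t <- al [:: m; nth 0%N K p.2.1; nth 0%N K p.2.2]])
    | m <- iota 0 7] | p <- ext_d_slots]).

Definition hodgeL (al : seq nat -> fpoly) (J : seq nat) : fpoly :=
  if uniq J then
    let I := [seq i <- iota 0 7 | i \notin J] in
    let e := kdet (iota 0 7) (I ++ J) in [seq (e * t.1, t.2) | t <- al I]
  else [::].

Definition phiL (K : seq nat) : fpoly := prune [:: (phiZ K, [::])].

(** The innermost star is already carried out: the computation starts at [phi], the star of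
    [Phi]. *)
Definition coflowL (K : seq nat) : fpoly :=
  [seq (- t.1, t.2) | t <- ext_dL (hodgeL (ext_dL phiL)) K].

Definition varthetaL (K : seq nat) : fpoly :=
  prune (flatten [seq [seq (- PhiZ (set_nth 0%N K a m), [:: (m, nth 0%N K a)])
    | m <- iota 0 7] | a <- iota 0 4]).

End FormalForms.

Section FormalEvaluation.
Context {R : realType} {g : vectType R}.
Variables (br : 'Hom(g, 'End(g))) (B : 7.-tuple g).
Hypotheses (BB : basis_of fullv B) (brxx : forall x, br x x = 0).
Implicit Types (am : nat -> nat -> R).

Definition fval am (l : fpoly) : R :=
  \sum_(t <- l) t.1%:~R * \prod_(p <- t.2) am p.1 p.2.

Lemma fval_prune am l : fval am (prune l) = fval am l.
Proof.
rewrite /fval big_filter big_mkcond /=; apply: eq_bigr => t _.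
by case: eqP => //= ->; rewrite mul0r.
Qed.

Lemma fval_flatten am (ll : seq fpoly) : fval am (flatten ll) = \sum_(l <- ll) fval am l.
Proof. by rewrite /fval big_flatten. Qed.

Lemma fval_scale am (e : int) l :
  fval am [seq (e * t.1, t.2) | t <- l] = e%:~R * fval am l.
Proof.
rewrite /fval big_map mulr_sumr; apply: eq_bigr => t _ /=.
by rewrite intrM mulrA.
Qed.

Definition has_components am {k : nat} (al : kform g k) (alL : seq nat -> fpoly) : Prop :=
  forall K : k.-tuple 'I_7, al (map_tuple (tnth B) K) = fval am (alL (map val K)).

Lemma phi_components am : has_components am (phi_std B) phiL.
Proof.
move=> K; rewrite phi_std_basis // /phiL fval_prune /fval big_seq1 big_nil.
by rewrite mulr1.
Qed.

Variable am : nat -> nat -> R.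
Hypothesis brB : forall x y : 'I_7, br (tnth B x) (tnth B y) =
  \sum_(m < 7) ((bracket_coef x y m).1%:~R *
     am (bracket_coef x y m).2.1 (bracket_coef x y m).2.2) *: tnth B m.

Lemma ext_d_components (al : kform g 3) (alL : seq nat -> fpoly) :
  mlin al -> has_components am al alL ->
  has_components am (ext_d br al : kform g 4) (ext_dL alL).
Proof.
move=> al_lin alE K; rewrite /ext_dL fval_prune fval_flatten big_map.
have slotE (x y z w : 'I_7) (s : int) :
    \sum_(l <- [seq
       (let c := bracket_coef x y m in if c.1 == 0 then [::] else
         [seq (s * c.1 * t.1, c.2 :: t.2) | t <- alL [:: m; val z; val w]])
      | m <- iota 0 7]) fval am l =
    s%:~R * al [tuple br (tnth B x) (tnth B y); tnth B z; tnth B w].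
  rewrite brB mlin3_sum0 // big_map sum_iota mulr_sumr; apply: eq_bigr => m _ /=.
  case: eqP => [->|_]; first by rewrite /fval big_nil !mul0r mulr0.
  have -> : [tuple tnth B m; tnth B z; tnth B w] = map_tuple (tnth B) [tuple m; z; w].
    exact: val_inj.
  rewrite alE /fval big_map !mulr_sumr; apply: eq_bigr => t _ /=.
  by rewrite big_cons !intrM; ring.
pose k n := tnth K (inord n).
have kE n : (n < 4)%N -> nth 0%N (map val K) n = val (k n).
  by move=> n4; rewrite (nth_map ord0) ?size_tuple // /k (tnth_nth ord0) inordK.
transitivity (\sum_(p <- ext_d_slots) p.1.1%:~R *
    al [tuple br (tnth B (k p.1.2.1)) (tnth B (k p.1.2.2));
              tnth B (k p.2.1); tnth B (k p.2.2)]).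
  have -> : map_tuple (tnth B) K =
      [tuple tnth B (k 0); tnth B (k 1); tnth B (k 2); tnth B (k 3)].
    rewrite [LHS]tuple4_eta; apply: val_inj => /=.
    by rewrite !(nth_map ord0) ?size_tuple // /k !(tnth_nth ord0) !inordK.
  rewrite ext_d3E /ext_d_slots !big_cons big_nil.
  by rewrite [fst _]/= rmorphN1 rmorph1 /=; ring.
apply: eq_big_seq => p; rewrite !inE => p_slots.
have [h1 h2 h3 h4] : [/\ (p.1.2.1 < 4)%N, (p.1.2.2 < 4)%N, (p.2.1 < 4)%N & (p.2.2 < 4)%N].
  by move: p_slots; do ![case/orP]; move/eqP => ->.
by rewrite fval_flatten !kE //; symmetry; exact: slotE.
Qed.

Lemma hodge_components (al : kform g 4) (alL : seq nat -> fpoly) :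
  mlin al -> is_alternating al -> has_components am al alL ->
  has_components am (hodge B al : kform g 3) (hodgeL alL).
Proof.
move=> al_lin al_alt alE J; rewrite /hodgeL map_inj_uniq; last exact: val_inj.
case: ifP => [uJ|/negbT]; last first.
  case/(uniqPn ord0) => p [q [pq]]; rewrite size_tuple => q3 Jpq.
  rewrite /fval big_nil.
  apply: (@hodge_alternating _ _ B 4 al isT _ (Ordinal (ltn_trans pq q3)) (Ordinal q3)).
    by rewrite -val_eqE /= ltn_eqF.
  by rewrite !tnth_map !(tnth_nth ord0) /= Jpq.
pose Is := [seq i <- enum 'I_7 | i \notin J].
have sI : size Is == 4.
  have := count_predC [in J] (enum 'I_7); rewrite size_enum_ord => /eqP.
  have -> : count [in J] (enum 'I_7) = 3.
    rewrite -size_filter -[RHS](size_tuple J); apply/perm_size/uniq_perm => //.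
      exact/filter_uniq/enum_uniq.
    by move=> x; rewrite mem_filter mem_enum andbT.
  by rewrite -size_filter /Is.
pose I0 : 4.-tuple 'I_7 := Tuple sI.
have IE : map val I0 = [seq i <- iota 0 7 | i \notin map val J].
  rewrite -val_enum_ord filter_map; congr map; apply: eq_filter => i /=.
  by rewrite mem_map //; apply: val_inj.
have uIJ : uniq (I0 ++ J).
  rewrite cat_uniq uJ filter_uniq ?enum_uniq //= andbT; apply/hasPn => x xJ.
  by rewrite mem_filter xJ.
rewrite -IE fval_scale -alE -map_cat.
rewrite (@hodge_complement _ _ B 4 al I0 J isT al_lin al_alt uIJ).
rewrite (vol_basis BB); first exact: mulrC.
by rewrite size_cat !size_tuple.
Qed.

Lemma coflow_components : has_components am (coflow_rhs br B) coflowL.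
Proof.
have phi_lin := @phi_std_mlin _ _ B; have phi_alt := @phi_std_alternating _ _ B.
have d_lin := ext_d3_mlin br phi_lin.
have d_alt := ext_d3_alternating brxx phi_lin phi_alt.
have h_lin : mlin (hodge B (ext_d br (phi_std B) : kform g 4) : kform g 3).
  exact: (@hodge_mlin _ _ B 4).
move=> K; rewrite /coflow_rhs /coflowL.
have -> : fval am [seq (- t.1, t.2) | t <- ext_dL (hodgeL (ext_dL phiL)) (map val K)] =
    - fval am (ext_dL (hodgeL (ext_dL phiL)) (map val K)).
  by rewrite /fval big_map -sumrN; apply: eq_bigr => t _; rewrite /= rmorphN mulNr.
have h_comp : has_components am (hodge B (ext_d br (phi_std B) : kform g 4) : kform g 3)
    (hodgeL (ext_dL phiL)).
  by apply: hodge_components => //; apply: ext_d_components => //; exact: phi_components.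
congr (- _); rewrite -(ext_d_components h_lin h_comp).
apply: (@ext_d_ext _ _ _ 2) => w; apply: (@hodge_ext _ _ _ 4) => u.
by apply: (@ext_d_ext _ _ _ 2) => x; exact: hodge_Phi_std.
Qed.

End FormalEvaluation.

Definition upd_ord {n k} (K : k.-tuple 'I_n) (a : 'I_k) (m : 'I_n) : k.-tuple 'I_n :=
  [tuple if j == a then m else tnth K j | j < k].

(** * Formal components of [vartheta X Phi] and of [d Phi] *)

Section FormalVartheta.
Context {R : realType} {g : vectType R}.
Variables (br : 'Hom(g, 'End(g))) (B : 7.-tuple g).
Hypothesis BB : basis_of fullv B.

Lemma vartheta_components (X : 'End(g)) (xm : nat -> nat -> R) :
  (forall j : 'I_7, X (tnth B j) = \sum_(m < 7) xm m j *: tnth B m) ->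
  has_components B xm (vartheta X (Phi_std B)) varthetaL.
Proof.
move=> XB K; have Phi_lin := @Phi_std_mlin _ _ B.
rewrite /vartheta /varthetaL fval_prune fval_flatten big_map sum_iota -sumrN.
apply: eq_bigr => a _.
pose w := map_tuple (tnth B) K.
have -> : [tuple if j == a then X (tnth w j) else tnth w j | j < 4] =
    upd w a (\sum_(m < 7) xm m (tnth K a) *: tnth B m).
  apply: eq_from_tnth => j; rewrite tnth_mktuple tnth_upd.
  by case: eqP => // ->; rewrite tnth_map XB.
rewrite mlin_suml // /fval big_map sum_iota -sumrN; apply: eq_bigr => m _ /=.
have -> : set_nth 0%N (map val K) a m = map val (upd_ord K a m).
  apply: (@eq_from_nth _ 0%N) => [|p].
    rewrite size_set_nth [in LHS]size_map [RHS]size_map !size_tuple.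
    exact: (maxn_idPr (ltn_ord a)).
  rewrite size_set_nth size_map size_tuple (maxn_idPr (ltn_ord a)) => p4.
  rewrite nth_set_nth /= [RHS](nth_map m) ?size_tuple ?card_ord //.
  rewrite -(tnth_nth m (upd_ord K a m) (Ordinal p4)) tnth_mktuple -val_eqE /=.
  by case: eqP => // _; rewrite (nth_map m) ?size_tuple // -(tnth_nth m K (Ordinal p4)).
have := Phi_std_basis (upd_ord K a m) BB; set z := PhiZ _ => PE.
rewrite big_seq1 /= (nth_map m) ?size_tuple // -tnth_nth mlinZ //.
rewrite mulrNz -PE mulNr [in RHS]mulrC; congr (- (_ * Phi_std B _)).
apply: eq_from_tnth => j; rewrite tnth_upd 2!tnth_map [tnth (upd_ord _ _ _) _]tnth_mktuple.
by case: eqP.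
Qed.

(** The arguments in [v] commute with each other, so only brackets with [e7] survive; the component
    is that of minus the action of [ad e7]-type terms, linear in its matrix. *)
Lemma ext_d_interior k (al : kform g k.+1) (e7 : g) (v : k.+1.-tuple g) : mlin al ->
  (forall i j, br (tnth v i) (tnth v j) = 0) ->
  ext_d br al [tuple of e7 :: v] =
  \sum_(b < k.+1) (-1) ^+ b.+1 *
    al [tuple of br e7 (tnth v b) :: [tuple tnth v (lift b m) | m < k]].
Proof.
move=> al_lin v0; rewrite /ext_d big_ord_recl big1 // add0r.
apply: eq_bigr => b _; rewrite (bigD1 ord0) //= big1 ?addr0 => [|i /andP[ib i0]].
  congr (_ * al _); apply: eq_from_tnth => j.
  have l0 : lift (lift ord0 b) ord0 = ord0 :> 'I_k.+2 by apply: val_inj.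
  case: (unliftP ord0 j) => [m|] ->; last by rewrite !tnth0 l0 tnth0 tnthS.
  rewrite !tnthS !tnth_mktuple.
  have -> : lift (lift ord0 b) (lift ord0 m) = lift ord0 (lift b m).
    by apply: val_inj; rewrite /= /bump !add1n ltnS addnS.
  by rewrite tnthS.
have [i' ->] : exists i' : 'I_k, i = lift ord0 i'.
  by case: (unliftP ord0 i) i0 => [i' ->|->] //; exists i'.
have -> : lift (lift ord0 b) (lift ord0 i') = lift ord0 (lift b i').
  by apply: val_inj; rewrite /= /bump !add1n ltnS addnS.
by rewrite !tnthS v0 -(upd_cons0 0) mlin0 // mulr0.
Qed.

Definition closedL (K : seq nat) : fpoly :=
  prune (flatten [seq [seq ((-1) ^+ b.+1 * PhiZ (m :: del_nth b K),
                            [:: (m, nth 0%N K b)]) | m <- iota 0 7] | b <- iota 0 4]).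

Lemma closed_components (e7 : g) (am : nat -> nat -> R) (K : 4.-tuple 'I_7) :
  (forall j, br e7 (tnth B j) = \sum_(m < 7) am m j *: tnth B m) ->
  (forall i j, br (tnth (map_tuple (tnth B) K) i) (tnth (map_tuple (tnth B) K) j) = 0) ->
  ext_d br (Phi_std B) [tuple of e7 :: map_tuple (tnth B) K] =
  fval am (closedL (map val K)).
Proof.
move=> Ae7 K0; rewrite (ext_d_interior e7 (@Phi_std_mlin _ _ B) K0).
rewrite /closedL fval_prune fval_flatten big_map sum_iota; apply: eq_bigr => b _.
rewrite tnth_map Ae7 /fval big_map sum_iota.
set w := [tuple _ | _ < _].
have slot z : [tuple of z :: w] = upd [tuple of 0 :: w] ord0 z by rewrite upd_cons0.
rewrite slot mlin_suml ?mulr_sumr; last exact: Phi_std_mlin.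
apply: eq_bigr => m _ /=; rewrite mlinZ; last exact: Phi_std_mlin.
rewrite -slot big_seq1 /= (nth_map m) ?size_tuple // -tnth_nth.
have -> : [tuple of tnth B m :: w] =
    map_tuple (tnth B) [tuple of m :: [tuple tnth K (lift b c) | c < 3]].
  apply: eq_from_tnth => j; rewrite tnth_map.
  by case: (unliftP ord0 j) => [c|] ->; rewrite ?tnth0 // !tnthS !tnth_mktuple tnth_map.
rewrite Phi_std_basis // intrM rmorph_sign /=.
rewrite -mulrA [X in _ = _ * X]mulrC; congr (_ * (_ * (PhiZ _)%:~R)).
congr (_ :: _); apply: (@eq_from_nth _ 0%N) => [|i].
  rewrite [LHS]size_map [LHS]size_map size_enum_ord /del_nth size_cat size_take size_drop.
  rewrite size_map size_tuple.
  by rewrite ltn_ord; case: b {w slot} => [[|[|[|[|//]]]] ?].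
rewrite size_map size_map size_enum_ord => i3; rewrite nth_del_nth.
rewrite (nth_map m) ?size_map ?size_enum_ord //.
rewrite (nth_map (Ordinal i3)) ?size_enum_ord //.
have -> : nth (Ordinal i3) (enum 'I_3) i = Ordinal i3.
  exact: (nth_ord_enum _ (Ordinal i3)).
have b4 : (bump b i < 4)%N := ltn_ord (lift b (Ordinal i3)).
by rewrite (nth_map m) ?size_tuple // -(tnth_nth m (n := 4) K (Ordinal b4));
  congr (val (tnth _ _)); apply: val_inj.
by rewrite -enumT size_enum_ord.
Qed.

End FormalVartheta.

(** * The Laplacian identity as polynomial identities *)

Section LaplacianPolynomials.
Context {R : realFieldType}.

Fixpoint mval (am : nat -> nat -> R) (ps : seq (nat * nat)) : R :=
  match ps with
  | [::] => 1
  | [:: p] => am p.1 p.2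
  | p :: ps' => am p.1 p.2 * mval am ps'
  end.

(* A computational form of [fval]: coefficients 0, 1, -1 disappear. *)
Fixpoint fcomp (am : nat -> nat -> R) (l : fpoly) : R :=
  match l with
  | [::] => 0
  | (z, ps) :: l' =>
      match z with
      | Posz 0 => 0
      | Posz 1 => mval am ps
      | Negz 0 => - mval am ps
      | _ => z%:~R * mval am ps
      end + fcomp am l'
  end.

Lemma fcompE (am : nat -> nat -> R) l :
  \sum_(t <- l) t.1%:~R * \prod_(p <- t.2) am p.1 p.2 = fcomp am l.
Proof.
have mE ps : \prod_(p <- ps) am p.1 p.2 = mval am ps.
  elim: ps => [|p ps IH]; first by rewrite big_nil.
  by rewrite big_cons IH; case: ps {IH} => //=; rewrite mulr1.
elim: l => [|[z ps] l IH]; first by rewrite big_nil.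
rewrite big_cons IH /= mE; congr (_ + _).
by case: z => [[|[|n]]|[|n]] //=; rewrite ?mul0r ?mul1r ?mulN1r.
Qed.

(** Indices out of range give 0, so a 6 by 6 table also describes the extension by 0 on [e7], whose
    index is 6. *)
Definition mx_entry (rows : seq (seq R)) (m j : nat) : R := nth 0 (nth [::] rows m) j.

Variables (a b s0 s1 s2 p1 p2 p3 p4 p5 p6 q0 q1 q2 : R).
Hypothesis ab : a ^+ 2 + b ^+ 2 = 1.

Definition S_rows : seq (seq R) :=
  [:: [:: s0 * a; s0 * b; 0; 0; 0; 0];
      [:: s0 * b; - (s0 * a); 0; 0; 0; 0];
      [:: 0; 0; s1 * a; s1 * b; 0; 0];
      [:: 0; 0; s1 * b; - (s1 * a); 0; 0];
      [:: 0; 0; 0; 0; s2 * a; s2 * b];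
      [:: 0; 0; 0; 0; s2 * b; - (s2 * a)]].

(** The general element of u(3) in real form, with nine parameters: 2 by 2 blocks are complex
    numbers, and [q0], [q1], [q2] are the imaginary parts on the diagonal, whose sum is [l]. *)
Definition L_rows : seq (seq R) :=
  [:: [:: 0; - q0; p1; p2; p3; p4];
      [:: q0; 0; - p2; p1; - p4; p3];
      [:: - p1; p2; 0; - q1; p5; p6];
      [:: - p2; - p1; q1; 0; - p6; p5];
      [:: - p3; p4; - p5; p6; 0; - q2];
      [:: - p4; - p3; - p6; - p5; q2; 0]].

Definition A_entry (m j : nat) : R := mx_entry S_rows m j + mx_entry L_rows m j.

(** For [a = cos theta], [b = sin theta] the two coefficients are [2 cos (2 theta)] and
    [-2 sin (2 theta)], times a product of two of the [s]. *)
Definition Sigma_rows : seq (seq R) :=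
  let u t := t * (- 2 + 4 * a ^+ 2) in let v t := t * (- 4 * a * b) in
  [:: [:: u (s1 * s2); v (s1 * s2); 0; 0; 0; 0];
      [:: v (s1 * s2); - u (s1 * s2); 0; 0; 0; 0];
      [:: 0; 0; u (s0 * s2); v (s0 * s2); 0; 0];
      [:: 0; 0; v (s0 * s2); - u (s0 * s2); 0; 0];
      [:: 0; 0; 0; 0; u (s0 * s1); v (s0 * s1)];
      [:: 0; 0; 0; 0; v (s0 * s1); - u (s0 * s1)]].

Definition X_entry (m j : nat) : R :=
  match m, j with
  | 6%N, 6%N => s0 ^+ 2 + s1 ^+ 2 + s2 ^+ 2 + (q0 + q1 + q2) ^+ 2
  | 6%N, _ | _, 6%N => 0
  | _, _ =>
    let S := mx_entry S_rows in let L := mx_entry L_rows in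
    let C k := S m k * L k j - L m k * S k j in
    - mx_entry Sigma_rows m j + (C 0%N + C 1%N + C 2%N + C 3%N + C 4%N + C 5%N)
  end.

Definition laplacian_eq (K : seq nat) : Prop :=
  fcomp A_entry (coflowL K) = fcomp X_entry (varthetaL K).

End LaplacianPolynomials.

Ltac vm_rewrite F :=
  match goal with |- context [F ?K] =>
    let v := eval vm_compute in (F K) in
    rewrite (_ : F K = v); [|by vm_cast_no_check (erefl v)] end.

Ltac laplacian_case :=
  rewrite /laplacian_eq; vm_rewrite coflowL; vm_rewrite varthetaL;
  cbv [fcomp mval A_entry X_entry mx_entry S_rows L_rows Sigma_rows nth fst snd].

Definition sorted4 : seq (seq nat) :=
  [:: [:: 0; 1; 2; 3]; [:: 0; 1; 2; 4]; [:: 0; 1; 2; 5]; [:: 0; 1; 2; 6];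
      [:: 0; 1; 3; 4]; [:: 0; 1; 3; 5]; [:: 0; 1; 3; 6]; [:: 0; 1; 4; 5];
      [:: 0; 1; 4; 6]; [:: 0; 1; 5; 6]; [:: 0; 2; 3; 4]; [:: 0; 2; 3; 5];
      [:: 0; 2; 3; 6]; [:: 0; 2; 4; 5]; [:: 0; 2; 4; 6]; [:: 0; 2; 5; 6];
      [:: 0; 3; 4; 5]; [:: 0; 3; 4; 6]; [:: 0; 3; 5; 6]; [:: 0; 4; 5; 6];
      [:: 1; 2; 3; 4]; [:: 1; 2; 3; 5]; [:: 1; 2; 3; 6]; [:: 1; 2; 4; 5];
      [:: 1; 2; 4; 6]; [:: 1; 2; 5; 6]; [:: 1; 3; 4; 5]; [:: 1; 3; 4; 6];
      [:: 1; 3; 5; 6]; [:: 1; 4; 5; 6]; [:: 2; 3; 4; 5]; [:: 2; 3; 4; 6];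
      [:: 2; 3; 5; 6]; [:: 2; 4; 5; 6]; [:: 3; 4; 5; 6]]%N.

Lemma sorted4P : tall 4 (fun K => if sorted ltn K then K \in sorted4 else true).
Proof. by vm_compute. Qed.

(** After evaluation of the formal components, each of the 35 increasing indices leaves a polynomial
    identity in 14 variables, valid modulo [a^2 + b^2 = 1]. *)
Lemma laplacian_eq_sorted (R : realFieldType)
    (a b s0 s1 s2 p1 p2 p3 p4 p5 p6 q0 q1 q2 : R) (K : 4.-tuple 'I_7) :
  a ^+ 2 + b ^+ 2 = 1 -> sorted ltn (map val K) ->
  laplacian_eq a b s0 s1 s2 p1 p2 p3 p4 p5 p6 q0 q1 q2 (map val K).
Proof.
move=> ab2 sK; have ab : a ^+ 2 = 1 - b ^+ 2 by rewrite -ab2 addrK.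
have := tallP sorted4P K; rewrite sK.
move: (map val K) => {K sK} K; rewrite /sorted4 !inE.
by do ![case/orP]; move/eqP => ->; laplacian_case; ring: ab.
Qed.

(** * The almost-abelian algebra in the frame [(f, e7)] *)

Section AlmostAbelian.
Context {R : realType} {g : vectType R}.
Variables (br : 'Hom(g, 'End(g))) (E : 7.-tuple g) (h : {vspace g}) (e7 : g).
Variables (f : 6.-tuple g) (theta : R) (s : 'I_3 -> R) (Sigma Lambda : 'End(g)).
Hypotheses (EB : basis_of fullv E) (fB : basis_of h f).
Hypotheses (e7u : metric E e7 e7 = 1) (e7h : forall v, v \in h -> metric E e7 v = 0).
Hypotheses (brxx : forall x, br x x = 0) (ideal : is_abelian_ideal br h).

Let B := full_frame e7 f.
Let BB : basis_of fullv B := full_frame_basis EB fB e7u e7h.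
Hypothesis ortho : forall a b, metric E (tnth B a) (tnth B b) = (a == b)%:R.

Let A := br e7.
Let At := transpose E A.
Let S := sympart E A.
Let L := skewpart E A.
Let l := im_trace f L.
Let X0 := - (Sigma + Lambda - commutator S L).

Hypothesis diagS : diagonalizes f theta s S.
Hypothesis SigmaE : is_Sigma e7 f theta s Sigma.
Hypothesis LambdaE : is_Lambda h e7 l Lambda.
Hypothesis closedPhi : ext_d br (Phi_std B) =1 (fun=> 0).

Lemma metric_coord a v : metric E (tnth B a) v = coord B a v.
Proof.
rewrite {1}(basis_expand v BB) metricC metric_suml (bigD1 a) //=.
rewrite ortho eqxx mulr1 big1 ?addr0 // => b ba.
by rewrite ortho (negbTE ba) mulr0.
Qed.

Lemma transposeE v w : metric E (At v) w = metric E v (A w).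
Proof.
have AtE : At v = \sum_(i < 7) metric E v (A (tnth E i)) *: tnth E i.
  apply: linfunE => c x y; rewrite scaler_sumr -big_split; apply: eq_bigr => i _ /=.
  by rewrite metric_linearl scalerDl scalerA.
have AwE : A w = \sum_(i < 7) coord E i w *: A (tnth E i).
  rewrite {1}(basis_expand w EB) linear_sum.
  by apply: eq_bigr => i _; rewrite linearZ.
rewrite AtE AwE [RHS]metricC !metric_suml; apply: eq_bigr => i _.
by rewrite metric_tnth // metricC mulrC.
Qed.

Lemma coord_transpose i j : coord B i (At (tnth B j)) = coord B j (A (tnth B i)).
Proof. by rewrite -!metric_coord metricC transposeE. Qed.

Lemma A_e7 : A e7 = 0. Proof. exact: brxx. Qed.

Lemma A_mem v : v \in h -> A v \in h.
Proof. by move=> vh; apply: ideal.1. Qed.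

Lemma B_last : tnth B ord_max = e7. Proof. exact: full_frame_last. Qed.

Lemma B_mem (i : 'I_7) : (i < 6)%N -> tnth B i \in h.
Proof. by move=> i6; rewrite full_frame_nth // (frame_mem fB). Qed.

Lemma ord7_split (i : 'I_7) : (i < 6)%N \/ i = ord_max.
Proof.
have [i6|i6] := ltnP i 6; [by left|right].
by apply/val_inj/eqP; rewrite eqn_leq i6 -ltnS ltn_ord.
Qed.

Lemma coord_last v : v \in h -> coord B ord_max v = 0.
Proof. by move=> vh; rewrite -metric_coord B_last e7h. Qed.

Lemma coord_A_last j : coord B ord_max (A (tnth B j)) = 0.
Proof.
have [j6|->] := ord7_split j; first by rewrite coord_last // A_mem // B_mem.
by rewrite B_last A_e7 linear0.
Qed.

Lemma coord_A_e7 i : coord B i (A (tnth B ord_max)) = 0.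
Proof. by rewrite B_last A_e7 linear0. Qed.

Lemma coord_S i j : coord B i (S (tnth B j)) =
  2^-1 * (coord B i (A (tnth B j)) + coord B j (A (tnth B i))).
Proof. by rewrite /S /sympart !lfun_simp linearZ linearD /= coord_transpose. Qed.

Lemma coord_L i j : coord B i (L (tnth B j)) =
  2^-1 * (coord B i (A (tnth B j)) - coord B j (A (tnth B i))).
Proof. by rewrite /L /skewpart !lfun_simp linearZ linearB /= coord_transpose. Qed.

Lemma coord_eq u v : (forall i, coord B i u = coord B i v) -> u = v.
Proof.
move=> uv; rewrite (basis_expand u BB) (basis_expand v BB).
by apply: eq_bigr => i _; rewrite uv.
Qed.

Lemma S_apply v : S v = 2^-1 *: (A v + At v).
Proof. by rewrite /S /sympart !lfun_simp. Qed.

Lemma L_apply v : L v = 2^-1 *: (A v - At v).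
Proof. by rewrite /L /skewpart !lfun_simp. Qed.

Lemma commutator_apply (X Y : 'End(g)) v : commutator X Y v = X (Y v) - Y (X v).
Proof. by rewrite /commutator !lfun_simp. Qed.

(** With [S] and [L] half the sum and half the difference of [A] and its transpose, the squares
    cancel in the commutator and the mixed terms add up. *)
Lemma commutator_SL v : commutator S L v = - (2^-1 *: commutator A At v).
Proof.
have linD (T : 'End(g)) x y : T (2^-1 *: (x + y)) = 2^-1 *: (T x + T y).
  by rewrite linearZ linearD.
have linB (T : 'End(g)) x y : T (2^-1 *: (x - y)) = 2^-1 *: (T x - T y).
  by rewrite linearZ linearB.
rewrite !commutator_apply S_apply [L (S v)]L_apply L_apply S_apply !linB !linD.
move: (A (A v)) (A (At v)) (At (A v)) (At (At v)) => p q r t.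
apply: coord_eq => i; have cZ x y : coord B i (x *: y) = x * coord B i y by rewrite linearZ.
have cD x y : coord B i (x + y) = coord B i x + coord B i y by rewrite linearD.
have cN x : coord B i (- x) = - coord B i x by rewrite linearN.
by rewrite !(cN, cZ, cD); field.
Qed.

Lemma At_e7 : At e7 = 0.
Proof.
apply: coord_eq => i; rewrite -B_last coord_transpose coord_A_last.
by rewrite linear0.
Qed.

Lemma At_mem v : v \in h -> At v \in h.
Proof.
move=> vh; rewrite (memh EB fB e7u e7h) metricC transposeE A_e7 metricC metric0l.
exact: eqxx.
Qed.

Lemma S_mem v : v \in h -> S v \in h.
Proof. by move=> vh; rewrite S_apply memvZ // memvD ?A_mem ?At_mem. Qed.

Lemma L_mem v : v \in h -> L v \in h.
Proof. by move=> vh; rewrite L_apply memvZ // memvB ?A_mem ?At_mem. Qed.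

Lemma f_mem n : (n < 6)%N -> f`_n \in h.
Proof. exact: (frame_mem fB). Qed.

Lemma Sigma_mem v : v \in h -> Sigma v \in h.
Proof.
move=> vh; rewrite (coord_basis fB vh) linear_sum; apply: memv_suml => i _.
rewrite linearZ; apply: memvZ => /=; have [_ Sf] := SigmaE.
have mem2 (k : 'I_3) (x y : R) : x *: fr f k + y *: Jfr f k \in h.
  by rewrite memvD // memvZ // f_mem //; case: k => [[|[|[|//]]]].
case: i => [[|[|[|[|[|[|//]]]]]] p] /=.
- by have [-> _] := Sf (@Ordinal 3 0 isT); apply: memvZ.
- by have [_ ->] := Sf (@Ordinal 3 0 isT); apply: memvZ.
- by have [-> _] := Sf (@Ordinal 3 1 isT); apply: memvZ.
- by have [_ ->] := Sf (@Ordinal 3 1 isT); apply: memvZ.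
- by have [-> _] := Sf (@Ordinal 3 2 isT); apply: memvZ.
- by have [_ ->] := Sf (@Ordinal 3 2 isT); apply: memvZ.
Qed.

Lemma X0_apply v : X0 v = - (Sigma v + Lambda v - commutator S L v).
Proof. by rewrite /X0 opp_lfunE add_lfunE opp_lfunE add_lfunE. Qed.

Lemma X0_ideal v : v \in h -> X0 v = (- Sigma - 2^-1 *: commutator A At) v.
Proof.
move=> vh; have Lv : Lambda v = 0 := LambdaE.1 v vh.
rewrite X0_apply Lv addr0 commutator_SL.
rewrite [RHS]add_lfunE ![in RHS]opp_lfunE [in RHS]scale_lfunE.
by rewrite opprD opprK.
Qed.

Lemma X0_e7 : X0 e7 = (l ^+ 2 + sqnorm s) *: e7.
Proof.
have Se7 : S e7 = 0 by rewrite S_apply At_e7 A_e7 addr0 scaler0.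
have Le7 : L e7 = 0 by rewrite L_apply At_e7 A_e7 subr0 scaler0.
rewrite X0_apply commutator_apply Se7 Le7 !linear0 ?subr0 ?oppr0 ?addr0.
by rewrite SigmaE.1 LambdaE.2 subr0 -scalerDl -[LHS]scaleNr opprD !opprK addrC.
Qed.

Lemma X0_mem v : v \in h -> X0 v \in h.
Proof.
move=> vh; have Lv : Lambda v = 0 := LambdaE.1 v vh.
rewrite X0_apply Lv addr0 commutator_apply memvN memvD ?memvN ?memvB //.
- exact: Sigma_mem.
- by rewrite S_mem // L_mem.
- by rewrite L_mem // S_mem.
Qed.

Lemma split_e7 v : exists2 u, u \in h & v = coord B ord_max v *: e7 + u.
Proof.
exists (v - coord B ord_max v *: e7); last by rewrite addrC subrK.
rewrite (memh EB fB e7u e7h) -B_last metric_coord linearB linearZ /=.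
by rewrite coord_tnth // eqxx mulr1 subrr.
Qed.

(** [D = X0 - c] preserves the ideal and multiplies [e7] by [l^2 + s^2 - c]. The derivation rule on
    [[e7, v]] thus reads [[D, A] = delta A], and all other brackets are determined by these. As [c]
    commutes with [A], [D] may be replaced by [X0] in the commutator. *)
Lemma soliton_eq c : soliton_with br X0 c <->
  forall v, v \in h -> commutator (- Sigma - 2^-1 *: commutator A At) A v =
    (l ^+ 2 + sqnorm s - c) *: A v.
Proof.
set de := l ^+ 2 + sqnorm s - c; set Y := - Sigma - _.
have comE (D : 'End(g)) v : X0 = c *: \1%VF + D -> v \in h ->
    D (A v) - A (D v) = commutator Y A v.
  move=> X0E vh; have DE u : u \in h -> D u = Y u - c *: u.
    move=> uh; rewrite -X0_ideal // X0E !lfun_simp.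
    by rewrite [c *: u + _]addrC addrK.
  have AE x : A (Y v - x *: v) = A (Y v) - x *: A v by rewrite linearB linearZ.
  rewrite commutator_apply (DE _ (A_mem vh)) (DE _ vh) AE.
  by rewrite opprB addrA subrK.
have De7 (D : 'End(g)) : X0 = c *: \1%VF + D -> D e7 = de *: e7.
  move=> X0E; have := X0_e7; rewrite X0E !lfun_simp => /(canRL (addKr _)) ->.
  by rewrite addrC -scalerBl.
split=> [[D [Dder X0E]] v vh|com].
  rewrite -(comE D v X0E vh) Dder (De7 D X0E) linearZ /= scale_lfunE.
  by rewrite addrK.
pose D := X0 - c *: \1%VF; have X0E : X0 = c *: \1%VF + D by rewrite addrC subrK.
exists D; split=> //; move: D X0E => D X0E x y.
have DA v : v \in h -> D (A v) = A (D v) + de *: A v.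
  by move=> vh; rewrite -com // -(comE D v X0E vh) addrC subrK.
have Dh v : v \in h -> D v \in h.
  move=> vh; have := X0_mem vh; rewrite X0E add_lfunE scale_lfunE id_lfunE.
  by rewrite rpredDl // memvZ.
(* For the converse, arbitrary arguments are split along [e7] and the ideal, where the bracket
   reduces to [A]. *)
have [u uh ->] := split_e7 x; have [w wh ->] := split_e7 y.
move: (coord B ord_max x) (coord B ord_max y) => p q.
have br0 v z : v \in h -> z \in h -> br v z = 0 by move=> vh zh; apply: ideal.2.
have brE v z p' q' : v \in h -> z \in h ->
    br (p' *: e7 + v) (q' *: e7 + z) = p' *: A z - q' *: A v.
  move=> vh zh; rewrite bracket_linearl !bracket_linearr brxx scaler0 add0r.
  rewrite (br0 _ _ vh zh) addr0 -/A; congr (_ + _).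
  by rewrite (bracketC brxx) scalerN.
have DE r v : D (r *: e7 + v) = (r * de) *: e7 + D v.
  by rewrite linearP /= (De7 D X0E) scalerA.
have DB v z p' q' : D (p' *: v - q' *: z) = p' *: D v - q' *: D z.
  by rewrite linearB !linearZ.
rewrite !DE !brE ?Dh // DB !DA //.
move: (A (D u)) (A (D w)) (A u) (A w) => Du Dw Au Aw.
apply: coord_eq => i; have cZ x' y' : coord B i (x' *: y') = x' * coord B i y'.
  by rewrite linearZ.
have cD x' y' : coord B i (x' + y') = coord B i x' + coord B i y' by rewrite linearD.
have cN x' : coord B i (- x') = - coord B i x' by rewrite linearN.
by rewrite !(cN, cZ, cD); ring.
Qed.

Let am (m j : nat) : R := coord B (inord m) (A (tnth B (inord j))).
Let lm (m j : nat) : R := 2^-1 * (am m j - am j m).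
Let a := cos theta.
Let b := sin theta.
Let s0 := s (@Ordinal 3 0 isT).
Let s1 := s (@Ordinal 3 1 isT).
Let s2 := s (@Ordinal 3 2 isT).
Let S_mx := mx_entry (S_rows a b s0 s1 s2).
Let L_mx := mx_entry (L_rows (lm 0 2) (lm 0 3) (lm 0 4) (lm 0 5) (lm 2 4) (lm 2 5)
  (lm 1 0) (lm 3 2) (lm 5 4)).
Let A_mx := A_entry a b s0 s1 s2 (lm 0 2) (lm 0 3) (lm 0 4) (lm 0 5) (lm 2 4) (lm 2 5)
  (lm 1 0) (lm 3 2) (lm 5 4).
Let X_mx := X_entry a b s0 s1 s2 (lm 0 2) (lm 0 3) (lm 0 4) (lm 0 5) (lm 2 4) (lm 2 5)
  (lm 1 0) (lm 3 2) (lm 5 4).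

Lemma am_coord (i j : 'I_7) : am i j = coord B i (A (tnth B j)).
Proof. by rewrite /am !inord_val. Qed.

Lemma coord_f (i : 'I_7) n : (n < 6)%N -> coord B i f`_n = (val i == n)%:R.
Proof.
move=> n6; have n7 : (n < 7)%N := leqW n6.
by rewrite -(@full_frame_nth _ _ e7 f (Ordinal n7)) // coord_tnth.
Qed.

Lemma coord_f2 (i : 'I_7) x y m n : (m < 6)%N -> (n < 6)%N ->
  coord B i (x *: f`_m + y *: f`_n) = x * (val i == m)%:R + y * (val i == n)%:R.
Proof. by move=> m6 n6; rewrite linearD !linearZ /= !coord_f. Qed.

Lemma S_entries (i j : 'I_7) : coord B i (S (tnth B j)) = S_mx i j.
Proof.
have S0 := diagS (@Ordinal 3 0 isT); have S1 := diagS (@Ordinal 3 1 isT).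
have S2 := diagS (@Ordinal 3 2 isT).
rewrite -/s0 -/a -/b in S0; rewrite -/s1 -/a -/b in S1; rewrite -/s2 -/a -/b in S2.
have cN v : coord B i (- v) = - coord B i v by rewrite linearN.
have cZ x v : coord B i (x *: v) = x * coord B i v by rewrite linearZ.
have [j6|->] := ord7_split j; last first.
  rewrite B_last S_apply At_e7 A_e7 addr0 scaler0 linear0.
  by case: i {cN cZ} => [[|[|[|[|[|[|[|//]]]]]]] ?].
rewrite full_frame_nth //; case: j j6 => [[|[|[|[|[|[|[|//]]]]]]] ?] //= _.
- rewrite (S0.1 : S f`_0 = _) cZ coord_f2 //.
  by case: i {cN cZ} => [[|[|[|[|[|[|[|//]]]]]]] ?]; rewrite /S_mx /mx_entry /=; ring.
- rewrite (S0.2 : S f`_1 = _) cN cZ coord_f2 //.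
  by case: i {cN cZ} => [[|[|[|[|[|[|[|//]]]]]]] ?]; rewrite /S_mx /mx_entry /=; ring.
- rewrite (S1.1 : S f`_2 = _) cZ coord_f2 //.
  by case: i {cN cZ} => [[|[|[|[|[|[|[|//]]]]]]] ?]; rewrite /S_mx /mx_entry /=; ring.
- rewrite (S1.2 : S f`_3 = _) cN cZ coord_f2 //.
  by case: i {cN cZ} => [[|[|[|[|[|[|[|//]]]]]]] ?]; rewrite /S_mx /mx_entry /=; ring.
- rewrite (S2.1 : S f`_4 = _) cZ coord_f2 //.
  by case: i {cN cZ} => [[|[|[|[|[|[|[|//]]]]]]] ?]; rewrite /S_mx /mx_entry /=; ring.
- rewrite (S2.2 : S f`_5 = _) cN cZ coord_f2 //.
  by case: i {cN cZ} => [[|[|[|[|[|[|[|//]]]]]]] ?]; rewrite /S_mx /mx_entry /=; ring.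
Qed.

Let Sg_mx := mx_entry (Sigma_rows a b s0 s1 s2).

Lemma Sigma_entries (i j : 'I_7) : (j < 6)%N -> coord B i (Sigma (tnth B j)) = Sg_mx i j.
Proof.
have [_ Sf] := SigmaE.
have o1 : lift ord0 ord0 = @Ordinal 3 1 isT by apply: val_inj.
have o2 : lift ord0 (lift ord0 ord0) = @Ordinal 3 2 isT by apply: val_inj.
have prE k : \prod_(m | m != k) s m = (if k == 0%N :> nat then 1 else s0) *
    ((if k == 1%N :> nat then 1 else s1) * (if k == 2%N :> nat then 1 else s2)).
  have o0 : ord0 = @Ordinal 3 0 isT by apply: val_inj.
  rewrite big_mkcond !big_ord_recl big_ord0 o2 o1 o0.
  by case: k => [[|[|[|//]]] k3]; rewrite /= mulr1.
have S0 := Sf (@Ordinal 3 0 isT); have S1 := Sf (@Ordinal 3 1 isT).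
have S2 := Sf (@Ordinal 3 2 isT).
rewrite prE /= mul1r -/a -/b in S0; rewrite prE /= mul1r -/a -/b in S1.
rewrite prE /= mulr1 -/a -/b in S2.
have cZ x v : coord B i (x *: v) = x * coord B i v by rewrite linearZ.
move=> j6; rewrite full_frame_nth //; case: j j6 => [[|[|[|[|[|[|[|//]]]]]]] ?] //= _.
- rewrite (S0.1 : Sigma f`_0 = _) cZ coord_f2 //.
  by case: i {cZ} => [[|[|[|[|[|[|[|//]]]]]]] ?]; rewrite /Sg_mx /mx_entry /=; ring.
- rewrite (S0.2 : Sigma f`_1 = _) cZ coord_f2 //.
  by case: i {cZ} => [[|[|[|[|[|[|[|//]]]]]]] ?]; rewrite /Sg_mx /mx_entry /=; ring.
- rewrite (S1.1 : Sigma f`_2 = _) cZ coord_f2 //.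
  by case: i {cZ} => [[|[|[|[|[|[|[|//]]]]]]] ?]; rewrite /Sg_mx /mx_entry /=; ring.
- rewrite (S1.2 : Sigma f`_3 = _) cZ coord_f2 //.
  by case: i {cZ} => [[|[|[|[|[|[|[|//]]]]]]] ?]; rewrite /Sg_mx /mx_entry /=; ring.
- rewrite (S2.1 : Sigma f`_4 = _) cZ coord_f2 //.
  by case: i {cZ} => [[|[|[|[|[|[|[|//]]]]]]] ?]; rewrite /Sg_mx /mx_entry /=; ring.
- rewrite (S2.2 : Sigma f`_5 = _) cZ coord_f2 //.
  by case: i {cZ} => [[|[|[|[|[|[|[|//]]]]]]] ?]; rewrite /Sg_mx /mx_entry /=; ring.
Qed.

Lemma A_e7_expand (j : 'I_7) : br e7 (tnth B j) = \sum_(m < 7) am m j *: tnth B m.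
Proof.
rewrite {1}(basis_expand (br e7 (tnth B j)) BB); apply: eq_bigr => m _.
by rewrite am_coord.
Qed.

Lemma closed_entries (K : 4.-tuple 'I_7) : all (ltn^~ 6) (map val K) ->
  fcomp am (closedL (map val K)) = 0.
Proof.
move=> K6; have BK i : tnth (map_tuple (tnth B) K) i \in h.
  rewrite tnth_map B_mem //; move/allP: K6; apply.
  by apply: map_f; apply: mem_tnth.
rewrite -fcompE -[LHS]/(fval am _) -(closed_components BB A_e7_expand).
  exact: closedPhi.
by move=> i j; apply: ideal.2.
Qed.

Lemma am_last_row j : (j < 7)%N -> am 6 j = 0.
Proof.
move=> j7; rewrite -[j]/(val (Ordinal j7)) -[6%N]/(val (@ord_max 6)).
by rewrite am_coord coord_A_last.
Qed.

Lemma am_last_col j : (j < 7)%N -> am j 6 = 0.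
Proof.
move=> j7; rewrite -[j]/(val (Ordinal j7)) -[6%N]/(val (@ord_max 6)).
by rewrite am_coord coord_A_e7.
Qed.

(** Components of [d Phi] on [e7] and four vectors of the ideal. They are the conditions for [A] to
    be symplectic that mix different planes of the frame. *)
Lemma closed_relations :
  [/\ am 3 0 = am 1 2, am 2 0 = - am 1 3, am 5 0 = am 1 4, am 4 0 = - am 1 5 &
      am 5 2 = am 3 4 /\ am 4 2 = - am 3 5].
Proof.
have a6 := am_last_row.
pose K (i j k l' : nat) : 4.-tuple 'I_7 := [tuple inord i; inord j; inord k; inord l'].
have KE i j k l' : (i < 6)%N -> (j < 6)%N -> (k < 6)%N -> (l' < 6)%N ->
    fcomp am (closedL [:: i; j; k; l']) = 0.
  move=> i6 j6 k6 l6; have mK : map val (K i j k l') = [:: i; j; k; l'].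
    by rewrite /= !inordK; do ?exact: leqW.
  by rewrite -mK; apply: closed_entries; rewrite mK /= i6 j6 k6 l6.
move: (KE 0 2 4 5 isT isT isT isT)%N (KE 0 3 4 5 isT isT isT isT)%N.
move: (KE 0 2 3 4 isT isT isT isT)%N (KE 0 2 3 5 isT isT isT isT)%N.
move: (KE 0 1 2 4 isT isT isT isT)%N (KE 0 1 2 5 isT isT isT isT)%N.
do 6![vm_rewrite closedL]; cbv [fcomp mval fst snd]; rewrite !a6 // => E1 E2 E3 E4 E5 E6.
by split; [| | | |split]; lra.
Qed.

Lemma sm_entries m j : (m < 7)%N -> (j < 7)%N -> 2^-1 * (am m j + am j m) = S_mx m j.
Proof.
move=> m7 j7; rewrite -[m]/(val (Ordinal m7)) -[j]/(val (Ordinal j7)).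
by rewrite -S_entries coord_S !am_coord.
Qed.

(** [S] has no entries between different planes, so there the closedness relations concern [L] alone
    and say that it commutes with [J]. Inside a plane every skew-symmetric matrix commutes with
    [J]. *)
Lemma lm_entries m j : (m < 7)%N -> (j < 7)%N -> lm m j = L_mx m j.
Proof.
have [r1 r2 r3 r4 [r5 r6]] := closed_relations; move=> m7 j7.
have s02 := @sm_entries 0 2 isT isT; have s03 := @sm_entries 0 3 isT isT.
have s04 := @sm_entries 0 4 isT isT; have s05 := @sm_entries 0 5 isT isT.
have s12 := @sm_entries 1 2 isT isT; have s13 := @sm_entries 1 3 isT isT.
have s14 := @sm_entries 1 4 isT isT; have s15 := @sm_entries 1 5 isT isT.
have s24 := @sm_entries 2 4 isT isT; have s25 := @sm_entries 2 5 isT isT.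
have s34 := @sm_entries 3 4 isT isT; have s35 := @sm_entries 3 5 isT isT.
rewrite /S_mx /mx_entry /= in s02 s03 s04 s05 s12 s13 s14 s15 s24 s25 s34 s35.
have lmN x y : lm x y = - lm y x by rewrite /lm; ring.
have e12 : lm 1 2 = - lm 0 3 by rewrite /lm; lra.
have e13 : lm 1 3 = lm 0 2 by rewrite /lm; lra.
have e14 : lm 1 4 = - lm 0 5 by rewrite /lm; lra.
have e15 : lm 1 5 = lm 0 4 by rewrite /lm; lra.
have e34 : lm 3 4 = - lm 2 5 by rewrite /lm; lra.
have e35 : lm 3 5 = lm 2 4 by rewrite /lm; lra.
have l6 n : (n < 7)%N -> lm 6 n = 0 /\ lm n 6 = 0.
  by move=> n7; rewrite /lm am_last_row // am_last_col // subrr mulr0.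
have [->|m6] := eqVneq m 6%N; first by rewrite (l6 _ j7).1 /L_mx /mx_entry /= nth_nil.
have [->|j6] := eqVneq j 6%N.
  rewrite (l6 _ m7).2 /L_mx /mx_entry nth_default //.
  by case: m m7 {m6} => [|[|[|[|[|[|[|//]]]]]]].
have lm0 x : lm x x = 0 by rewrite /lm subrr mulr0.
rewrite /L_mx /mx_entry.
case: m m7 m6 => [|[|[|[|[|[|[|//]]]]]]] _ //;
case: j j7 j6 => [|[|[|[|[|[|[|//]]]]]]] _ // _ _ /=;
rewrite ?lm0 ?(lmN 0 1)%N ?(lmN 2 3)%N ?(lmN 4 5)%N ?(lmN 2 0)%N ?(lmN 3 0)%N
  ?(lmN 4 0)%N ?(lmN 5 0)%N ?(lmN 2 1)%N ?(lmN 3 1)%N ?(lmN 4 1)%N ?(lmN 5 1)%N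
  ?(lmN 4 2)%N ?(lmN 5 2)%N ?(lmN 4 3)%N ?(lmN 5 3)%N
  ?e12 ?e13 ?e14 ?e15 ?e34 ?e35 ?opprK //.
Qed.

Lemma am_entries m j : (m < 7)%N -> (j < 7)%N -> am m j = A_mx m j.
Proof.
move=> m7 j7; have -> : A_mx m j = S_mx m j + L_mx m j by [].
rewrite -sm_entries // -lm_entries // /lm.
by field.
Qed.

Lemma l_entries : l = lm 1 0 + lm 3 2 + lm 5 4.
Proof.
have lmE (i j : 'I_7) : lm i j = coord B i (L (tnth B j)).
  by rewrite coord_L /lm !am_coord.
have cE i v : (i < 6)%N -> v \in h -> coord f (inord i) v = coord B (inord i) v.
  move=> i6 vh; rewrite -(coord_full_frame EB fB e7u e7h _ vh); congr (coord B _ v).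
  by apply: val_inj; rewrite /= !inordK //; apply: leqW.
have LE i j : (i < 6)%N -> (j < 6)%N -> coord f (inord i) (L f`_j) = lm i j.
  move=> i6 j6; have i7 := leqW i6; have j7 := leqW j6.
  rewrite cE ?L_mem ?f_mem // -[in RHS](@inordK 6 i) // -[in RHS](@inordK 6 j) // lmE.
  by rewrite full_frame_nth inordK.
rewrite /l /im_trace /mxtrace !big_ord_recl big_ord0 !mxE.
transitivity (coord f (inord 1) (L f`_0) +
  (coord f (inord 3) (L f`_2) + (coord f (inord 5) (L f`_4) + 0))); first by [].
by rewrite !LE // addr0 addrA.
Qed.

Lemma coord_comp (X Y : 'End(g)) (i j : 'I_7) : coord B i (X (Y (tnth B j))) =
  \sum_(k < 7) coord B i (X (tnth B k)) * coord B k (Y (tnth B j)).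
Proof.
rewrite {1}(basis_expand (Y (tnth B j)) BB) !linear_sum; apply: eq_bigr => k _.
by rewrite !linearZ mulrC.
Qed.

Lemma sqnormE : sqnorm s = s0 ^+ 2 + s1 ^+ 2 + s2 ^+ 2.
Proof.
rewrite /sqnorm !big_ord_recl big_ord0 addr0 addrA.
by congr (s _ ^+ 2 + s _ ^+ 2 + s _ ^+ 2); apply: val_inj.
Qed.

Lemma coord_X0 (i j : 'I_7) : coord B i (X0 (tnth B j)) = X_mx i j.
Proof.
have LE (x y : 'I_7) : coord B x (L (tnth B y)) = L_mx x y.
  by rewrite -lm_entries // coord_L /lm !am_coord.
have [j6|->] := ord7_split j; last first.
  rewrite B_last X0_e7 linearZ /= -B_last coord_tnth // sqnormE l_entries.
  case: i => [[|[|[|[|[|[|[|//]]]]]]] ?]; rewrite ?mulr0 //.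
  by rewrite /X_mx /X_entry /= mulr1 addrC.
have [i6|->] := ord7_split i; last first.
  rewrite coord_last ?X0_mem ?B_mem //.
  by case: j j6 => [[|[|[|[|[|[|[|//]]]]]]] ?].
have Lv : Lambda (tnth B j) = 0 := LambdaE.1 _ (B_mem j6).
have cSL : coord B i (commutator S L (tnth B j)) =
    \sum_(k < 7) (S_mx i k * L_mx k j - L_mx i k * S_mx k j).
  rewrite commutator_apply sumrB [LHS]linearB /= !coord_comp.
  by congr (_ - _); apply: eq_bigr => k _; rewrite S_entries LE.
rewrite X0_apply Lv addr0 linearN linearB /= Sigma_entries // cSL opprB addrC.
rewrite !big_ord_recl big_ord0.
case: i i6 {cSL} => [[|[|[|[|[|[|[|//]]]]]]] ?] //= _;
  case: j j6 Lv => [[|[|[|[|[|[|[|//]]]]]]] ?] //= _ _;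
  rewrite /bump /S_mx /L_mx /Sg_mx /X_mx /X_entry /mx_entry /=; ring.
Qed.

Lemma X0_symmetric i j : coord B i (X0 (tnth B j)) = coord B j (X0 (tnth B i)).
Proof.
rewrite !coord_X0.
case: i => [[|[|[|[|[|[|[|//]]]]]]] ?] //=;
  case: j => [[|[|[|[|[|[|[|//]]]]]]] ?] //=;
  rewrite /X_mx /X_entry /mx_entry /=; ring.
Qed.

Lemma bracket_frame (x y : 'I_7) : br (tnth B x) (tnth B y) = \sum_(m < 7)
  ((bracket_coef x y m).1%:~R * A_mx (bracket_coef x y m).2.1 (bracket_coef x y m).2.2)
    *: tnth B m.
Proof.
have AE (z : 'I_7) : br e7 (tnth B z) = \sum_(m < 7) A_mx m z *: tnth B m.
  by rewrite A_e7_expand; apply: eq_bigr => m _; rewrite am_entries.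
have [x6|->] := ord7_split x; last first.
  by rewrite B_last AE; apply: eq_bigr => m _; rewrite mul1r.
have [y6|->] := ord7_split y; last first.
  rewrite B_last (bracketC brxx) AE -sumrN; apply: eq_bigr => m _.
  by rewrite /bracket_coef ltn_eqF //= mulN1r scaleNr.
rewrite big1 => [|m _]; first by apply: ideal.2; apply: B_mem.
by rewrite /bracket_coef !ltn_eqF //= mul0r scale0r.
Qed.

(** Both sides are alternating and multilinear, so the polynomial identities on increasing indices
    suffice. *)
Lemma coflow_rhs_vartheta v : coflow_rhs br B v = vartheta X0 (Phi_std B) v.
Proof.
have Phi_lin := @Phi_std_mlin _ _ B.
have h_lin al : mlin (hodge B (al : kform g 4)) := @hodge_mlin _ _ B 4 al isT.
have h_alt al : is_alternating (hodge B (al : kform g 4)) :=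
  @hodge_alternating _ _ B 4 al isT.
move: v; apply: (alternating_ext BB).
- move=> v i c x y; rewrite /coflow_rhs (ext_d3_mlin br (h_lin _)); ring.
- exact: vartheta_mlin.
- move=> v i j ij vij; rewrite /coflow_rhs.
  by rewrite (ext_d3_alternating brxx (h_lin _) (h_alt _) ij vij) oppr0.
- exact: (vartheta_alternating _ Phi_lin (@Phi_std_alternating _ _ B)).
move=> K sK; rewrite (coflow_components BB brxx bracket_frame).
have XB j : X0 (tnth B j) = \sum_(m < 7) X_mx m j *: tnth B m.
  by rewrite {1}(basis_expand (X0 (tnth B j)) BB); apply: eq_bigr => m _; rewrite coord_X0.
rewrite (vartheta_components BB XB) /fval !fcompE.
by apply: laplacian_eq_sorted sK; exact: cos2Dsin2.
Qed.

Lemma X0_eigenbasis c : exists (U : 7.-tuple g) (d : 'I_7 -> R),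
  basis_of fullv U /\ forall i, (X0 - c *: \1%VF) (tnth U i) = d i *: tnth U i.
Proof.
apply: (symmetric_eigenbasis BB) => i j.
have cE (m n : 'I_7) : coord B m ((X0 - c *: \1%VF) (tnth B n)) =
    coord B m (X0 (tnth B n)) - c * (m == n)%:R.
  have -> (X : 'End(g)) v : (X - c *: \1%VF) v = X v - c *: v by rewrite !lfun_simp.
  by rewrite linearB linearZ /= coord_tnth.
by rewrite !cE X0_symmetric eq_sym.
Qed.

End AlmostAbelian.

(** * Reading the adapted frame off [omega] and [psi] *)

Section AdaptedTables.
Context {R : realType} {g : vectType R}.
Variables (E : 7.-tuple g) (h : {vspace g}) (e7 : g) (f : 6.-tuple g).
Variables (phi : kform g 3) (Phi : kform g 4).
Hypotheses (phiE : phi =1 phi_std E) (PhiE : Phi =1 Phi_std E).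
Hypothesis adapted : adapted_frame h (omega_ind e7 phi) (psi_ind e7 Phi) f.

Lemma adapted_omega i j : (i < 6)%N -> (j < 6)%N ->
  phi_std E [tuple e7; f`_i; f`_j] = (omZ [:: i; j])%:~R.
Proof.
case: adapted => fB om _ i6 j6.
have -> : [tuple e7; f`_i; f`_j] = [tuple of e7 :: map_tuple (tnth f)
    [tuple Ordinal i6; Ordinal j6]] by apply: val_inj; rewrite /= !(tnth_nth 0).
rewrite -phiE -[LHS]/(omega_ind e7 phi _) om => [|v]; last first.
  case/tnthP => k ->; rewrite tnth_map; exact: (basis_mem fB (mem_tnth _ _)).
rewrite /omZ 2!intrD.
by congr (_ + _ + _); apply: (coform_free _ (basis_free fB)).
Qed.

Lemma adapted_psi i j k : (i < 6)%N -> (j < 6)%N -> (k < 6)%N ->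
  Phi_std E [tuple e7; f`_i; f`_j; f`_k] = - (psZ [:: i; j; k])%:~R.
Proof.
case: adapted => fB _ ps i6 j6 k6.
have -> : [tuple e7; f`_i; f`_j; f`_k] = [tuple of e7 :: map_tuple (tnth f)
    [tuple Ordinal i6; Ordinal j6; Ordinal k6]].
  by apply: val_inj; rewrite /= !(tnth_nth 0).
rewrite -PhiE; apply: oppr_inj; rewrite opprK -[LHS]/(psi_ind e7 Phi _) ps => [|v].
  rewrite /psZ 3!intrD mulrNz.
  by congr (- _ + _ + _ + _); apply: (coform_free _ (basis_free fB)).
case/tnthP => m ->; rewrite tnth_map; exact: (basis_mem fB (mem_tnth _ _)).
Qed.

End AdaptedTables.

Theorem theorem4p2 (R : realType) (g : vectType R) (br : 'Hom(g, 'End(g)))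
    (h : {vspace g}) (e7 : g) (phi0 : kform g 3) (E : 7.-tuple g)
    (f : 6.-tuple g) (theta : R) (s : 'I_3 -> R) (Sigma Lambda : 'End(g)) :
  \dim (fullv : {vspace g}) = 7%N ->
  is_lie_bracket br ->
  \dim h = 6%N ->
  is_abelian_ideal br h ->
  G2_frame phi0 E ->
  let Phi0 : kform g 4 := hodge E phi0 in
  ext_d br Phi0 =1 (fun=> 0) ->
  metric E e7 e7 = 1 ->
  (forall v, v \in h -> metric E e7 v = 0) ->
  let A := br e7 in
  let At := transpose E A in
  let S := sympart E A in
  let L := skewpart E A in
  adapted_frame h (omega_ind e7 phi0) (psi_ind e7 Phi0) f ->
  0 <= theta <= 2 * pi ->
  diagonalizes f theta s S ->
  let l := im_trace f L in
  is_Sigma e7 f theta s Sigma ->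
  is_Lambda h e7 l Lambda ->
  let X0 := - (Sigma + Lambda - commutator S L) in
  (is_soliton br X0 <->
   exists c : R, forall v, v \in h ->
     commutator (- Sigma - 2^-1 *: commutator A At) A v =
       (l ^+ 2 + sqnorm s - c) *: A v) /\
  (forall c : R, soliton_with br X0 c ->
     let D := X0 - c *: \1%VF in
     let Phi : R -> kform g 4 :=
       fun t v => coflow_scale c t * exp_act (coflow_time c t) D Phi0 v in
     [/\ is_derivation br D,
         is_coflow_solution br Phi0 [set t | 0 < 1 - 2 * c * t] Phi &
         forall (I : set R) (Psi : R -> kform g 4),
           is_coflow_solution br Phi0 I Psi ->
           forall t, I t -> 0 < 1 - 2 * c * t -> Psi t =1 Phi t]).
Proof.
move=> _ [brxx _] _ ideal [EB phiE] Phi0 dPhi e7u e7h A At S L adapted _ diagS l.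
move=> SigmaE LambdaE X0.
have [fB _ _] := adapted.
have PhiE : Phi0 =1 Phi_std E.
  by move=> v; rewrite /Phi0 (hodge_ext E phiE) hodge_phi_std.
have om := adapted_omega phiE adapted; have ps := adapted_psi PhiE adapted.
pose B := full_frame e7 f.
have BB : basis_of fullv B := full_frame_basis EB fB e7u e7h.
(* The initial 4-form is standard in [B] as well, so the flow can be computed there although the
   statement refers to [E]. *)
have PhiB : Phi0 =1 Phi_std B.
  by move=> v; rewrite PhiE (adapted_Phi_std EB fB e7u e7h om ps).
have ortho := adapted_orthonormal EB fB e7u e7h om ps.
have closedPhi : ext_d br (Phi_std B) =1 (fun=> 0).
  by move=> v; rewrite -(@ext_d_ext _ _ br 3 _ _ PhiB).
have solE := soliton_eq EB fB e7u e7h brxx ideal ortho SigmaE LambdaE.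
split=> [|c sol D Phi].
  by split=> -[c /solE sol]; exists c.
have [D' [D'der X0D']] := sol.
(* For a given [c] the derivation in the soliton condition can only be [X0 - c]. *)
have DE : D = D' by rewrite /D X0D' addrAC subrr add0r.
have Dder : is_derivation br D by rewrite DE.
have X0D : X0 = c *: \1%VF + D by rewrite DE.
have [U [d [UB DU]]] :=
  X0_eigenbasis EB fB e7u e7h brxx ideal ortho diagS SigmaE LambdaE closedPhi c.
have lap := coflow_rhs_vartheta EB fB e7u e7h brxx ideal ortho diagS SigmaE LambdaE closedPhi.
have Phi_sol := coflow_existence BB UB DU Dder X0D closedPhi lap PhiB.
split=> // I Psi Psi_sol t It ct.
exact: (coflow_unique BB Psi_sol Phi_sol It ct).
Qed.
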